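(* Let $\Lambda=\Lambda_0\oplus\Lambda_1$ be a finite-dimensional commutative superalgebra satisfying conditions $(A_0)$ and $(A_1)$, and let $n,m\in\mathbb{N}$. Let $\Omega$ be a bounded domain of $\Lambda_0^n\times\Lambda_1^m$ whose boundary $\partial\Omega$ is connected, and let $f$ be a ($\Lambda$-valued) function that is qS-differentiable in a neighbourhood of $\partial\Omega$. Then $f$ extends to a qS-differentiable function on $\Omega$.
   Context: A commutative superalgebra (CSA) is a real associative unital algebra $\Lambda=\Lambda_0\oplus\Lambda_1$ (direct sum of real vector subspaces), here always of finite dimension, such that $\Lambda_0$ is a subalgebra, $\Lambda_1\Lambda_1\subset\Lambda_0$, $\Lambda_0\Lambda_1\subset\Lambda_1$, elements of $\Lambda_0$ commute with all elements of $\Lambda$, and any two elements of $\Lambda_1$ anticommute. The unit is $e_0=1\in\Lambda_0$. Write $\dim_{\mathbb{R}}\Lambda_0=p+1$ and $\dim_{\mathbb{R}}\Lambda_1=q$. Condition $(A_0)$: there is a basis $(e_0=1,e_1,\dots,e_p)$ of $\Lambda_0$ with $\sum_{k=0}^p e_k^2=0$. Condition $(A_1)$: there are a basis $(\varepsilon_1,\dots,\varepsilon_q)$ of $\Lambda_1$ and a finite sequence of integers $s_1=1<s_2<\dots<s_r<s_{r+1}=q+1$ such that for every $j=1,\dots,q$ there is $a_j\in\Lambda_0$ with $\varepsilon_j=a_j\varepsilon_{s_k}$ if $s_k\le j<s_{k+1}$, with $a_{s_1}=\dots=a_{s_r}=e_0$ and $\sum_{j=s_k}^{s_{k+1}-1}a_j^2=0$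 for every $k=1,\dots,r$. Fix such bases and data. Points of $\Lambda_0^n\times\Lambda_1^m$ are written $x=(y,\theta)=(y_1,\dots,y_n,\theta_1,\dots,\theta_m)$ with $y_i=\sum_{j=0}^p y_i^j e_j$ and $\theta_l=\sum_{k=1}^q\theta_l^k\varepsilon_k$, the $y_i^j,\theta_l^k$ being real coordinates. The Cauchy-Riemann operator on $\Lambda_0^n\times\Lambda_1^m$ is $$d''=\sum_{i=1}^n\sum_{j=1}^p dy_i^j\Big(\frac{\partial}{\partial y_i^j}-e_j\frac{\partial}{\partial y_i^0}\Big)+\sum_{l=1}^m\sum_{k=1}^r\sum_{i=s_k+1}^{s_{k+1}-1}d\theta_l^i\Big(\frac{\partial}{\partial\theta_l^i}-a_i\frac{\partial}{\partial\theta_l^{s_k}}\Big).$$ A map $F:U\to\Lambda$ on an open set $U\subset\Lambda_0^n\times\Lambda_1^m$ is qS-differentiable on $U$ if it is Fréchet-differentiable on $U$ and satisfies $d''F=0$ on $U$. A domain is a connected open set.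
   Formalization: Assumes the real dimension n(p+1)+mq of the superspace is not 2; this is automatic for n, m, q ≥ 1, and if n or m may be 0 (or Λ_1 = 0) it excludes only the one-complex-variable case, where 1/y near the unit circle does not extend. *)

(* Defs.v *)
From HB Require Import structures.
From mathcomp Require Import all_boot all_order all_algebra falgebra.
From mathcomp Require Import all_classical all_reals all_analysis.

Set Implicit Arguments.
Unset Strict Implicit.
Unset Printing Implicit Defensive.

Import Order.TTheory GRing.Theory Num.Theory.
Import numFieldNormedType.Exports.

Local Open Scope classical_set_scope.
Local Open Scope ring_scope.

(* A finite-dimensional real vector space with its usual topology, given by the
   sup norm of the coordinates in some basis; all norms being equivalent, openness,
   boundedness and Frechet differentiability do not depend on this choice. *)
Definition fdnormed (R : realType) (V : vectType R) : Type := V.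

Section FdNormed.
Variables (R : realType) (V : vectType R).

HB.instance Definition _ := Vector.on (fdnormed V).

Definition fdcoord (v : V) : 'rV[R]_(\dim {:V}) :=
  \row_i coord (vbasis {:V}) i v.

Definition fdnorm (v : fdnormed V) : R := `|fdcoord v|.

Lemma fdnormD (x y : fdnormed V) : fdnorm (x + y) <= fdnorm x + fdnorm y.
Proof.
rewrite /fdnorm; suff -> : fdcoord (x + y) = fdcoord x + fdcoord y.
  exact: ler_normD.
by apply/rowP => i; rewrite !mxE -linearD.
Qed.

Lemma fdnormZ (l : R) (x : fdnormed V) : fdnorm (l *: x) = `|l| * fdnorm x.
Proof.
rewrite /fdnorm; suff -> : fdcoord (l *: x) = l *: fdcoord x by exact: normrZ.
by apply/rowP => i; rewrite !mxE -[RHS]linearZ.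
Qed.

Lemma fdnorm0_eq0 (x : fdnormed V) : fdnorm x = 0 -> x = 0.
Proof.
move=> /normr0_eq0 /rowP x0.
have := coord_vbasis (memvf (x : V)); rewrite big1 // => i _.
by have := x0 i; rewrite !mxE => ->; rewrite scale0r.
Qed.

HB.instance Definition _ :=
  Lmodule_isNormed.Build R (fdnormed V) fdnormD fdnormZ fdnorm0_eq0.

End FdNormed.

Definition boundary (T : topologicalType) (A : set T) : set T :=
  closure A `\` interior A.

Section Superspace.
Variables (R : realType) (L : falgType R) (L0 L1 : {vspace L}).

Record is_csa : Prop := IsCSA {
  csa_sum : (L0 + L1 = fullv)%VS;
  csa_direct : directv (L0 + L1);
  csa_1 : 1 \in L0;
  csa_00 : (L0 * L0 <= L0)%VS;
  csa_11 : (L1 * L1 <= L0)%VS;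
  csa_01 : (L0 * L1 <= L1)%VS;
  csa_comm : forall a x : L, a \in L0 -> a * x = x * a;
  csa_anti : forall u v : L, u \in L1 -> v \in L1 -> u * v = - (v * u)
}.

Definition condA0 (p : nat) (e : p.+1.-tuple L) : Prop :=
  [/\ basis_of L0 e, e`_0 = 1 & \sum_(k < p.+1) e`_k ^+ 2 = 0].

(* Indices start at 0 and the blocks are [s k, s k.+1[ for k < r, with
   0 = s 0 < s 1 < ... < s r = q; so [s k] is the usual s_{k+1} - 1.
   Only the values s 0, ..., s r matter. *)
Record condA1 (q : nat) (eps : q.-tuple L) (r : nat) (s : nat -> nat)
    (a : q.-tuple L) : Prop := CondA1 {
  A1_basis : basis_of L1 eps;
  A1_first : s 0%N = 0%N;
  A1_last : s r = q;
  A1_incr : forall k, (k < r)%N -> (s k < s k.+1)%N;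
  A1_even : forall j, (j < q)%N -> a`_j \in L0;
  A1_eps : forall k j, (k < r)%N -> (s k <= j < s k.+1)%N ->
    eps`_j = a`_j * eps`_(s k);
  A1_unit : forall k, (k < r)%N -> a`_(s k) = 1;
  A1_squares : forall k, (k < r)%N -> \sum_(s k <= j < s k.+1) a`_j ^+ 2 = 0
}.

Variables n m : nat.

Definition superspace : Type :=
  fdnormed ({ffun 'I_n -> subvs_of L0} * {ffun 'I_m -> subvs_of L1})%type.

HB.instance Definition _ := NormedModule.on superspace.

(* The vector whose only nonzero component is the i-th even one, equal to v
   (resp. the l-th odd one); v is meant to be in L0 (resp. L1). *)
Definition ydir (i : 'I_n) (v : L) : superspace :=
  ([ffun i' => if i' == i then vsproj L0 v else 0], 0).

Definition tdir (l : 'I_m) (v : L) : superspace :=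
  (0, [ffun l' => if l' == l then vsproj L1 v else 0]).

Section CauchyRiemann.
Variables (p : nat) (e : p.+1.-tuple L).
Variables (q : nat) (eps : q.-tuple L) (r : nat) (s : nat -> nat)
  (a : q.-tuple L).

(* Real coordinates y_i^j and theta_l^k; being linear they are also the values
   of the forms dy_i^j and dtheta_l^k on a tangent vector. *)
Definition ycoord (i : 'I_n) (j : 'I_p.+1) (x : superspace) : R :=
  coord e j (vsval (x.1 i)).

Definition tcoord (l : 'I_m) (k : 'I_q) (x : superspace) : R :=
  coord eps k (vsval (x.2 l)).

Implicit Types (F : superspace -> fdnormed L) (x h : superspace).

(* Partial derivatives with respect to y_i^j and theta_l^k. *)
Definition dy F (i : 'I_n) (j : nat) x : L := 'D_(ydir i e`_j) F x.

Definition dt F (l : 'I_m) (k : nat) x : L := 'D_(tdir l eps`_k) F x.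

(* The L-valued 1-form d''F at x, evaluated at the tangent vector h. *)
Definition dbar F x h : L :=
  \sum_(i < n) \sum_(j < p.+1 | (0 < j)%N)
     ycoord i j h *: (dy F i j x - e`_j * dy F i 0 x) +
  \sum_(l < m) \sum_(k < r) \sum_(i < q | (s k < i < s k.+1)%N)
     tcoord l i h *: (dt F l i x - a`_i * dt F l (s k) x).

Definition qS_differentiable (U : set superspace) F : Prop :=
  forall x, U x -> differentiable F x /\ forall h, dbar F x h = 0.

End CauchyRiemann.

(* The superspace has real dimension n * p.+1 + m * q. *)
Lemma superspace_dim_neq2 (p q : nat) (e : p.+1.-tuple L) :
  condA0 e -> (0 < n)%N -> (0 < m)%N -> (0 < q)%N ->
  (n * p.+1 + m * q != 2)%N.
Proof.
case: p e => [|p] e [_ e0 sq] n0 m0 q0; last first.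
  have h1 : (2 <= n * p.+2)%N by rewrite (leq_trans _ (leq_pmull _ n0)).
  have h2 : (1 <= m * q)%N by rewrite muln_gt0 m0.
  by rewrite gtn_eqF// -(addn1 2) leq_add.
by move: sq; rewrite big_ord1 /= e0 expr1n => /eqP; rewrite oner_eq0.
Qed.

End Superspace.

(* Main.v *)
(** For a tangent vector h, a combination of coordinate vectors of one of the groups
    y_i or theta_l^(block k), let c be the same combination of the coefficients e_j or
    a_j and u the first coordinate vector of the group: qS-differentiability says that
    D_h f = c D_u f. In every character of Lambda_0 the coefficients of a group are
    complex numbers with sum of squares 0, one of them being 1, so they are not all
    real; hence a generic c is nonreal: s + t c is invertible for all real
    (s, t) <> (0, 0). Such operators D_h - c D_u span all the equations, and each has a
    Cauchy kernel, hence a Cauchy-Pompeiu formula in the plane of u and h and a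
    compactly supported theory of the equation D_h v - c D_u v = g.

    The extension follows Ehrenpreis. Let xi be 0 near the part of Omega where f is
    not defined and 1 off Omega. The Cauchy transform v of (D_h xi - c D_u xi) f in one
    fixed plane solves the corresponding equations for all the planes, as the
    coefficients are central. Since the real dimension is not 2, some linear form
    vanishes on the fixed plane, so v is 0 near a point of the boundary, where this form
    is maximal on Omega. Unique continuation, applied along the connected boundary,
    gives v = 0 near all of it, and xi f - v is the required extension. *)

Require Import Defs.
From HB Require Import structures.
From mathcomp Require Import all_boot all_order all_algebra falgebra.
From mathcomp Require Import all_classical all_reals all_analysis.
From mathcomp Require Import ring lra complex spectral.
Set Implicit Arguments.
Unset Strict Implicit.
Unset Printing Implicit Defensive.
Import Order.TTheory GRing.Theory Num.Theory.
Import numFieldNormedType.Exports.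
Local Open Scope classical_set_scope.
Local Open Scope ring_scope.

(** * Finite-dimensional normed spaces *)

(** Frechet differentiability says nothing on the continuity of the derivatives, whereas the source
    (D_h xi - c D_u xi) f has to be differentiated; so regularity comes first, from Goursat's
    bisection and a Cauchy formula for the first derivative. The coefficients lie in an algebra that
    may have nilpotents: complex analysis is redone in each real plane R + R c, without assuming c^2
    = -1. There 2 pi i becomes an element [kappa c] that has to be proved invertible, and unique
    continuation rests on division by z - p and the mean value formula rather than on power series.
    Let P_i be the operators D_h - c D_u, let T be the Cauchy transform inverting P_0 on the right,
    and a_i = (P_i xi) f. The P_i commute and kill f, so P_j a_i = P_i a_j; hence P_j T a_0 = T P_j
    a_0 = T P_0 a_j = a_j, the last equality by Cauchy-Pompeiu because a_j has bounded support. A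
    cutoff of class C^2 suffices, since T only has to differentiate a_i once. *)

HB.mixin Record isFiniteDimensional (R : realType) V & NormedModule R V := {
  fddim : nat ;
  fdbasis : 'I_fddim -> V ;
  fdc : 'I_fddim -> V -> R ;
  fdcP : forall i (k : R) (x y : V), fdc i (k *: x + y) = k * fdc i x + fdc i y ;
  fdc_sum : forall x : V, x = \sum_i fdc i x *: fdbasis i ;
  fdc_sumK : forall (c : 'I_fddim -> R) i, fdc i (\sum_j c j *: fdbasis j) = c i ;
  ler_fdc : forall i (x : V), `|fdc i x| <= `|x| ;
  fdnorm_le : forall (x : V) (M : R), 0 <= M ->
    (forall i, `|fdc i x| <= M) -> `|x| <= M
}.

#[short(type="fdModType")]
HB.structure Definition FdModule (R : realType) :=
  { V of NormedModule R V & isFiniteDimensional R V }.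

Arguments fddim {R} s.
Arguments fdbasis {R s} _.
Arguments fdc {R s} _ _.
Arguments fdc_sum {R s} x.
Arguments fdnorm_le {R s} x M.

HB.instance Definition _ (R : realType) (L : falgType R) :=
  Falgebra.on (fdnormed L).

Section FdNormedInstance.
Variables (R : realType) (X : vectType R).
Implicit Types x y : fdnormed X.

Local Notation n := (\dim {:X}).

Let fdbasis (i : 'I_n) : fdnormed X := (vbasis {:X})`_i.

Let fdc (i : 'I_n) (x : fdnormed X) : R := coord (vbasis {:X}) i x.

Let fdcP i (k : R) x y : fdc i (k *: x + y) = k * fdc i x + fdc i y.
Proof. exact: linearP. Qed.

Let fdc_sum x : x = \sum_i fdc i x *: fdbasis i.
Proof. exact: coord_vbasis (memvf (x : X)). Qed.

Let fdc_sumK (c : 'I_n -> R) i : fdc i (\sum_j c j *: fdbasis j) = c i.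
Proof. by have := coord_sum_free c i (basis_free (vbasisP {:X})). Qed.

Let ler_fdc i x : `|fdc i x| <= `|x|.
Proof.
change (`|fdc i x| <= `|@fdcoord R X x|).
rewrite [leRHS]/Num.norm /= mx_normrE.
have -> : fdc i x = @fdcoord R X x 0 i by rewrite mxE.
exact: (le_bigmax _ (fun ij => `|@fdcoord R X x ij.1 ij.2|) (0, i)).
Qed.

Let fdnorm_le x (M : R) : 0 <= M -> (forall i, `|fdc i x| <= M) -> `|x| <= M.
Proof.
move=> M0 xM; change (`|@fdcoord R X x| <= M).
rewrite [leLHS]/Num.norm /= mx_normrE.
apply: bigmax_le => // -[i j] _ /=; rewrite !mxE; exact: xM.
Qed.

HB.instance Definition _ := isFiniteDimensional.Build R (fdnormed X)
  fdcP fdc_sum fdc_sumK ler_fdc fdnorm_le.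

End FdNormedInstance.

(* Keeps unification from unfolding [fdnormed X] to the structure-less [X]. *)
Opaque fdnormed.

Section NormedModules.
Variable R : realType.
Implicit Types V W : normedModType R.

Lemma near_dist_lt V (x : V) (e : R) :
  0 < e -> \forall y \near x, `|x - y| < e.
Proof. by move=> e0; near=> y; near: y; exact: cvgr_dist_lt.
Unshelve. all: by end_near. Qed.

Lemma lipschitz_at_continuous V W (f : V -> W) x (M : R) :
  (forall y, `|f x - f y| <= M * `|x - y|) -> {for x, continuous f}.
Proof.
move=> fM; apply/cvgrPdist_lt => e e0; near=> y.
rewrite (le_lt_trans (fM _))//.
have M1 : 0 < 1 + `|M| by rewrite ltr_pwDl.
rewrite (@le_lt_trans _ _ ((1 + `|M|) * `|x - y|))//.
  by rewrite ler_wpM2r// (le_trans (ler_norm M))// lerDr.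
rewrite -ltr_pdivlMl// mulrC.
by near: y; apply: near_dist_lt; rewrite divr_gt0.
Unshelve. all: by end_near. Qed.

End NormedModules.

Section FiniteDimension.
Variables (R : realType) (X : fdModType R).
Implicit Types x y : X.
Local Notation n := (fddim X).

Lemma fdc_is_linear (i : 'I_n) : linear (fdc i : X -> R).
Proof. by move=> k x y; exact: fdcP. Qed.

HB.instance Definition _ i := GRing.isLinear.Build R X
  R *%R (fdc i) (fdc_is_linear i).

Lemma fdcZ (i : 'I_n) k x : fdc i (k *: x) = k * fdc i x.
Proof. exact: linearZ. Qed.

Lemma fdcD (i : 'I_n) x y : fdc i (x + y) = fdc i x + fdc i y.
Proof. exact: raddfD. Qed.

Lemma fdcN (i : 'I_n) x : fdc i (- x) = - fdc i x.
Proof. exact: raddfN. Qed.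

Lemma fd_ext x y : (forall i : 'I_n, fdc i x = fdc i y) -> x = y.
Proof. by move=> xy; rewrite (fdc_sum x) (fdc_sum y); apply: eq_bigr => i _; rewrite xy. Qed.

Lemma fd_linear_bounded (W : normedModType R) (f : {linear X -> W}) :
  exists2 M, 0 < M & forall x, `|f x| <= M * `|x|.
Proof.
exists (1 + \sum_(i < n) `|f (fdbasis i)|).
  by rewrite ltr_wpDr// sumr_ge0.
move=> x; rewrite {1}(fdc_sum x) linear_sum.
rewrite (le_trans (ler_norm_sum _ _ _))// mulrDl mul1r ler_wpDl// mulr_suml.
apply: ler_sum => i _; rewrite linearZ normrZ mulrC ler_wpM2l//.
exact: ler_fdc.
Qed.

Lemma fd_linear_continuous (W : normedModType R) (f : {linear X -> W}) :
  continuous f.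
Proof.
have [M M0 fM] := fd_linear_bounded f.
by move=> x; apply: (@lipschitz_at_continuous _ _ _ _ _ M) => y; rewrite -linearB.
Qed.

Definition fdrow (x : X) : 'rV[R]_n := \row_i fdc i x.

Lemma fdnormE x : `|x| = `|fdrow x|.
Proof.
apply/eqP; rewrite eq_le; apply/andP; split.
  apply: fdnorm_le => // i; rewrite [leRHS]/Num.norm /= mx_normrE.
  have -> : fdc i x = fdrow x 0 i by rewrite mxE.
  exact: (le_bigmax _ (fun ij => `|fdrow x ij.1 ij.2|) (0, i)).
rewrite [leLHS]/Num.norm /= mx_normrE.
by apply: bigmax_le => // -[i j] _ /=; rewrite !mxE; exact: ler_fdc.
Qed.

(** The coordinates give an isometry with row vectors under the sup norm, for which the result is
    known. *)
Lemma fd_bounded_closed_compact (A : set X) :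
  bounded_set A -> closed A -> compact A.
Proof.
move=> bA cA.
pose dec (v : 'rV[R]_n) : X := \sum_i v ord0 i *: fdbasis i.
have decK : cancel dec fdrow.
  by move=> v; apply/rowP => i; rewrite mxE; exact: fdc_sumK.
have fdrowK : cancel fdrow dec.
  move=> x; rewrite [RHS]fdc_sum; apply: eq_bigr => i _.
  by rewrite mxE.
have decB v w : dec v - dec w = dec (v - w).
  rewrite /dec -sumrB; apply: eq_bigr => i _.
  by rewrite -scalerBl !mxE.
have ndec v : `|dec v| = `|v| by rewrite fdnormE decK.
have cdec : continuous dec.
  move=> v; apply: (@lipschitz_at_continuous _ _ _ _ _ 1) => w.
  by rewrite decB ndec mul1r.
have -> : A = dec @` (dec @^-1` A).
  rewrite eqEsubset; split => [x Ax|_ [v Av <-]//].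
  by exists (fdrow x) => //=; rewrite /preimage/= fdrowK.
apply: continuous_compact; first exact: continuous_subspaceT.
apply: bounded_closed_compact.
  case: bA => M [Mr AM]; exists M; split => // N MN v /= /(AM N MN) /=.
  by rewrite ndec.
by apply: preimage_closed => // v _; exact: cdec.
Qed.

End FiniteDimension.

(** Proves identities that are real-linear in the vectors by reading them in every coordinate;
    products of algebra elements stay atoms. *)
Ltac fd_ring := apply: fd_ext => ?; rewrite ?(fdcD, fdcN, fdcZ); ring.

Section Bilinear.
Variable R : realType.

Lemma fd_bilinear_bounded (U V : fdModType R) (W : normedModType R)
    (B : U -> V -> W) :
  (forall v, linear (B^~ v)) -> (forall u, linear (B u)) ->
  exists2 K : R, 0 < K & forall u v, `|B u v| <= K * `|u| * `|v|.
Proof.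
move=> Bl Br.
pose m (i : 'I_(fddim U)) := HB.pack_for {linear V -> W} (B (fdbasis i))
  (GRing.isLinear.Build _ _ _ _ _ (Br (fdbasis i))).
have /choice[M Mm] : forall i, exists M : R, 0 < M /\ forall y, `|m i y| <= M * `|y|.
  by move=> i; have [M ? ?] := fd_linear_bounded (m i); exists M.
exists (1 + \sum_i M i).
  by rewrite ltr_wpDr// sumr_ge0// => i _; apply: ltW; exact: (Mm i).1.
move=> x y; pose l := HB.pack_for {linear U -> W} (B^~ y)
  (GRing.isLinear.Build _ _ _ _ _ (Bl y)).
rewrite {1}(fdc_sum x) -[B _ _]/(l _) linear_sum.
rewrite (le_trans (ler_norm_sum _ _ _))// -mulrA mulrDl mul1r ler_wpDl ?mulr_ge0//.
rewrite mulr_suml; apply: ler_sum => i _; rewrite linearZ normrZ.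
rewrite mulrCA ler_pM//; [exact: ler_fdc | exact: (Mm i).2].
Qed.

End Bilinear.

(** * Differential calculus *)

Section Derivatives.
Variable R : realType.
Implicit Types U V W : normedModType R.

(** The form without quotient allows h = 0 and turns a derivative into an estimate valid near 0. *)
Lemma is_deriveP U V (f : U -> V) x v d :
  is_derive x v f d <->
  (forall e, 0 < e ->
     \forall h \near (0 : R), `|f (h *: v + x) - f x - h *: d| <= e * `|h|).
Proof.
split=> [[fx fd] e e0|fx].
  have : (fun h => h^-1 *: ((f \o shift x) (h *: v) - f x)) @ 0^' --> d.
    by rewrite -fd; exact: fx.
  move/cvgrPdist_le => /(_ _ e0); rewrite near_withinE => H.
  near=> h; have [->|h0] := eqVneq h 0.
    by rewrite !scale0r add0r !subrr !normr0 mulr0.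
  have /(_ h0) /= Hh : h != 0 -> `|d - h^-1 *: ((f \o shift x) (h *: v) - f x)| <= e.
    by near: h; exact: H.
  rewrite mulrC -ler_pdivrMl ?normr_gt0// -normrV ?unitfE// -normrZ.
  by rewrite scalerBr scalerA mulVf// scale1r distrC.
have fxd : (fun h => h^-1 *: ((f \o shift x) (h *: v) - f x)) @ 0^' --> d.
  apply/cvgrPdist_le => e e0; rewrite near_withinE.
  near=> h => h0 /=.
  rewrite -(scale1r d) -(mulVf h0) -scalerA -scalerBr normrZ distrC normrV ?unitfE//.
  rewrite ler_pdivrMl ?normr_gt0// mulrC.
  by near: h; exact: fx.
by split; [apply/cvg_ex; exists d | exact/cvg_lim].
Unshelve. all: by end_near. Qed.

Lemma is_derive_unique U V (f : U -> V) x v d d' :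
  is_derive x v f d -> is_derive x v f d' -> d = d'.
Proof. by move=> [_ <-] [_ <-]. Qed.

Lemma differentiable_is_derive U V (f : U -> V) x v :
  differentiable f x -> is_derive x v f ('d f x v).
Proof.
by move=> fx; split; [exact: diff_derivable | rewrite deriveE].
Qed.

Lemma is_derive_ext U V (f g : U -> V) x v d :
  f =1 g -> is_derive x v f d -> is_derive x v g d.
Proof. by move=> /funext <-. Qed.

Lemma near_eq_is_derive_ext U V (f g : U -> V) x v d :
  (\forall y \near x, f y = g y) -> is_derive x v f d -> is_derive x v g d.
Proof.
move=> fg /is_deriveP fd; apply/is_deriveP => e e0.
have fgx : f x = g x by exact: nbhs_singleton fg.
have c0 : h *: v + x @[h --> (0 : R)] --> x.
  rewrite -[X in _ --> X]add0r -[X in X + _](scale0r v).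
  by apply: cvgD; [apply: cvgZr_tmp; exact: cvg_id | exact: cvg_cst].
near=> h; rewrite -fgx -(_ : f (h *: v + x) = g (h *: v + x)); first by near: h; exact: fd.
by near: h; exact: (c0 _ fg).
Unshelve. all: by end_near. Qed.

Lemma cvg_shift0 V (x : V) : y - x @[y --> x] --> (0 : V).
Proof. by rewrite -(subrr x); apply: cvgB; [exact: cvg_id | exact: cvg_cst]. Qed.

Lemma cvg_0shift V (x : V) : h + x @[h --> (0 : V)] --> x.
Proof.
by rewrite -[X in _ --> X](add0r x); apply: cvgD; [exact: cvg_id | exact: cvg_cst].
Qed.

Lemma differentiableP_eps U V (f : U -> V) x : differentiable f x ->
  forall e : R, 0 < e ->
    \forall y \near x, `|f y - f x - 'd f x (y - x)| <= e * `|y - x|.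
Proof.
move=> fx e e0; have [_ H] := (diff_locallyP x f).1 fx.
have /eqaddoP/(_ e e0) {}H := eqaddoE H.
near=> y.
suff : `|(f \o shift x - (cst (f x) + 'd f x)) (y - x)| <= e * `|y - x|.
  by rewrite !fctE /= subrK opprD addrA.
by near: y; exact: (cvg_shift0 x H).
Unshelve. all: by end_near. Qed.

Lemma differentiable_epsP U V (f : U -> V) (l : {linear U -> V}) x :
  continuous l ->
  (forall e : R, 0 < e ->
    \forall y \near x, `|f y - f x - l (y - x)| <= e * `|y - x|) ->
  differentiable f x /\ 'd f x = l :> (U -> V).
Proof.
move=> cl H.
have fo : f \o shift x = cst (f x) + l +o_ (0 : U) id.
  apply/eqaddoP => e e0; near=> h.
  suff : `|f (h + x) - f x - l (h + x - x)| <= e * `|h + x - x|.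
    by rewrite !fctE /= addrK opprD addrA.
  by near: h; exact: (cvg_0shift (H _ e0)).
have dE := diff_unique cl fo.
by split=> //; apply/diff_locallyP; rewrite dE.
Unshelve. all: by end_near. Qed.

Lemma near_eq_differentiable U V (f g : U -> V) x :
  (\forall y \near x, f y = g y) -> differentiable f x ->
  differentiable g x /\ 'd g x = 'd f x :> (U -> V).
Proof.
move=> fg fx; apply: differentiable_epsP; first exact: diff_continuous.
move=> e e0; have fgx : f x = g x by exact: nbhs_singleton fg.
by apply: filterS2 fg (differentiableP_eps fx e0) => y <-; rewrite fgx.
Qed.

Lemma is_derive_lin U V W (l : {linear V -> W}) (f : U -> V) x v d :
  continuous l -> is_derive x v f d -> is_derive x v (l \o f) (l d).
Proof.
move=> cl [fx fd].
have fxd : (fun h => h^-1 *: ((f \o shift x) (h *: v) - f x)) @ 0^' --> d.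
  by rewrite -fd; exact: fx.
have : (fun h => h^-1 *: ((l \o f \o shift x) (h *: v) - (l \o f) x)) @ 0^' --> l d.
  have := cvg_comp _ _ fxd (cl d).
  apply: cvg_trans; apply: near_eq_cvg; apply: nearW => h.
  by rewrite /= linearZ linearB.
by move=> H; split; [apply/cvg_ex; exists (l d) | exact/cvg_lim].
Qed.

Lemma is_derive_differentiable V (f : R -> V) (t : R) d :
  is_derive t 1 f d -> differentiable f t /\ 'd f t = (fun h : R => h *: d) :> (R -> V).
Proof.
move=> [ft fd]; split; first exact/derivable1_diffP.
by rewrite deriv1E// derive1E fd.
Qed.

Lemma is_derive_continuous V (f : R -> V) (t : R) d :
  is_derive t 1 f d -> {for t, continuous f}.
Proof.
by move=> /is_derive_differentiable[+ _]; exact: differentiable_continuous.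
Qed.

Lemma is_derive_curve V W (f : V -> W) (g : R -> V) (t : R) d :
  is_derive t 1 g d -> differentiable f (g t) ->
  is_derive t 1 (f \o g) ('d f (g t) d).
Proof.
move=> /is_derive_differentiable[dg gE] df.
have dfg : differentiable (f \o g) t by exact: differentiable_comp.
split; first exact/derivable1_diffP.
by rewrite deriveE// diff_comp// gE /= scale1r.
Qed.

Lemma is_derive_line U V (f : U -> V) x v (t : R) d :
  is_derive (t *: v + x) v f d -> is_derive t 1 (fun s => f (s *: v + x)) d.
Proof.
move=> /is_deriveP fd; apply/is_deriveP => e e0.
apply: filterS (fd _ e0) => h.
by rewrite addrA -scalerDl [h *: 1]mulr1.
Qed.

(** With [is_derive_line], it reduces directional derivatives to derivatives in one real
    variable. *)
Lemma is_derive_at_line U V (f : U -> V) x v d :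
  is_derive (0 : R) 1 (fun s => f (s *: v + x)) d -> is_derive x v f d.
Proof.
move=> /is_deriveP fd; apply/is_deriveP => e e0.
apply: filterS (fd _ e0) => h.
by rewrite scale0r add0r addr0 [h *: 1]mulr1.
Qed.

Lemma bilinear_identities U V W (B : U -> V -> W) :
  (forall v, linear (B^~ v)) -> (forall u, linear (B u)) ->
  [/\ forall a a' b, B (a - a') b = B a b - B a' b,
      forall a b b', B a (b - b') = B a b - B a b',
      forall k a b, B (k *: a) b = k *: B a b &
      forall k a b, B a (k *: b) = k *: B a b].
Proof.
move=> Bl Br.
have BBl a a' b : B (a - a') b = B a b - B a' b.
  by have := Bl b (-1) a' a; rewrite /= !scaleN1r [- a' + a]addrC [X in _ = X]addrC.
have BBr a b b' : B a (b - b') = B a b - B a b'.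
  by have := Br a (-1) b' b; rewrite /= !scaleN1r [- b' + b]addrC [X in _ = X]addrC.
split=> // k a b.
  have B0 : B 0 b = 0 by rewrite -(subrr 0) BBl subrr.
  by have := Bl b k a 0; rewrite /= !addr0 B0 addr0.
have B0 : B a 0 = 0 by rewrite -(subrr 0) BBr subrr.
by have := Br a k b 0; rewrite /= !addr0 B0 addr0.
Qed.

Lemma cvg_bilinear U V W (B : U -> V -> W) (K : R) (T : Type) (F : set_system T)
    {FF : Filter F} (u : T -> U) (v : T -> V) u0 v0 :
  (forall v, linear (B^~ v)) -> (forall u, linear (B u)) ->
  (forall u v, `|B u v| <= K * `|u| * `|v|) ->
  u @ F --> u0 -> v @ F --> v0 -> B (u t) (v t) @[t --> F] --> B u0 v0.
Proof.
move=> Bl Br BK uF vF.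
have [K' K0 {}BK] : exists2 K' : R, 0 < K' & forall a b, `|B a b| <= K' * `|a| * `|b|.
  exists (`|K| + 1) => [|a b]; first by rewrite ltr_wpDl.
  rewrite (le_trans (BK a b))// -!mulrA ler_wpM2r ?mulr_ge0//.
  by rewrite (le_trans (ler_norm K))// lerDl.
have [BBl BBr BZl BZr] := bilinear_identities Bl Br.
apply/cvgrPdist_lt => e e0; near=> t.
have -> : B u0 v0 - B (u t) (v t) = B (u0 - u t) (v t) + B u0 (v0 - v t).
  by rewrite BBl BBr [RHS]addrC subrKA.
have v1 : `|v t| <= `|v0| + 1.
  have : `|v0 - v t| < 1 by near: t; exact: cvgr_dist_lt.
  move=> /ltW v1; rewrite -(subrK v0 (v t)) addrC (le_trans (ler_normD _ _))//.
  by rewrite lerD2l distrC.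
have V0 : 0 < `|v0| + 1 by rewrite ltr_wpDl.
have U0 : 0 < `|u0| + 1 by rewrite ltr_wpDl.
rewrite (le_lt_trans (ler_normD _ _))// (splitr e) ltrD//.
  rewrite (le_lt_trans (BK _ _))//.
  rewrite (@le_lt_trans _ _ (K' * (`|v0| + 1) * `|u0 - u t|))//.
    by rewrite -mulrA -[leRHS]mulrA ler_wpM2l ?(ltW K0)// [leRHS]mulrC ler_wpM2l.
  rewrite -ltr_pdivlMl ?mulr_gt0//; near: t; apply: cvgr_dist_lt => //.
  by rewrite mulr_gt0 ?invr_gt0 ?mulr_gt0 ?divr_gt0.
rewrite (le_lt_trans (BK _ _))//.
rewrite (@le_lt_trans _ _ (K' * (`|u0| + 1) * `|v0 - v t|))//.
  by rewrite ler_wpM2r// ler_wpM2l ?(ltW K0)// lerDl.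
rewrite -ltr_pdivlMl ?mulr_gt0//; near: t; apply: cvgr_dist_lt => //.
by rewrite mulr_gt0 ?invr_gt0 ?mulr_gt0 ?divr_gt0.
Unshelve. all: by end_near. Qed.

Lemma is_derive_bilinear U' U V W (B : U -> V -> W) (K : R)
    (f : U' -> U) (g : U' -> V) x v df dg :
  (forall v, linear (B^~ v)) -> (forall u, linear (B u)) ->
  (forall u v, `|B u v| <= K * `|u| * `|v|) ->
  is_derive x v f df -> is_derive x v g dg ->
  is_derive x v (fun y => B (f y) (g y)) (B df (g x) + B (f x) dg).
Proof.
move=> Bl Br BK fd gd; apply: is_derive_at_line.
have {}fd : is_derive (0 : R) 1 (fun s => f (s *: v + x)) df.
  by apply: is_derive_line; rewrite scale0r add0r.
have {}gd : is_derive (0 : R) 1 (fun s => g (s *: v + x)) dg.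
  by apply: is_derive_line; rewrite scale0r add0r.
move: fd gd.
set f' := (fun s : R => f _); set g' := (fun s : R => g _) => fd gd.
have -> : f x = f' 0 by rewrite /f' scale0r add0r.
have -> : g x = g' 0 by rewrite /g' scale0r add0r.
rewrite -[X in is_derive _ _ X _]/(fun s => B (f' s) (g' s)).
(* A directional derivative gives no continuity on [U'], but it does along the line; hence the
   restriction to the line. *)
have cg := is_derive_continuous gd.
have [BBl BBr BZl BZr] := bilinear_identities Bl Br.
have qf : (fun h : R => h^-1 *: ((f' \o shift 0) (h *: 1) - f' 0)) @ 0^' --> df.
  by case: fd => fx <-; exact: fx.
have qg : (fun h : R => h^-1 *: ((g' \o shift 0) (h *: 1) - g' 0)) @ 0^' --> dg.
  by case: gd => gx <-; exact: gx.
have g0 : g' h @[h --> 0^'] --> g' 0 by apply: cvg_trans cg; apply: cvg_app; exact: nbhs_dnbhs.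
have H : (fun h : R => h^-1 *: (((fun s => B (f' s) (g' s)) \o shift 0) (h *: 1)
   - B (f' 0) (g' 0))) @ 0^' --> B df (g' 0) + B (f' 0) dg.
  under eq_fun => h.
    have -> : h^-1 *: (((fun s => B (f' s) (g' s)) \o shift 0) (h *: 1)
       - B (f' 0) (g' 0)) =
      B (h^-1 *: ((f' \o shift 0) (h *: 1) - f' 0)) (g' h)
      + B (f' 0) (h^-1 *: ((g' \o shift 0) (h *: 1) - g' 0)).
      rewrite /= !addr0 [h *: 1]mulr1 BZl BZr -scalerDr BBl BBr; congr (_ *: _).
      by rewrite addrA subrK.
    over.
  apply: cvgD; apply: cvg_bilinear BK _ _ => //; exact: cvg_cst.
by split; [apply/cvg_ex; eexists; exact: H | apply/cvg_lim => //].
Unshelve. all: by end_near. Qed.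

Lemma differentiable_bilinear U' U V W (B : U -> V -> W) (K : R)
    (f : U' -> U) (g : U' -> V) x :
  (forall v, linear (B^~ v)) -> (forall u, linear (B u)) ->
  (forall u v, `|B u v| <= K * `|u| * `|v|) ->
  differentiable f x -> differentiable g x ->
  differentiable (fun y => B (f y) (g y)) x.
Proof.
move=> Bl Br BK df dg.
have Bbil : bilinear_for (GRing.Scale.Law.clone _ _ *:%R _)
    (GRing.Scale.Law.clone _ _ *:%R _) B.
  by split=> [u'|u] k a b; [exact: Bl | exact: Br].
pose Bm := bilinear_isBilinear.Build R U V W _ _ B Bbil.
pose BB : {bilinear U -> V -> W} := HB.pack B Bm.
have cB : continuous (fun p : U * V => BB p.1 p.2).
  by move=> p; apply: (cvg_bilinear Bl Br BK); [exact: cvg_fst | exact: cvg_snd].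
have := @differentiable_comp _ _ _ _ (fun y => (f y, g y)) (fun p => BB p.1 p.2) x.
by apply; [exact: differentiable_pair | exact: differentiable_bilin].
Qed.

Lemma differentiable_fst U V (z : U * V) : differentiable (fun z : U * V => z.1) z.
Proof.
have lin : linear (fun z : U * V => z.1) by [].
pose l := HB.pack_for {linear (U * V)%type -> U} (fun z : U * V => z.1)
  (GRing.isLinear.Build _ _ _ _ _ lin).
by apply: (@linear_differentiable _ _ _ l); move=> y; exact: cvg_fst.
Qed.

Lemma differentiable_snd U V (z : U * V) : differentiable (fun z : U * V => z.2) z.
Proof.
have lin : linear (fun z : U * V => z.2) by [].
pose l := HB.pack_for {linear (U * V)%type -> V} (fun z : U * V => z.2)
  (GRing.isLinear.Build _ _ _ _ _ lin).
by apply: (@linear_differentiable _ _ _ l); move=> y; exact: cvg_snd.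
Qed.

Lemma differentiable_scale U V (a : U -> R) (f : U -> V) x :
  differentiable a x -> differentiable f x -> differentiable (fun y => a y *: f y) x.
Proof.
apply: (@differentiable_bilinear _ _ _ _ (fun (k : R) (w : V) => k *: w) 1).
- by move=> w k s t; rewrite scalerDl scalerA.
- by move=> r k s t; rewrite scalerDr !scalerA mulrC.
- by move=> r w; rewrite mul1r normrZ.
Qed.

Section ContinuousAt.
Variables (T : topologicalType) (t : T).

Lemma cont_dist_lt V (f : T -> V) (e : R) : {for t, continuous f} -> 0 < e ->
  \forall s \near t, `|f t - f s| < e.
Proof. by move=> cf e0; near=> s; near: s; exact: cvgr_dist_lt.
Unshelve. all: by end_near. Qed.

Lemma contP V (f : T -> V) :
  (forall e : R, 0 < e -> \forall s \near t, `|f t - f s| < e) -> {for t, continuous f}.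
Proof. by move=> H; exact/cvgrPdist_lt. Qed.

Lemma contD V (f g : T -> V) : {for t, continuous f} -> {for t, continuous g} ->
  {for t, continuous (fun s => f s + g s)}.
Proof. by move=> cf cg; exact: cvgD. Qed.

Lemma contB V (f g : T -> V) : {for t, continuous f} -> {for t, continuous g} ->
  {for t, continuous (fun s => f s - g s)}.
Proof. by move=> cf cg; exact: cvgB. Qed.

Lemma contZr V (k : R) (f : T -> V) : {for t, continuous f} ->
  {for t, continuous (fun s => k *: f s)}.
Proof. by move=> cf; apply: cvgZ => //; exact: cvg_cst. Qed.

Lemma contZ V (a : T -> R) (f : T -> V) : {for t, continuous a} ->
  {for t, continuous f} -> {for t, continuous (fun s => a s *: f s)}.
Proof. by move=> ca cf; exact: cvgZ. Qed.

Lemma cont_cst V (v : V) : {for t, continuous (fun _ : T => v)}.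
Proof. exact: cvg_cst. Qed.

Lemma cont_comp (T' T'' : topologicalType) (f : T -> T') (g : T' -> T'') :
  {for t, continuous f} -> {for f t, continuous g} ->
  {for t, continuous (fun s => g (f s))}.
Proof. by move=> cf cg; exact: (continuous_comp cf). Qed.

Lemma cont_pair (T' T'' : topologicalType) (f : T -> T') (g : T -> T'') :
  {for t, continuous f} -> {for t, continuous g} ->
  {for t, continuous (fun s => (f s, g s))}.
Proof. by move=> cf cg; exact: cvg_pair. Qed.

Lemma cont_bilinear U V W (B : U -> V -> W) (K : R) (f : T -> U) (g : T -> V) :
  (forall v, linear (B^~ v)) -> (forall u, linear (B u)) ->
  (forall u v, `|B u v| <= K * `|u| * `|v|) ->
  {for t, continuous f} -> {for t, continuous g} ->
  {for t, continuous (fun s => B (f s) (g s))}.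
Proof. by move=> Bl Br BK cf cg; exact: cvg_bilinear BK cf cg. Qed.

End ContinuousAt.

Lemma is_derive_scale U V (a : U -> R) (f : U -> V) x v da df :
  is_derive x v a da -> is_derive x v f df ->
  is_derive x v (fun y => a y *: f y) (da *: f x + a x *: df).
Proof.
apply: (@is_derive_bilinear _ _ _ _ (fun (k : R) (w : V) => k *: w) 1).
- by move=> w k s t; rewrite scalerDl scalerA.
- by move=> r k s t; rewrite scalerDr !scalerA mulrC.
- by move=> r w; rewrite mul1r normrZ.
Qed.

Lemma is_derive_scalel V (s : R) (w : V) : is_derive s 1 (fun u : R => u *: w) w.
Proof.
have := is_derive_scale (is_derive_id s (1 : R)) (is_derive_cst w s 1).
by rewrite scale1r scaler0 addr0.
Qed.

Lemma is_derive_addl U V (f : U -> V) y x v d :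
  is_derive (y + x) v f d -> is_derive x v (fun u => f (y + u)) d.
Proof.
move=> /is_deriveP fd; apply/is_deriveP => e e0.
by apply: filterS (fd _ e0) => h; rewrite addrCA.
Qed.

End Derivatives.

(** * Integrals of vector-valued functions *)

Section Integral.
Variable R : realType.
Implicit Types V W : fdModType R.

Lemma fdc_continuous V i : continuous (fdc i : V -> R).
Proof. exact: fd_linear_continuous. Qed.

(* Two-sided derivatives on the whole segment, whose ends come in any order. *)
Definition primitive_on (V : normedModType R) (a b : R) (g G : R -> V) :=
  forall t, Num.min a b <= t <= Num.max a b -> is_derive t 1 G (g t).

Lemma primitive_onC (V : normedModType R) (a b : R) (g G : R -> V) :
  primitive_on a b g G -> primitive_on b a g G.
Proof. by move=> H t; rewrite minC maxC; exact: H. Qed.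

Lemma primitive_on_sub (V : normedModType R) (a b c d : R) (g G : R -> V) :
  a <= c <= b -> a <= d <= b -> primitive_on a b g G -> primitive_on c d g G.
Proof.
move=> /andP[ac cb] /andP[ad db] H t /andP[]; rewrite ge_min le_max => t1 t2.
apply: H; have ab := le_trans ac cb; rewrite (min_idPl ab) (max_idPr ab).
apply/andP; split; first by case/orP: t1; exact: le_trans.
by case/orP: t2 => t2; exact: le_trans t2 _.
Qed.

(** The norm is the sup of the coordinates, so the real mean value theorem in each coordinate loses
    no constant. *)
Lemma mean_value_ineq V (G g : R -> V) (a b M : R) : a <= b ->
  (forall t, a <= t <= b -> is_derive t 1 G (g t)) ->
  (forall t, a <= t <= b -> `|g t| <= M) -> `|G b - G a| <= M * (b - a).
Proof.
move=> ab dG gM.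
have M0 : 0 <= M by rewrite (le_trans _ (gM a _))// lexx.
apply: fdnorm_le => [|i]; first by rewrite mulr_ge0// subr_ge0.
have dGi t : a <= t <= b -> is_derive t 1 (fdc i \o G) (fdc i (g t)).
  by move=> tab; apply: is_derive_lin; [exact: fdc_continuous | exact: dG].
have [|t|c /[!in_itv]/= cab E] := @MVT_segment R (fdc i \o G) (fdc i \o g) a b ab.
- by move=> t; rewrite in_itv /= => /andP[/ltW at1 /ltW tb]; apply: dGi; rewrite at1.
- apply: derivable_within_continuous => s; rewrite in_itv /= => sab.
  by have [] := dGi s sab.
rewrite linearB /= [X in `|X|]E normrM (@ger0_norm _ (b - a)) ?subr_ge0//.
by rewrite ler_wpM2r ?subr_ge0// (le_trans (ler_fdc _ _))// gM.
Qed.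

Lemma primitive_unique V (g G1 G2 : R -> V) (a b : R) :
  primitive_on a b g G1 -> primitive_on a b g G2 ->
  G1 b - G1 a = G2 b - G2 a.
Proof.
wlog ab : a b / a <= b.
  move=> H p1 p2; have [/H|/ltW/H h] := leP a b; first exact.
  have := h (primitive_onC p1) (primitive_onC p2).
  by move=> /(congr1 -%R); rewrite !opprB.
move=> p1 p2; apply/eqP; rewrite -subr_eq0 -normr_le0.
have -> : G1 b - G1 a - (G2 b - G2 a) = (G1 - G2) b - (G1 - G2) a.
  by rewrite !fctE /= !opprB addrACA [RHS]addrACA; congr (_ + _); rewrite addrC.
rewrite -(mul0r (b - a)).
apply: (@mean_value_ineq _ _ (fun=> 0)) => // t tab; last by rewrite normr0.
rewrite -(subrr (g t)).
have {}tab : Num.min a b <= t <= Num.max a b by rewrite (min_idPl ab) (max_idPr ab).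
by apply: is_deriveB; [exact: p1 | exact: p2].
Qed.

Lemma continuous_has_primitive (h : R -> R) (a b : R) : continuous h ->
  exists H, forall t, a <= t <= b -> is_derive t 1 H (h t).
Proof.
move=> ch.
(* Starting at a - 1 makes the endpoint a interior, so that the derivative is two-sided there; b + 1
   below does the same for b. *)
exists (fun x => (\int[lebesgue_measure]_(t in [set` `[a - 1, x]]) h t)%R).
move=> t /andP[at1 tb].
have tb1 : t < b + 1 by rewrite (le_lt_trans tb)// ltrDl.
have [||] := @continuous_FTC1_closed R h (a - 1) t (b + 1) tb1 _ _ (ch t).
- apply: continuous_compact_integrable; first exact: segment_compact.
  exact: continuous_subspaceT.
- by rewrite (lt_le_trans _ at1)// ltrBlDr ltrDl.
move=> dH HE; split; [exact: dH | by rewrite -derive1E HE].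
Qed.

Lemma clamp_continuous (a b : R) : a <= b ->
  continuous (fun t : R => Num.max a (Num.min b t)).
Proof.
by move=> ab t; apply: continuous_max; [exact: cvg_cst | apply: continuous_min;
  [exact: cvg_cst | exact: cvg_id]].
Qed.

Lemma primitive_exists V (g : R -> V) (a b : R) :
  (forall t, Num.min a b <= t <= Num.max a b -> {for t, continuous g}) ->
  exists G, primitive_on a b g G.
Proof.
wlog ab : a b / a <= b.
  move=> H cg; have [/H|/ltW/H h] := leP a b; first exact.
  have [|G p] := h; last by exists G; exact: primitive_onC.
  by move=> t; rewrite minC maxC; exact: cg.
rewrite (min_idPl ab) (max_idPr ab) => cg.
(* Clamping t to the segment gives an integrand that is continuous on the whole line. *)
pose cl t := Num.max a (Num.min b t).
have clE t : a <= t <= b -> cl t = t.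
  by move=> /andP[at1 tb]; rewrite /cl (min_idPr tb) (max_idPr at1).
have clab t : a <= cl t <= b.
  by rewrite /cl le_max lexx /= ge_max ab ge_min lexx.
have /choice[H HP] : forall i, exists H : R -> R, forall t, a <= t <= b ->
    is_derive t 1 H (fdc i (g (cl t))).
  move=> i; apply: (@continuous_has_primitive (fun t => fdc i (g (cl t)))) => t.
  apply: (@continuous_comp _ _ _ _ (fdc i)); last exact: fdc_continuous.
  apply: (@continuous_comp _ _ _ cl g); first exact: clamp_continuous.
  exact: cg.
exists (fun t => \sum_i H i t *: fdbasis i) => t.
rewrite (min_idPl ab) (max_idPr ab) => tab.
rewrite (fdc_sum (g t)).
have -> : (fun t => \sum_i H i t *: fdbasis i) = \sum_i (fun t => H i t *: (fdbasis i : V)).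
  by apply/funext => s; rewrite fct_sumE.
apply: is_derive_sum => i.
have := HP i t tab; rewrite clE// => dH.
have := is_derive_scale dH (is_derive_cst (fdbasis i : V) t 1).
by rewrite scaler0 addr0.
Qed.

(** Integration through primitives is enough, as the integrands that occur are continuous at each
    point of the segment, and linearity follows from that of derivatives. The value 0 is a default
    for want of a primitive. *)
Definition int V (a b : R) (g : R -> V) : V :=
  if pselect (exists G, primitive_on a b g G) is left H
  then projT1 (cid H) b - projT1 (cid H) a else 0.

Lemma intE V (a b : R) (g G : R -> V) :
  primitive_on a b g G -> int a b g = G b - G a.
Proof.
move=> p; rewrite /int; case: pselect => [H|]; last by case; exists G.
by case: (cid H) => G' p' /=; exact: primitive_unique p' p.
Qed.

Lemma int_FTC V (a b : R) (G g : R -> V) : a <= b ->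
  (forall t, a <= t <= b -> is_derive t 1 G (g t)) -> int a b g = G b - G a.
Proof. by move=> ab dG; apply: intE; rewrite /primitive_on (min_idPl ab) (max_idPr ab). Qed.

Lemma eq_int V (a b : R) (f g : R -> V) : a <= b ->
  (forall t, a <= t <= b -> f t = g t) -> int a b f = int a b g.
Proof.
move=> ab fg; have pfg G : primitive_on a b f G <-> primitive_on a b g G.
  by split=> p t tab; move: (tab); rewrite (min_idPl ab) (max_idPr ab) => /fg E;
    [rewrite -E | rewrite E]; exact: p.
have [[G p]|np] := pselect (exists G, primitive_on a b f G).
  by rewrite (intE p); symmetry; apply: intE; exact/pfg.
rewrite /int; case: pselect => // _; case: pselect => // ex.
by case: np; case: ex => G p; exists G; exact/pfg.
Qed.

Lemma int_lin V W (l : {linear V -> W}) (a b : R) (g : R -> V) : a <= b ->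
  (forall t, a <= t <= b -> {for t, continuous g}) ->
  int a b (fun t => l (g t)) = l (int a b g).
Proof.
move=> ab cg.
have [|G p] := @primitive_exists V g a b; first by rewrite (min_idPl ab) (max_idPr ab).
rewrite (intE p) linearB; apply: (@intE _ _ _ _ (l \o G)) => t tab.
by apply: is_derive_lin; [exact: fd_linear_continuous | exact: p].
Qed.

Lemma intD V (a b : R) (f g : R -> V) : a <= b ->
  (forall t, a <= t <= b -> {for t, continuous f}) ->
  (forall t, a <= t <= b -> {for t, continuous g}) ->
  int a b (fun t => f t + g t) = int a b f + int a b g.
Proof.
move=> ab cf cg.
have [|F pF] := @primitive_exists V f a b; first by rewrite (min_idPl ab) (max_idPr ab).
have [|G pG] := @primitive_exists V g a b; first by rewrite (min_idPl ab) (max_idPr ab).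
rewrite (intE pF) (intE pG) addrACA -opprD.
apply: (@intE _ _ _ _ (F + G)) => t tab.
by apply: is_deriveD; [exact: pF | exact: pG].
Qed.

Lemma intZ V (a b k : R) (g : R -> V) : a <= b ->
  (forall t, a <= t <= b -> {for t, continuous g}) ->
  int a b (fun t => k *: g t) = k *: int a b g.
Proof. by move=> ab cg; rewrite -(int_lin ( *:%R k) ab cg). Qed.

Lemma intB V (a b : R) (f g : R -> V) : a <= b ->
  (forall t, a <= t <= b -> {for t, continuous f}) ->
  (forall t, a <= t <= b -> {for t, continuous g}) ->
  int a b (fun t => f t - g t) = int a b f - int a b g.
Proof.
move=> ab cf cg; rewrite -scaleN1r -intZ// -intD//.
  by apply: eq_int => // t _; rewrite scaleN1r.
by move=> t tab; apply: contZr; exact: cg.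
Qed.

Lemma int_le V (a b M : R) (g : R -> V) : a <= b ->
  (forall t, a <= t <= b -> {for t, continuous g}) ->
  (forall t, a <= t <= b -> `|g t| <= M) -> `|int a b g| <= M * (b - a).
Proof.
move=> ab cg gM.
have [|G p] := @primitive_exists V g a b; first by rewrite (min_idPl ab) (max_idPr ab).
rewrite (intE p); apply: mean_value_ineq gM => // t tab.
by apply: p; rewrite (min_idPl ab) (max_idPr ab).
Qed.

Lemma int_chasles V (a b c : R) (g : R -> V) : a <= b -> b <= c ->
  (forall t, a <= t <= c -> {for t, continuous g}) ->
  int a b g + int b c g = int a c g.
Proof.
move=> ab bc cg; have ac := le_trans ab bc.
have [|G p] := @primitive_exists V g a c; first by rewrite (min_idPl ac) (max_idPr ac).
have bac : a <= b <= c by rewrite ab.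
rewrite (intE p) (intE (primitive_on_sub _ bac p)) ?lexx//.
by rewrite (intE (primitive_on_sub bac _ p)) ?lexx ?ac// addrC subrKA.
Qed.

End Integral.

Section ParametricIntegrals.
Variable R : realType.
Implicit Types V W : fdModType R.

(** The tube lemma: by compactness of the segment, one neighbourhood of x serves all t. *)
Lemma near_segment (T : topologicalType) (x : T) (a b : R) (P : T -> R -> Prop) :
  (forall t, a <= t <= b -> \forall z \near (x, t), P z.1 z.2) ->
  \forall y \near x, forall t, a <= t <= b -> P y t.
Proof.
move=> H.
have := (compact_near_coveringP `[a, b]).1 (@segment_compact R a b) T (nbhs x) P _.
move=> K; apply: filterS (K _ _) => [y yP t tab|].
  by apply: yP; rewrite /= in_itv.
move=> t.
rewrite /= in_itv /= => /H [[A B] /= [xA tB] AB].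
by exists (B, A) => // -[u v] /= [uB vA]; apply: (AB (v, u)).
Qed.

Lemma joint_continuous_snd (T U : topologicalType) (V : normedModType R)
    (g : T -> U -> V) x t :
  {for (x, t), continuous (fun z => g z.1 z.2)} -> {for t, continuous (g x)}.
Proof.
move=> cg; apply: (@continuous_comp _ _ _ (fun s => (x, s)) (fun z => g z.1 z.2)) => //.
by apply: cvg_pair; [exact: cvg_cst | exact: cvg_id].
Qed.

Lemma near_segment_dist (T : topologicalType) V (g : T -> R -> V) x (a b e : R) :
  0 < e -> (forall t, a <= t <= b -> {for (x, t), continuous (fun z => g z.1 z.2)}) ->
  \forall y \near x, forall t, a <= t <= b -> `|g x t - g y t| < e.
Proof.
move=> e0 cg; apply: near_segment => t tab.
have e2 : 0 < e / 2 by rewrite divr_gt0.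
have cgt := cont_dist_lt (cg t tab) e2.
have cgx : \forall z \near (x, t), `|g x t - g x z.2| < e / 2.
  have := cont_dist_lt (joint_continuous_snd (cg t tab)) e2.
  move=> H; exact: (cvg_snd H).
near=> z => /=.
rewrite (splitr e) -(subrKA (g x t)) (le_lt_trans (ler_normD _ _))// ltrD//.
  by rewrite distrC; near: z.
by near: z.
Unshelve. all: by end_near. Qed.

Lemma int_continuous (T : topologicalType) V (g : T -> R -> V) x (a b : R) :
  a <= b -> (forall t, a <= t <= b -> {for (x, t), continuous (fun z => g z.1 z.2)}) ->
  (\forall y \near x, forall t, a <= t <= b -> {for t, continuous (g y)}) ->
  {for x, continuous (fun y => int a b (g y))}.
Proof.
move=> ab cg cgy; apply: contP => e e0.
have e1 : 0 < e / (b - a + 1) by rewrite divr_gt0// ltr_wpDl// subr_ge0.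
near=> y.
have cx t : a <= t <= b -> {for t, continuous (g x)}.
  by move=> tab; exact: joint_continuous_snd (cg t tab).
have cy : forall t, a <= t <= b -> {for t, continuous (g y)} by near: y.
rewrite -intB// (@le_lt_trans _ _ (e / (b - a + 1) * (b - a)))//.
  apply: int_le => // t tab; first by apply: contB; [exact: cx | exact: cy].
  apply: ltW; move: t tab; near: y; exact: near_segment_dist.
rewrite mulrAC ltr_pdivrMr ?ltr_wpDl ?subr_ge0//.
by rewrite ltr_pM2l// ltrDl.
Unshelve. all: by end_near. Qed.

(** For each t, the mean value inequality for [g (y + s) t - s *: g' y t] bounds the error by the
    oscillation of g' near y, which is uniform in t by [near_segment_dist]. *)
Lemma int_parameter_derive V (g g' : R -> R -> V) (y a b : R) : a <= b ->
  (\forall z \near y, forall t, a <= t <= b -> is_derive (z : R) 1 (g ^~ t) (g' z t)) ->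
  (\forall z \near y, forall t, a <= t <= b -> {for t, continuous (g z)}) ->
  (forall t, a <= t <= b -> {for (y, t), continuous (fun z => g' z.1 z.2)}) ->
  is_derive y 1 (fun z => int a b (g z)) (int a b (g' y)).
Proof.
move=> ab dg cg cg'; apply/is_deriveP => e e0.
have e1 : 0 < e / (b - a + 1) by rewrite divr_gt0// ltr_wpDl// subr_ge0.
have K := near_segment_dist e1 cg'.
have /nbhs_ballP[r /= r0 Hr] : \forall z \near y,
    (forall t, a <= t <= b -> is_derive (z : R) 1 (g ^~ t) (g' z t)) /\
    (forall t, a <= t <= b -> {for t, continuous (g z)}) /\
    (forall t, a <= t <= b -> `|g' y t - g' z t| < e / (b - a + 1)).
  by near=> z; split; [near: z; exact: dg | split; [near: z; exact: cg | near: z; exact: K]].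
have c' t : a <= t <= b -> {for t, continuous (g' y)}.
  by move=> tab; exact: joint_continuous_snd (cg' t tab).
near=> h.
have hr : `|h| < r.
  have : ball (0 : R) r h by near: h; exact: (nbhsx_ballx (0 : R)).
  by rewrite -ball_normE /= sub0r normrN.
have [_ [cy _]] := Hr y (ballxx _ r0).
have inr (s : R) : `|s| <= `|h| -> ball y r (y + s).
  by move=> sh; rewrite -ball_normE /= opprD addrA subrr sub0r normrN (le_lt_trans sh).
have [_ [ch _]] := Hr _ (inr h (lexx _)).
rewrite [h *: 1]mulr1 [h + y]addrC -intB// -intZ// -intB//; last first.
- by move=> t tab; apply: contZr; exact: c'.
- by move=> t tab; apply: contB; [exact: ch | exact: cy].
rewrite (@le_trans _ _ ((e / (b - a + 1) * `|h|) * (b - a)))//; last first.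
  rewrite mulrAC ler_wpM2r// mulrAC ler_pdivrMr ?ltr_wpDl ?subr_ge0//.
  by rewrite ler_pM2l// lerDl.
apply: int_le => // t tab.
  apply: contB; last by apply: contZr; exact: c'.
  by apply: contB; [exact: ch | exact: cy].
have D s : `|s| <= `|h| ->
    is_derive (s : R) 1 (fun s => g (y + s) t - s *: g' y t) (g' (y + s) t - g' y t).
  move=> sh; have [dz _] := Hr _ (inr s sh).
  apply: is_deriveB.
    exact: (@is_derive_addl R R V (g ^~ t) y s 1 _ (dz t tab)).
  exact: is_derive_scalel.
have E s : `|s| <= `|h| -> `|g' (y + s) t - g' y t| <= e / (b - a + 1).
  by move=> sh; rewrite distrC ltW//; have [_ [_]] := Hr _ (inr s sh); exact.
have [h0|h0] := leP 0 h.
  have sh s : 0 <= s <= h -> `|s| <= `|h|.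
    by move=> /andP[s0 sh]; rewrite (ger0_norm s0) (ger0_norm h0).
  have := mean_value_ineq h0 (fun s H => D s (sh s H)) (fun s H => E s (sh s H)).
  by rewrite addr0 scale0r !subr0 (ger0_norm h0) addrAC.
have sh s : h <= s <= 0 -> `|s| <= `|h|.
  by move=> /andP[hs s0]; rewrite (ler0_norm s0) (ltr0_norm h0) lerN2.
have := mean_value_ineq (ltW h0) (fun s H => D s (sh s H)) (fun s H => E s (sh s H)).
by rewrite addr0 scale0r subr0 sub0r (ltr0_norm h0) distrC addrAC.
Unshelve. all: by end_near. Qed.

Lemma int_continuous_all (T : topologicalType) V (g : T -> R -> V) x (a b : R) :
  a <= b -> (forall t, {for (x, t), continuous (fun z => g z.1 z.2)}) ->
  (forall y t, {for t, continuous (g y)}) ->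
  {for x, continuous (fun y => int a b (g y))}.
Proof.
move=> ab cg cgy; apply: int_continuous; [exact: ab | by move=> t _; exact: cg |].
by near=> y => t _; exact: cgy.
Unshelve. all: by end_near. Qed.

Lemma int_parameter_derive_all V (g g' : R -> R -> V) (y a b : R) : a <= b ->
  (forall (z t : R), is_derive z 1 (g ^~ t) (g' z t)) ->
  (forall z t, {for t, continuous (g z)}) ->
  (forall t, {for (y, t), continuous (fun z => g' z.1 z.2)}) ->
  is_derive y 1 (fun z => int a b (g z)) (int a b (g' y)).
Proof.
move=> ab dg cg cg'; apply: int_parameter_derive; [exact: ab | | |].
- by near=> z => t _; exact: dg.
- by near=> z => t _; exact: cg.
- by move=> t _; exact: cg'.
Unshelve. all: by end_near. Qed.

End ParametricIntegrals.

(** Mean value inequality along the segment from x to y, for F minus its candidate linear part.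
    Since [DF y] is linear, it is enough to control its variation on the basis vectors. *)
Lemma differentiable_of_continuous_derive (R : realType) (X V : fdModType R)
    (F : X -> V) (DF : X -> {linear X -> V}) (x : X) :
  (\forall y \near x, forall h, is_derive y h F (DF y h)) ->
  (forall h, {for x, continuous (fun y => DF y h)}) ->
  differentiable F x /\ 'd F x = DF x :> (X -> V).
Proof.
move=> dF cF; apply: differentiable_epsP; first exact: fd_linear_continuous.
move=> e e0; pose N := (fddim X)%:R + 1 : R.
have N0 : 0 < N by rewrite ltr_wpDl.
have eN : 0 < e / N by rewrite divr_gt0.
have K : \forall y \near x, forall i : 'I_(fddim X),
    `|DF x (fdbasis i) - DF y (fdbasis i)| < e / N.
  by apply: filter_forall => i; exact: cont_dist_lt (cF _) eN.
have /nbhs_ballP[r /= r0 Hr] : \forall y \near x,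
    (forall h, is_derive y h F (DF y h)) /\
    forall i : 'I_(fddim X), `|DF x (fdbasis i) - DF y (fdbasis i)| < e / N.
  by near=> y; split; near: y.
apply/nbhs_ballP; exists r => //= y; rewrite -ball_normE /=.
rewrite distrC; set h := y - x => xy.
have inr (s : R) : 0 <= s <= 1 -> ball x r (s *: h + x).
  move=> /andP[s0 s1]; rewrite -ball_normE /= opprD addrCA subrr addr0 normrN normrZ.
  by rewrite (le_lt_trans _ xy)// ger0_norm// ler_piMl.
have D s : 0 <= s <= 1 -> is_derive (s : R) 1
    (fun s => F (s *: h + x) - s *: DF x h) (DF (s *: h + x) h - DF x h).
  move=> s01; have [dz _] := Hr _ (inr s s01).
  by apply: is_deriveB; [exact: is_derive_line | exact: is_derive_scalel].
have E s : 0 <= s <= 1 -> `|DF (s *: h + x) h - DF x h| <= e * `|h|.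
  move=> s01; have [_ bz] := Hr _ (inr s s01).
  have DE z : DF z h = \sum_i fdc i h *: DF z (fdbasis i).
    by rewrite {1}(fdc_sum h) linear_sum; apply: eq_bigr => i _; rewrite linearZ.
  rewrite !DE -sumrB (le_trans (ler_norm_sum _ _ _))//.
  rewrite (@le_trans _ _ (\sum_(i < fddim X) (e / N * `|h|)))//.
    apply: ler_sum => i _; rewrite -scalerBr normrZ mulrC distrC.
    by apply: ler_pM => //; [exact: ltW | exact: ler_fdc].
  rewrite sumr_const card_ord -mulr_natl mulrA ler_wpM2r// mulrCA ger_pMr//.
  by rewrite ler_pdivrMr// mul1r lerDl.
have := @mean_value_ineq R V _ _ 0 1 _ ler01 D E.
by rewrite !scale1r !scale0r add0r !subr0 mulr1 subrK addrAC.
Unshelve. all: by end_near. Qed.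

(** In finite dimension an injective multiplication is onto, so 1 is in its image. *)
Lemma unit_of_mul_injective (K : fieldType) (L : falgType K) (u : L) :
  (forall x, u * x = 0 -> x = 0) -> u \is a GRing.unit.
Proof.
move=> inju; apply/unitrP.
have ker0 : lker (amull u) == 0%VS.
  rewrite eqEsubv sub0v andbT; apply/subvP => v; rewrite memv_ker lfunE /=.
  by move/eqP/inju ->; rewrite mem0v.
have /memv_imgP[v _ vu1]: 1 \in limg (amull u); last rewrite lfunE /= in vu1.
  suffices /eqP->: limg (amull u) == fullv by rewrite memvf.
  by rewrite -dimv_leqif_eq ?subvf ?limg_dim_eq // (eqP ker0) capv0.
exists v; split=> //; apply: (lker0P ker0).
by rewrite !lfunE /= mulrA -vu1 mulr1 mul1r.
Qed.

(** * Calculus in a finite-dimensional algebra *)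

Section Algebra.
Variables (R : realType) (L : falgType R).
Local Notation A := (fdnormed L).

Lemma mulA_linearl (y : A) : linear (fun x : A => x * y : A).
Proof. by move=> k a b; rewrite mulrDl scalerAl. Qed.

Lemma mulA_linearr (x : A) : linear (fun y : A => x * y : A).
Proof. by move=> k a b; rewrite mulrDr scalerAr. Qed.

HB.instance Definition _ (x : A) := GRing.isLinear.Build R A A *:%R ( *%R x) (mulA_linearr x).

Lemma mulA_bounded : exists2 K : R, 0 < K & forall x y : A, `|x * y| <= K * `|x| * `|y|.
Proof. exact: (fd_bilinear_bounded mulA_linearl mulA_linearr). Qed.

Lemma is_deriveMA (U : normedModType R) (f g : U -> A) (x v : U) df dg :
  is_derive x v f df -> is_derive x v g dg ->
  is_derive x v (fun y => f y * g y) (df * g x + f x * dg).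
Proof.
have [K _ mK] := mulA_bounded.
exact: (is_derive_bilinear mulA_linearl mulA_linearr mK).
Qed.

Lemma contMA (T : topologicalType) (f g : T -> A) t :
  {for t, continuous f} -> {for t, continuous g} ->
  {for t, continuous (fun s => f s * g s)}.
Proof.
have [K _ mK] := mulA_bounded.
exact: (cont_bilinear mulA_linearl mulA_linearr mK).
Qed.

Lemma contMAr (T : topologicalType) (f : T -> A) (a : A) t :
  {for t, continuous f} -> {for t, continuous (fun s => a * f s)}.
Proof. by move=> cf; apply: contMA => //; exact: cont_cst. Qed.

Lemma is_deriveMAr (U : normedModType R) (f : U -> A) (a : A) (x v : U) df :
  is_derive x v f df -> is_derive x v (fun y => a * f y) (a * df).
Proof. by move=> fd; have := is_deriveMA (is_derive_cst a x v) fd; rewrite mul0r add0r. Qed.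

Lemma differentiableMA (U : normedModType R) (f g : U -> A) (x : U) :
  differentiable f x -> differentiable g x ->
  differentiable (fun y => f y * g y) x.
Proof.
have [K _ mK] := mulA_bounded.
exact: (differentiable_bilinear mulA_linearl mulA_linearr mK).
Qed.

(** The radius 1 / (2K) makes multiplication by h a contraction of ratio 1/2, so 1 + h is injective;
    the bound comes from w = 1 - h w. No Neumann series is summed. *)
Lemma unit_near1 : exists2 r : R, 0 < r & forall h : A, `|h| <= r ->
  (1 + h : A) \is a GRing.unit /\ `|(1 + h : A)^-1| <= 2 * `|1 : A|.
Proof.
have [K K0 mK] := mulA_bounded.
exists (2 * K)^-1 => [|h hr]; first by rewrite invr_gt0 mulr_gt0.
have hx (x : A) : `|h * x| <= 2^-1 * `|x|.
  rewrite (le_trans (mK _ _))// ler_wpM2r// (le_trans (ler_wpM2l (ltW K0) hr))//.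
  by rewrite invfM mulrCA divff ?gt_eqF// mulr1.
have U : (1 + h : A) \is a GRing.unit.
  apply: unit_of_mul_injective => x /eqP; rewrite mulrDl mul1r addr_eq0 => /eqP xE.
  apply/eqP; rewrite -normr_le0.
  have xx := hx x; rewrite -(normrN (h * x)) -xE in xx.
  have := normr_ge0 x; lra.
split=> //; set w := (1 + h : A)^-1.
have wE : w = 1 - h * w.
  have e1 : w + h * w = 1 by rewrite -{1}(mul1r w) -mulrDl mulrV.
  by rewrite -e1 addrK.
have hw := hx w; have ww : `|w| <= `|1 : A| + `|h * w| by rewrite {1}wE ler_normB.
move: hw ww; set a1 := `|1 : A|; set b1 := `|h * w|; set c1 := `|w|; lra.
Qed.

(** Factors y as a (1 + a^-1 (y - a)), to which [unit_near1] applies. *)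
Lemma inv_near_bounded (a : A) : a \is a GRing.unit ->
  exists M : R, \forall y \near a, (y : A) \is a GRing.unit /\ `|y^-1| <= M.
Proof.
move=> Ua; have [r r0 Hr] := unit_near1; have [K K0 mK] := mulA_bounded.
have Ka0 : 0 < K * `|a^-1|.
  by rewrite mulr_gt0// normr_gt0 invr_eq0; apply: contraTneq Ua => ->; rewrite unitr0.
exists (K * (2 * `|1 : A|) * `|a^-1|); near=> y.
have [] := Hr (a^-1 * (y - a)).
  rewrite (le_trans (mK _ _))// mulrC -ler_pdivlMr// distrC ltW//.
  by near: y; apply: near_dist_lt; rewrite divr_gt0.
have -> : 1 + a^-1 * (y - a) = a^-1 * y by rewrite mulrBr mulVr// addrC subrK.
move=> Uay nay.
have yE : y = a * (a^-1 * y) by rewrite mulrA mulrV// mul1r.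
split; first by rewrite yE unitrMl.
have -> : y^-1 = (a^-1 * y)^-1 * a^-1 by rewrite -invrM// -yE.
by rewrite (le_trans (mK _ _))// ler_wpM2r// ler_wpM2l// ltW.
Unshelve. all: by end_near. Qed.

Lemma inv_continuous (a : A) : a \is a GRing.unit -> {for a, continuous (fun y : A => y^-1)}.
Proof.
move=> Ua; have [M HM] := inv_near_bounded Ua; have [K K0 mK] := mulA_bounded.
have Ma : `|a^-1| <= M by have [_] := nbhs_singleton HM.
have M0 : 0 <= M by exact: le_trans Ma.
pose C := K * (K * M) * M + 1.
have C0 : 0 < C by rewrite ltr_wpDl// !mulr_ge0// ltW.
apply: contP => e e0; near=> y.
have [Uy My] : (y : A) \is a GRing.unit /\ `|y^-1| <= M by near: y.
have -> : a^-1 - y^-1 = a^-1 * (y - a) * y^-1.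
  by rewrite mulrBr mulVr// mulrBl mul1r -mulrA mulrV// mulr1.
rewrite (@le_lt_trans _ _ (C * `|a - y|))//.
  rewrite (le_trans (mK _ _))// (le_trans (ler_wpM2r _ (ler_wpM2l (ltW K0) (mK _ _))))//.
  rewrite [`|y - a|]distrC.
  rewrite (@le_trans _ _ (K * (K * M * `|a - y|) * M))//.
    by rewrite ler_pM// ?mulr_ge0 ?(ltW K0)// ler_wpM2l ?(ltW K0)// ler_wpM2r// ler_wpM2l ?(ltW K0).
  rewrite /C mulrDl mul1r; have := normr_ge0 (a - y); nra.
rewrite -ltr_pdivlMl// mulrC; near: y; apply: near_dist_lt; exact: divr_gt0.
Unshelve. all: by end_near. Qed.

Lemma differentiable_inv (a : A) : a \is a GRing.unit ->
  differentiable (fun y : A => y^-1 : A) a /\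
  'd (fun y : A => y^-1 : A) a = (fun h => - (a^-1 * h * a^-1)) :> (A -> A).
Proof.
move=> Ua; have [K K0 mK] := mulA_bounded.
have lin : linear (fun h : A => - (a^-1 * h * a^-1) : A).
  by move=> k x y; rewrite mulrDr mulrDl -scalerAr -scalerAl opprD scalerN.
pose l := HB.pack_for {linear A -> A} (fun h : A => - (a^-1 * h * a^-1) : A)
  (GRing.isLinear.Build _ _ _ _ _ lin).
apply: (@differentiable_epsP _ _ _ _ l); first exact: fd_linear_continuous.
move=> e e0; have [M HM] := inv_near_bounded Ua.
pose C := K * (K * `|a^-1|) + 1.
have C0 : 0 < C by rewrite ltr_wpDl// !mulr_ge0// ltW.
near=> y; rewrite /l /=.
have [Uy _] : (y : A) \is a GRing.unit /\ `|y^-1| <= M by near: y.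
(* The remainder is the product of y - a with a factor that tends to 0 by continuity of the
   inverse. *)
have -> : y^-1 - a^-1 - - (a^-1 * (y - a) * a^-1) = a^-1 * (y - a) * (a^-1 - y^-1).
  have E : a^-1 * (y - a) * y^-1 = a^-1 - y^-1.
    by rewrite mulrBr mulVr// mulrBl mul1r -mulrA mulrV// mulr1.
  by rewrite opprK [RHS]mulrBr E opprB addrC.
rewrite (le_trans (mK _ _))//.
have ay : `|a^-1 - y^-1| <= e / C.
  apply: ltW; near: y; apply: (cont_dist_lt (inv_continuous Ua)).
  exact: divr_gt0.
rewrite (@le_trans _ _ (K * (K * `|a^-1| * `|y - a|) * (e / C)))//.
  by rewrite ler_pM// ?mulr_ge0 ?(ltW K0)// ler_wpM2l ?(ltW K0).
have -> : K * (K * `|a^-1| * `|y - a|) * (e / C) =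
    K * (K * `|a^-1|) / C * (e * `|y - a|) by ring.
by rewrite ler_piMl ?mulr_ge0 ?(ltW e0)// ler_pdivrMr// mul1r lerDl.
Unshelve. all: by end_near. Qed.

Lemma is_derive_inv (f : R -> A) (t : R) df :
  f t \is a GRing.unit -> is_derive t 1 f df ->
  is_derive t 1 (fun y => (f y)^-1) (- ((f t)^-1 * df * (f t)^-1)).
Proof.
move=> Uf fd; have [dinv E] := differentiable_inv Uf.
by have := is_derive_curve fd dinv; rewrite E.
Qed.

Lemma differentiableVA (U : normedModType R) (f : U -> A) (x : U) :
  f x \is a GRing.unit -> differentiable f x ->
  differentiable (fun y => (f y)^-1 : A) x.
Proof.
by move=> Uf df; apply: (@differentiable_comp _ _ _ _ f) => //; exact: (differentiable_inv Uf).1.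
Qed.

End Algebra.

(** * Goursat's bisection argument on rectangles *)

Section Goursat.
Variable R : realType.
Implicit Types V : fdModType R.

Lemma half_powers_small (d delta : R) : 0 < delta -> 0 <= d ->
  exists n, forall k, (n <= k)%N -> d * 2^-1 ^+ k < delta.
Proof.
move=> dl0 d0.
have /cvgrPdist_lt/(_ _ dl0)[n _ Hn] : (fun k : nat => d * (2^-1 : R) ^+ k) @ \oo --> (0 : R).
  rewrite -[X in _ --> X](mulr0 d); apply: cvgM; first exact: cvg_cst.
  by apply: cvg_expr; rewrite ger0_norm ?invr_ge0// invf_lt1// ltr1n.
exists n => k nk; have := Hn k nk; rewrite sub0r normrN ger0_norm//.
by rewrite mulr_ge0// exprn_ge0// invr_ge0.
Qed.

(** The common point is the supremum of the left ends, which every right end bounds. *)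
Lemma nested_intervals (p s : nat -> R) :
  (forall n, p n <= p n.+1) -> (forall n, p n.+1 + s n.+1 <= p n + s n) ->
  (forall n, 0 <= s n) -> exists z, forall n, p n <= z <= p n + s n.
Proof.
move=> pinc psdec s0.
have pm m n : (m <= n)%N -> p m <= p n.
  by apply: (@homo_leq _ p (fun a b => a <= b)) => // b a c; exact: le_trans.
have psm m n : (m <= n)%N -> p n + s n <= p m + s m.
  apply: (@homo_leq _ (fun k => p k + s k) (fun a b => b <= a)) => //.
  by move=> b a c ab bc; exact: le_trans ab.
have pps m n : p m <= p n + s n.
  have [mn|nm] := leqP m n; first by rewrite (le_trans (pm _ _ mn))// lerDl.
  by rewrite (le_trans _ (psm _ _ (ltnW nm)))// lerDl.
have ne : range p !=set0 by exists (p 0%N), 0%N.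
exists (sup (range p)) => n; apply/andP; split.
  apply: sup_upper_bound; last by exists n.
  by split=> //; exists (p 0%N + s 0%N) => _ [m _ <-].
by apply: ge_sup => // _ [m _ <-].
Qed.

Variables (V : fdModType R) (J : R -> R -> R -> R -> V) (q1 q2 d1 d2 : R).

Definition subrect (p1 p2 s1 s2 : R) :=
  [/\ 0 <= s1, 0 <= s2, (q1 <= p1) && (p1 + s1 <= q1 + d1) &
      (q2 <= p2) && (p2 + s2 <= q2 + d2)].

(** At each step some quarter keeps at least a fourth of the norm of J. At the limit point the local
    estimate, with e small, contradicts this because 4^n (2^-n)^2 = 1. *)
Lemma rectangle_bisection : 0 <= d1 -> 0 <= d2 ->
  (forall p1 p2 s1 s2, subrect p1 p2 s1 s2 ->
     J p1 p2 s1 s2 = J p1 p2 (s1 / 2) (s2 / 2) + J (p1 + s1 / 2) p2 (s1 / 2) (s2 / 2)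
       + (J p1 (p2 + s2 / 2) (s1 / 2) (s2 / 2)
          + J (p1 + s1 / 2) (p2 + s2 / 2) (s1 / 2) (s2 / 2))) ->
  (forall z1 z2 e, q1 <= z1 <= q1 + d1 -> q2 <= z2 <= q2 + d2 -> 0 < e ->
     exists2 delta, 0 < delta & forall p1 p2 s1 s2, subrect p1 p2 s1 s2 ->
       s1 < delta -> s2 < delta -> p1 <= z1 <= p1 + s1 -> p2 <= z2 <= p2 + s2 ->
       `|J p1 p2 s1 s2| <= e * (s1 + s2) ^+ 2) ->
  J q1 q2 d1 d2 = 0.
Proof.
move=> d10 d20 quarter local; apply/eqP; rewrite -normr_le0 leNgt; apply/negP => J0.
pose h n : R := 2^-1 ^+ n.
have h0 n : 0 < h n by rewrite exprn_gt0.
have hS n : h n.+1 = h n / 2 by rewrite /h exprSr.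
(* The condition is put inside the existential so that [choice] gives a function defined on all
   pairs. *)
have step (np : nat * (R * R)) : exists p' : R * R,
    subrect np.2.1 np.2.2 (d1 * h np.1) (d2 * h np.1) ->
    [/\ subrect p'.1 p'.2 (d1 * h np.1.+1) (d2 * h np.1.+1),
        (np.2.1 <= p'.1) && (p'.1 + d1 * h np.1.+1 <= np.2.1 + d1 * h np.1),
        (np.2.2 <= p'.2) && (p'.2 + d2 * h np.1.+1 <= np.2.2 + d2 * h np.1) &
        `|J np.2.1 np.2.2 (d1 * h np.1) (d2 * h np.1)|
           <= 4 * `|J p'.1 p'.2 (d1 * h np.1.+1) (d2 * h np.1.+1)|].
  case: np => n [p1 p2] /=.
  have [sr|] := pselect (subrect p1 p2 (d1 * h n) (d2 * h n)); last first.
    by move=> nsr; exists (p1, p2) => sr.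
  rewrite hS !mulrA.
  move: (quarter _ _ _ _ sr); case: sr.
  move: (d1 * h n) (d2 * h n) => s1 s2 s10 s20 /andP[qp1 pq1] /andP[qp2 pq2].
  set a := J p1 p2 (s1 / 2) _; set b := J (p1 + _) p2 _ _.
  set c := J p1 (p2 + _) _ _; set d := J (p1 + _) (p2 + _) _ _ => E.
  have : `|J p1 p2 s1 s2| <= 4 * `|a| \/ `|J p1 p2 s1 s2| <= 4 * `|b| \/
     `|J p1 p2 s1 s2| <= 4 * `|c| \/ `|J p1 p2 s1 s2| <= 4 * `|d|.
    have : `|J p1 p2 s1 s2| <= `|a| + `|b| + (`|c| + `|d|).
      by rewrite E (le_trans (ler_normD _ _))// lerD// ler_normD.
    move: `|J _ _ _ _| `|a| `|b| `|c| `|d| => j a' b' c' d' H.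
    have [|ja] := leP j (4 * a'); first by left.
    have [|jb] := leP j (4 * b'); first by right; left.
    have [|jc] := leP j (4 * c'); first by right; right; left.
    by right; right; right; rewrite leNgt; apply/negP => jd; clear -H ja jb jc jd; lra.
  by case=> [H|[H|[H|H]]];
    [exists (p1, p2) | exists (p1 + s1 / 2, p2) | exists (p1, p2 + s2 / 2)
    | exists (p1 + s1 / 2, p2 + s2 / 2)] => _ /=; split => //; rewrite /subrect;
    clear - s10 s20 qp1 pq1 qp2 pq2; try (split; try (apply/andP; split)); lra.
have [F HF] := choice step.
(* Lower left corners of the chosen rectangles, whose sides are [d1 * h n] and [d2 * h n]. *)
pose p := fix p n := if n is k.+1 then F (k, p k) else (q1, q2).
have sr n : subrect (p n).1 (p n).2 (d1 * h n) (d2 * h n).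
  elim: n => [|n IH]; last by have [] := HF (n, p n) IH.
  by rewrite /= /h expr0 !mulr1; split=> //; rewrite !lexx.
have HFp n := HF (n, p n) (sr n).
have Jn n : `|J q1 q2 d1 d2| <= 4 ^+ n * `|J (p n).1 (p n).2 (d1 * h n) (d2 * h n)|.
  elim: n => [|n IH]; first by rewrite /= /h !expr0 !mulr1 mul1r.
  rewrite (le_trans IH)// exprSr -mulrA ler_wpM2l ?exprn_ge0//.
  by have [] := HFp n.
have [z1 Hz1] : exists z, forall n, (p n).1 <= z <= (p n).1 + d1 * h n.
  apply: nested_intervals => n; try by have [_ /andP[? ?] /andP[? ?] _] := HFp n.
  by rewrite mulr_ge0// ltW.
have [z2 Hz2] : exists z, forall n, (p n).2 <= z <= (p n).2 + d2 * h n.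
  apply: nested_intervals => n; try by have [_ /andP[? ?] /andP[? ?] _] := HFp n.
  by rewrite mulr_ge0// ltW.
have D0 : 0 < (d1 + d2) ^+ 2 + 1 by rewrite ltr_wpDl// exprn_ge0// addr_ge0.
(* Makes [e * (d1 + d2) ^+ 2] smaller than the norm of J; the added 1 avoids a zero denominator. *)
pose e := `|J q1 q2 d1 d2| / 2 / ((d1 + d2) ^+ 2 + 1).
have e0 : 0 < e by rewrite !divr_gt0.
have [||delta dl0 Hd] := local z1 z2 e _ _ e0.
- by have := Hz1 0%N; rewrite /= /h expr0 mulr1.
- by have := Hz2 0%N; rewrite /= /h expr0 mulr1.
have [n1 Hn1] := half_powers_small dl0 d10.
have [n2 Hn2] := half_powers_small dl0 d20.
pose n := maxn n1 n2.
have := Hd _ _ _ _ (sr n) (Hn1 n (leq_maxl _ _)) (Hn2 n (leq_maxr _ _)) (Hz1 n) (Hz2 n).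
rewrite -mulrDl exprMn mulrA => Hle.
have := le_trans (Jn n) (ler_wpM2l (exprn_ge0 n (ler0n R 4)) Hle).
have -> : 4 ^+ n * (e * (d1 + d2) ^+ 2 * h n ^+ 2) = e * (d1 + d2) ^+ 2.
  rewrite mulrCA /h -exprM mulnC exprM -exprMn.
  have -> : 4 * (2^-1 : R) ^+ 2 = 1 by lra.
  by rewrite expr1n mulr1.
apply/negP; rewrite -ltNge.
have K : (d1 + d2) ^+ 2 / ((d1 + d2) ^+ 2 + 1) < 1 by rewrite ltr_pdivrMr// mul1r ltrDl.
rewrite /e -mulrA (mulrC _^-1) -mulrA.
rewrite (@lt_trans _ _ (`|J q1 q2 d1 d2| * 2^-1))//; last by rewrite gtr_pMr// invf_lt1// ltr1n.
by rewrite ltr_pM2l// gtr_pMr.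
Qed.

End Goursat.

Section GoursatForm.
Variables (R : realType) (V : fdModType R).

Lemma int_cst (a b : R) (v : V) : a <= b -> int a b (fun=> v) = (b - a) *: v.
Proof.
move=> ab; have dv (t : R) : a <= t <= b -> is_derive t 1 (fun t => t *: v) v.
  by move=> _; exact: is_derive_scalel.
by rewrite (int_FTC ab dv) scalerBl.
Qed.

Lemma pair_norm_le (a b m : R) : `|a| <= m -> `|b| <= m -> `|((a, b) : R * R)| <= m.
Proof. by move=> am bm; rewrite prod_normE /= ge_max am. Qed.

Variables (A B : R * R -> V) (q1 q2 d1 d2 : R).

(** Circulation of the form A ds + B dt along the boundary of the rectangle, counterclockwise. *)
Let J (p1 p2 s1 s2 : R) : V :=
  (int p1 (p1 + s1) (fun s => A (s, p2)) - int p1 (p1 + s1) (fun s => A (s, p2 + s2)))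
  + (int p2 (p2 + s2) (fun t => B (p1 + s1, t)) - int p2 (p2 + s2) (fun t => B (p1, t))).

(** A closed form A ds + B dt has zero circulation even if the partial derivatives are not
    continuous. Near a point, A and B are linear up to a small error, and the linear parts
    contribute nothing since the cross derivatives agree. *)
Lemma goursat_rectangle : 0 <= d1 -> 0 <= d2 ->
  (forall s t, q1 <= s <= q1 + d1 -> q2 <= t <= q2 + d2 ->
    [/\ differentiable A (s, t), differentiable B (s, t) &
        'd A (s, t) (0, 1) = 'd B (s, t) (1, 0)]) ->
  (int q1 (q1 + d1) (fun s => A (s, q2)) - int q1 (q1 + d1) (fun s => A (s, q2 + d2)))
  + (int q2 (q2 + d2) (fun t => B (q1 + d1, t)) - int q2 (q2 + d2) (fun t => B (q1, t))) = 0.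
Proof.
move=> d10 d20 H.
have cst1 (s t : R) : {for s, continuous (fun s => (s, t) : R * R)}.
  by apply: cont_pair; [exact: cvg_id | exact: cont_cst].
have cst2 (s t : R) : {for t, continuous (fun t => (s, t) : R * R)}.
  by apply: cont_pair; [exact: cont_cst | exact: cvg_id].
have cA1 s t : q1 <= s <= q1 + d1 -> q2 <= t <= q2 + d2 ->
    {for s, continuous (fun s => A (s, t))}.
  move=> hs ht; have [dA _ _] := H s t hs ht.
  exact: cont_comp (cst1 s t) (differentiable_continuous dA).
have cB2 s t : q1 <= s <= q1 + d1 -> q2 <= t <= q2 + d2 ->
    {for t, continuous (fun t => B (s, t))}.
  move=> hs ht; have [_ dB _] := H s t hs ht.
  exact: cont_comp (cst2 s t) (differentiable_continuous dB).
apply: (@rectangle_bisection R V J q1 q2 d1 d2 d10 d20) => [p1 p2 s1 s2|z1 z2 e hz1 hz2 e0].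
  case=> s10 s20 /andP[qp1 pq1] /andP[qp2 pq2].
  have e1 : p1 + s1 / 2 + s1 / 2 = p1 + s1 by lra.
  have e2 : p2 + s2 / 2 + s2 / 2 = p2 + s2 by lra.
  rewrite /J e1 e2.
  have l1 : p1 <= p1 + s1 / 2 by lra.
  have l1' : p1 + s1 / 2 <= p1 + s1 by lra.
  have l2 : p2 <= p2 + s2 / 2 by lra.
  have l2' : p2 + s2 / 2 <= p2 + s2 by lra.
  have h1 s : p1 <= s <= p1 + s1 -> q1 <= s <= q1 + d1 by lra.
  have h2 t : p2 <= t <= p2 + s2 -> q2 <= t <= q2 + d2 by lra.
  have iA t : p2 <= t <= p2 + s2 -> int p1 (p1 + s1) (fun s => A (s, t)) =
      int p1 (p1 + s1 / 2) (fun s => A (s, t)) +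
      int (p1 + s1 / 2) (p1 + s1) (fun s => A (s, t)).
    by move=> ht; rewrite int_chasles// => s hs; apply: cA1; [exact: h1 | exact: h2].
  have iB s : p1 <= s <= p1 + s1 -> int p2 (p2 + s2) (fun t => B (s, t)) =
      int p2 (p2 + s2 / 2) (fun t => B (s, t)) +
      int (p2 + s2 / 2) (p2 + s2) (fun t => B (s, t)).
    by move=> hs; rewrite int_chasles// => t ht; apply: cB2; [exact: h1 | exact: h2].
  rewrite (iA p2) ?(iA (p2 + s2)) ?(iB p1) ?(iB (p1 + s1)); try by [apply/andP; split; lra].
  by fd_ring.
have [dA dB dE] := H z1 z2 hz1 hz2.
set a := 'd A (z1, z2) (0, 1) in dE.
have e4 : 0 < e / 2 by rewrite divr_gt0.
have /nbhs_ballP[r1 /= r10 Hr1] := differentiableP_eps dA e4.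
have /nbhs_ballP[r2 /= r20 Hr2] := differentiableP_eps dB e4.
exists (Num.min r1 r2); first by rewrite lt_min r10.
move=> p1 p2 s1 s2 [s10 s20 /andP[qp1 pq1] /andP[qp2 pq2]].
rewrite !lt_min => /andP[sr11 sr12] /andP[sr21 sr22] hp1 hp2.
have l1 : p1 <= p1 + s1 by lra.
have l2 : p2 <= p2 + s2 by lra.
have p2m : q2 <= p2 <= q2 + d2 by lra.
have p2M : q2 <= p2 + s2 <= q2 + d2 by lra.
have p1m : q1 <= p1 <= q1 + d1 by lra.
have p1M : q1 <= p1 + s1 <= q1 + d1 by lra.
have h1 s : p1 <= s <= p1 + s1 -> q1 <= s <= q1 + d1 by lra.
have h2 t : p2 <= t <= p2 + s2 -> q2 <= t <= q2 + d2 by lra.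
have inb (r s t : R) : s1 < r -> s2 < r -> p1 <= s <= p1 + s1 -> p2 <= t <= p2 + s2 ->
    ball ((z1, z2) : R * R) r (s, t).
  move: hp1 hp2; clear -s10 s20 => /andP[? ?] /andP[? ?] sr1 sr2 /andP[? ?] /andP[? ?].
  by split; rewrite -ball_normE /= ltr_norml; apply/andP; split; lra.
have nn s t : p1 <= s <= p1 + s1 -> p2 <= t <= p2 + s2 ->
    `|(s, t) - (z1, z2) : R * R| <= s1 + s2.
  move=> hs ht; rewrite (_ : _ - _ = (s - z1, t - z2))//.
  move: hs ht hp1 hp2; clear -s10 s20 => /andP[? ?] /andP[? ?] /andP[? ?] /andP[? ?].
  by apply: pair_norm_le; rewrite ler_norml; apply/andP; split; lra.
have EA s t : p1 <= s <= p1 + s1 -> p2 <= t <= p2 + s2 ->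
    `|A (s, t) - A (z1, z2) - 'd A (z1, z2) (s - z1, t - z2)| <= e / 2 * (s1 + s2).
  move=> hs ht; apply: (le_trans (Hr1 _ (inb _ _ _ sr11 sr21 hs ht))).
  by rewrite ler_wpM2l ?(ltW e4)// nn.
have EB s t : p1 <= s <= p1 + s1 -> p2 <= t <= p2 + s2 ->
    `|B (s, t) - B (z1, z2) - 'd B (z1, z2) (s - z1, t - z2)| <= e / 2 * (s1 + s2).
  move=> hs ht; apply: (le_trans (Hr2 _ (inb _ _ _ sr12 sr22 hs ht))).
  by rewrite ler_wpM2l ?(ltW e4)// nn.
(* The two terms in [a] integrate to opposite vectors; placed under the integrals, they cancel the
   linear parts of the differences of A and of B. *)
have JE : J p1 p2 s1 s2 =
    int p1 (p1 + s1) (fun s => A (s, p2) - A (s, p2 + s2) + s2 *: a) +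
    int p2 (p2 + s2) (fun t => B (p1 + s1, t) - B (p1, t) - s1 *: a).
  rewrite intD//; last 2 first.
  - by move=> s hs; apply: contB; apply: cA1 => //; exact: h1.
  - by move=> s hs; exact: cont_cst.
  rewrite intB//; last 2 first.
  - by move=> s hs; apply: cA1 => //; exact: h1.
  - by move=> s hs; apply: cA1 => //; exact: h1.
  rewrite intB//; last 2 first.
  - by move=> t ht; apply: contB; apply: cB2 => //; exact: h2.
  - by move=> t ht; exact: cont_cst.
  rewrite intB//; last 2 first.
  - by move=> t ht; apply: cB2 => //; exact: h2.
  - by move=> t ht; apply: cB2 => //; exact: h2.
  rewrite !int_cst//; have -> : p1 + s1 - p1 = s1 by ring.
  have -> : p2 + s2 - p2 = s2 by ring.
  by rewrite /J; fd_ring.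
have p2i : p2 <= p2 <= p2 + s2 by lra.
have p2f : p2 <= p2 + s2 <= p2 + s2 by lra.
have p1i : p1 <= p1 <= p1 + s1 by lra.
have p1f : p1 <= p1 + s1 <= p1 + s1 by lra.
have bA s : p1 <= s <= p1 + s1 ->
    `|A (s, p2) - A (s, p2 + s2) + s2 *: a| <= e * (s1 + s2).
  move=> hs.
  have -> : A (s, p2) - A (s, p2 + s2) + s2 *: a =
      (A (s, p2) - A (z1, z2) - 'd A (z1, z2) (s - z1, p2 - z2)) -
      (A (s, p2 + s2) - A (z1, z2) - 'd A (z1, z2) (s - z1, p2 + s2 - z2)).
    have -> : s2 *: a = 'd A (z1, z2) (s - z1, p2 + s2 - z2) - 'd A (z1, z2) (s - z1, p2 - z2).
      rewrite -linearB -linearZ; congr ('d A _ _); congr (_, _) => /=.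
        by rewrite scaler0 subrr.
      by rewrite [s2 *: 1]mulr1; ring.
    by fd_ring.
  rewrite (le_trans (ler_normB _ _))// (le_trans (lerD (EA _ _ hs p2i) (EA _ _ hs p2f)))//.
  by rewrite -mulrDl -splitr.
have bB t : p2 <= t <= p2 + s2 ->
    `|B (p1 + s1, t) - B (p1, t) - s1 *: a| <= e * (s1 + s2).
  move=> ht.
  have -> : B (p1 + s1, t) - B (p1, t) - s1 *: a =
      (B (p1 + s1, t) - B (z1, z2) - 'd B (z1, z2) (p1 + s1 - z1, t - z2)) -
      (B (p1, t) - B (z1, z2) - 'd B (z1, z2) (p1 - z1, t - z2)).
    have -> : s1 *: a = 'd B (z1, z2) (p1 + s1 - z1, t - z2) - 'd B (z1, z2) (p1 - z1, t - z2).
      rewrite dE -linearB -linearZ; congr ('d B _ _); congr (_, _) => /=.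
        by rewrite [s1 *: 1]mulr1; ring.
      by rewrite scaler0 subrr.
    by fd_ring.
  rewrite (le_trans (ler_normB _ _))// (le_trans (lerD (EB _ _ p1f ht) (EB _ _ p1i ht)))//.
  by rewrite -mulrDl -splitr.
rewrite JE (le_trans (ler_normD _ _))// expr2 mulrA [X in _ <= X]mulrDr lerD//.
  have -> : e * (s1 + s2) * s1 = e * (s1 + s2) * (p1 + s1 - p1) by ring.
  apply: int_le => // s hs.
  apply: contD; last exact: cont_cst.
  by apply: contB; apply: cA1 => //; exact: h1.
have -> : e * (s1 + s2) * s2 = e * (s1 + s2) * (p2 + s2 - p2) by ring.
apply: int_le => // t ht.
apply: contB; last exact: cont_cst.
by apply: contB; apply: cB2 => //; exact: h2.
Qed.

End GoursatForm.

(** * The Cauchy formula over a commutative plane *)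

Section Polar.
Variables (R : realType) (L : falgType R).
Local Notation A := (fdnormed L).
Local Notation tau := (pi *+ 2 : R).
Implicit Types (c : A) (t r : R).

(** Nonzero elements of the real plane of 1 and c are units; in other words, multiplication by c has
    no real eigenvalue. This plane replaces the complex numbers, though it need not be closed under
    product. *)
Definition nonreal c := forall s t : R, (s != 0) || (t != 0) ->
  (s *: 1 + t *: c : A) \is a GRing.unit.

(** The analogue of exp(i t), running on a closed curve around 0 in the plane of 1 and c; [dpw c] is
    its derivative. *)
Definition pw c t : A := cos t *: 1 + sin t *: c.
Definition dpw c t : A := - sin t *: 1 + cos t *: c.

Lemma pw_unit c t : nonreal c -> pw c t \is a GRing.unit.
Proof.
move=> gc; apply: gc; rewrite -negb_and; apply/negP => /andP[/eqP c0 /eqP s0].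
by have := cos2Dsin2 t; rewrite c0 s0 expr0n /= addr0 => /esym/eqP; rewrite oner_eq0.
Qed.

Lemma comm_lin c (a b : R) (x : A) : x * c = c * x ->
  x * (a *: 1 + b *: c) = (a *: 1 + b *: c) * x.
Proof. by move=> xc; rewrite mulrDr mulrDl -!scalerAr -!scalerAl mulr1 mul1r xc. Qed.

Lemma comm_pw c t x : x * c = c * x -> x * pw c t = pw c t * x.
Proof. exact: comm_lin. Qed.

Lemma comm_dpw c t x : x * c = c * x -> x * dpw c t = dpw c t * x.
Proof. exact: comm_lin. Qed.

Lemma comm_pwV c t (x : A) : x * c = c * x -> x * (pw c t)^-1 = (pw c t)^-1 * x.
Proof. by move=> xc; apply: commrV; exact: comm_pw. Qed.

Lemma dpwC c t : dpw c t * c = c * dpw c t.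
Proof. by rewrite (@comm_dpw c t c). Qed.

Lemma is_derive_pw c t : is_derive t 1 (pw c) (dpw c t).
Proof.
have := is_deriveD (is_derive_scale (is_derive_cos t) (is_derive_cst (1 : A) t 1))
  (is_derive_scale (is_derive_sin t) (is_derive_cst c t 1)).
by rewrite !scaler0 !addr0.
Qed.

Lemma cos_differentiable t : differentiable (cos : R -> R) t.
Proof. by apply/derivable1_diffP; case: (is_derive_cos t). Qed.

Lemma sin_differentiable t : differentiable (sin : R -> R) t.
Proof. by apply/derivable1_diffP; case: (is_derive_sin t). Qed.

Lemma pw_differentiable c t : differentiable (pw c) t.
Proof. by have [] := is_derive_differentiable (is_derive_pw c t). Qed.

Lemma dpw_differentiable c t : differentiable (dpw c) t.
Proof.
apply: differentiableD; apply: differentiable_scale; try exact: differentiable_cst.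
  by apply: differentiableN; exact: sin_differentiable.
exact: cos_differentiable.
Qed.

Lemma dpw_continuous c : continuous (dpw c).
Proof. by move=> t; exact: differentiable_continuous (dpw_differentiable c t). Qed.

Lemma pwV_differentiable c t : nonreal c -> differentiable (fun t => (pw c t)^-1 : A) t.
Proof. by move=> gc; apply: differentiableVA; [exact: pw_unit | exact: pw_differentiable]. Qed.

Lemma pwV_continuous c : nonreal c -> continuous (fun t => (pw c t)^-1 : A).
Proof. by move=> gc t; exact: differentiable_continuous (pwV_differentiable t gc). Qed.

Lemma is_derive_pwV c t : nonreal c ->
  is_derive t 1 (fun t => (pw c t)^-1 : A) (- ((pw c t)^-1 * dpw c t * (pw c t)^-1)).
Proof. by move=> gc; apply: is_derive_inv; [exact: pw_unit | exact: is_derive_pw]. Qed.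

(* The logarithmic derivative of the circle and the kernel of the Cauchy formula
   for the first derivative. *)
Definition ker1 c t : A := (pw c t)^-1 * dpw c t.
Definition ker2 c t : A := (pw c t)^-1 * (pw c t)^-1 * dpw c t.

(** The integral of dz / z along the loop [pw c], which stands for 2 pi i. *)
Definition kappa c : A := int 0 tau (ker1 c).

Lemma ker1_continuous c : nonreal c -> continuous (ker1 c).
Proof.
move=> gc t; apply: (@contMA _ _ _ (fun t => (pw c t)^-1 : A) (dpw c)).
  exact: pwV_continuous.
exact: dpw_continuous.
Qed.

Lemma ker2_continuous c : nonreal c -> continuous (ker2 c).
Proof.
move=> gc t.
apply: (@contMA _ _ _ (fun t => (pw c t)^-1 * (pw c t)^-1 : A) (dpw c)); last exact: dpw_continuous.
by apply: contMA; exact: pwV_continuous.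
Qed.

Lemma ker2_pw c t : nonreal c -> ker2 c t * pw c t = ker1 c t.
Proof.
move=> gc; rewrite /ker2 -[LHS]mulrA (comm_pw t (dpwC c t)) mulrA -[_ * _ * pw c t]mulrA.
by rewrite mulVr ?mulr1// pw_unit.
Qed.

Lemma tau_ge0 : 0 <= tau. Proof. by rewrite mulrn_wge0// pi_ge0. Qed.

Lemma pw_tau c : pw c tau = pw c 0.
Proof. by rewrite /pw cos2pi sin2pi cos0 sin0. Qed.

Variables (X : normedModType R) (u h x : X).

Definition pol (z : R * R) : X := z.1 *: (cos z.2 *: u + sin z.2 *: h) + x.

Lemma pol_differentiable z : differentiable pol z.
Proof.
have d1 : differentiable (fun z : R * R => z.1) z by exact: differentiable_fst.
have d2 : differentiable (fun z : R * R => z.2) z by exact: differentiable_snd.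
apply: differentiableD; last exact: differentiable_cst.
apply: differentiable_scale => //; apply: differentiableD.
  apply: differentiable_scale; last exact: differentiable_cst.
  by apply: (@differentiable_comp _ _ _ _ (fun z : R * R => z.2) (cos : R -> R)) => //; exact: cos_differentiable.
apply: differentiable_scale; last exact: differentiable_cst.
by apply: (@differentiable_comp _ _ _ _ (fun z : R * R => z.2) (sin : R -> R)) => //; exact: sin_differentiable.
Qed.

Lemma pol_tau r : pol (r, tau) = pol (r, 0).
Proof. by rewrite /pol /= cos2pi sin2pi cos0 sin0. Qed.

Lemma is_derive_pol1 r t : is_derive r 1 (fun r => pol (r, t)) (cos t *: u + sin t *: h).
Proof.
have := is_deriveD (is_derive_scalel r (cos t *: u + sin t *: h)) (is_derive_cst x r 1).
by rewrite addr0.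
Qed.

Lemma is_derive_pol2 r t :
  is_derive t 1 (fun t => pol (r, t)) (r *: (- sin t *: u + cos t *: h)).
Proof.
have d1 := is_derive_scale (is_derive_cos t) (is_derive_cst u t 1).
have d2 := is_derive_scale (is_derive_sin t) (is_derive_cst h t 1).
have := is_deriveD (is_derive_scale (is_derive_cst r t 1) (is_deriveD d1 d2)) (is_derive_cst x t 1).
by rewrite !scaler0 !addr0 scale0r add0r.
Qed.

Variables (c : A) (f : X -> A).

Definition cauchy_riemann (y : X) := differentiable f y /\ 'd f y h = c * 'd f y u.

Lemma is_derive_radial r t : cauchy_riemann (pol (r, t)) ->
  is_derive r 1 (fun r => f (pol (r, t))) (pw c t * 'd f (pol (r, t)) u).
Proof.
move=> [df dh]; have := is_derive_curve (is_derive_pol1 r t) df.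
by rewrite linearD !linearZ /= dh mulrDl -!scalerAl mul1r.
Qed.

Lemma is_derive_angular r t : cauchy_riemann (pol (r, t)) ->
  is_derive t 1 (fun t => f (pol (r, t))) (r *: (dpw c t * 'd f (pol (r, t)) u)).
Proof.
move=> [df dh]; have := is_derive_curve (is_derive_pol2 r t) df.
by rewrite linearZ linearD !linearZ /= dh mulrDl -!scalerAl mul1r.
Qed.

End Polar.

Section CauchyFormulas.
Variables (R : realType) (L : falgType R).
Local Notation A := (fdnormed L).
Local Notation tau := (pi *+ 2 : R).

Lemma mulA_linear_right (y : A) : linear (fun x : A => x * y : A).
Proof. by move=> k a b; rewrite mulrDl scalerAl. Qed.

Lemma int_mull (a b : R) (v : A) (g : R -> A) : a <= b ->
  (forall t, a <= t <= b -> {for t, continuous g}) ->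
  int a b (fun t => v * g t) = v * int a b g.
Proof. by move=> ab cg; rewrite -(int_lin ( *%R v) ab cg). Qed.

Lemma int_mulr (a b : R) (v : A) (g : R -> A) : a <= b ->
  (forall t, a <= t <= b -> {for t, continuous g}) ->
  int a b (fun t => g t * v) = int a b g * v.
Proof.
move=> ab cg.
pose l := HB.pack_for {linear A -> A} (fun x : A => x * v : A)
  (GRing.isLinear.Build _ _ _ _ _ (mulA_linear_right v)).
by rewrite -[RHS](int_lin l ab cg).
Qed.

Lemma bounded_on_segment (V : normedModType R) (a b : R) (g : R -> V) : a <= b ->
  (forall t, a <= t <= b -> {for t, continuous g}) ->
  exists M : R, forall t, a <= t <= b -> `|g t| <= M.
Proof.
move=> ab cg; have [|m mab Hm] := @EVT_max R (fun t => `|g t|) a b ab.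
  apply: continuous_in_subspaceT => t; rewrite inE /= in_itv /= => tab.
  by apply: (cont_comp (cg t tab)); exact: norm_continuous.
by exists `|g m| => t tab; apply: Hm; rewrite in_itv.
Qed.

Lemma is_derive_pair1 (s t : R) : is_derive s 1 (fun s => (s, t) : R * R) (1, 0).
Proof.
apply/is_deriveP => e e0; near=> h.
rewrite (_ : _ - _ - _ = 0) ?normr0 ?mulr_ge0 ?(ltW e0)//.
rewrite [h *: 1]mulr1; apply/eqP; rewrite xpair_eqE /= scaler0 [h *: 1]mulr1.
by rewrite addrK !subrr !eqxx.
Unshelve. all: by end_near. Qed.

Lemma is_derive_pair2 (s t : R) : is_derive t 1 (fun t => (s, t) : R * R) (0, 1).
Proof.
apply/is_deriveP => e e0; near=> h.
rewrite (_ : _ - _ - _ = 0) ?normr0 ?mulr_ge0 ?(ltW e0)//.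
rewrite [h *: 1]mulr1; apply/eqP; rewrite xpair_eqE /= scaler0 [h *: 1]mulr1.
by rewrite addrK !subrr !eqxx.
Unshelve. all: by end_near. Qed.

Lemma is_derive_Rinv (s : R) : s != 0 -> is_derive s 1 (fun s : R => s^-1) (- (s^-1 * s^-1)).
Proof.
move=> s0; have [d1 d2] := is_derive_id s (1 : R).
split; first exact: derivableV.
by rewrite deriveV// d2 [_ *: 1]mulr1 expr2 invfM.
Qed.

Lemma Rinv_differentiable (s : R) : s != 0 -> differentiable (fun s : R => s^-1) s.
Proof. by move=> s0; have [] := is_derive_differentiable (is_derive_Rinv s0). Qed.

Variables (c : A) (gc : nonreal c).

Lemma ker2E t : (pw c t)^-1 * dpw c t * (pw c t)^-1 = ker2 c t.
Proof. by rewrite /ker2 -!mulrA (@comm_pwV _ _ c t _ (dpwC c t)). Qed.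

Lemma int_ker2 : int 0 tau (ker2 c) = 0.
Proof.
have d t : 0 <= t <= tau -> is_derive t 1 (fun t => - (pw c t)^-1 : A) (ker2 c t).
  move=> _; have := is_deriveN (is_derive_pwV t gc).
  by rewrite opprK ker2E.
by rewrite (int_FTC (tau_ge0 R) d) pw_tau subrr.
Qed.

Variables (X : normedModType R) (u h x : X) (f : X -> A).
Local Notation pol := (pol u h x).

Lemma pol_continuous : continuous pol.
Proof. by move=> z; exact: differentiable_continuous (pol_differentiable u h x z). Qed.

Lemma circle_continuous r : (forall t, differentiable f (pol (r, t))) ->
  continuous (fun t => f (pol (r, t))).
Proof.
move=> df t; apply: (@cont_comp _ _ _ _ (fun t => pol (r, t))).
  exact: is_derive_continuous (is_derive_pol2 u h x r t).
exact: differentiable_continuous.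
Qed.

(** With z = r [pw c t], the form FA dr + FB dt is f dz / z^2 in polar coordinates. The
    Cauchy-Riemann equation makes it closed, and in Goursat's lemma on [r1, r2] x [0, tau] the sides
    t = 0 and t = tau cancel. *)
Lemma ker2_circle_invariance (r1 r2 : R) : 0 < r1 -> r1 <= r2 ->
  (forall r t, r1 <= r <= r2 -> cauchy_riemann u h c f (pol (r, t))) ->
  r1^-1 *: int 0 tau (fun t => ker2 c t * f (pol (r1, t))) =
  r2^-1 *: int 0 tau (fun t => ker2 c t * f (pol (r2, t))).
Proof.
move=> r10 r12 CR.
pose FA (z : R * R) : A := (z.1^-1 * z.1^-1) *: ((pw c z.2)^-1 * f (pol z)).
pose FB (z : R * R) : A := z.1^-1 *: (ker2 c z.2 * f (pol z)).
have d1 z : differentiable (fun z : R * R => z.1) z by exact: differentiable_fst.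
have d2 z : differentiable (fun z : R * R => z.2) z by exact: differentiable_snd.
have dinv s t : r1 <= s -> differentiable (fun z : R * R => z.1^-1) (s, t).
  move=> rs; apply: (@differentiable_comp _ _ _ _ (fun z : R * R => z.1) (fun s : R => s^-1)) => //=.
  by apply: Rinv_differentiable; rewrite gt_eqF// (lt_le_trans r10).
have dV z : differentiable (fun z : R * R => (pw c z.2)^-1 : A) z.
  apply: (@differentiable_comp _ _ _ _ (fun z : R * R => z.2) (fun t => (pw c t)^-1 : A)) => //=.
  exact: pwV_differentiable.
have dk2 z : differentiable (fun z : R * R => ker2 c z.2 : A) z.
  apply: (@differentiableMA _ _ _ (fun z : R * R => (pw c z.2)^-1 * (pw c z.2)^-1) (fun z => dpw c z.2)).
    exact: differentiableMA.
  by apply: (@differentiable_comp _ _ _ _ (fun z : R * R => z.2) (dpw c)) => //; exact: dpw_differentiable.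
have df s t : r1 <= s <= r2 -> differentiable (f \o pol) (s, t).
  move=> hs; have [dfs _] := CR s t hs.
  by apply: differentiable_comp => //; exact: pol_differentiable.
have H s t : r1 <= s <= r1 + (r2 - r1) -> 0 <= t <= 0 + tau ->
    [/\ differentiable FA (s, t), differentiable FB (s, t) &
        'd FA (s, t) (0, 1) = 'd FB (s, t) (1, 0)].
  rewrite addrCA subrr addr0 => hs _; have [rs sr] := andP hs.
  have s0 : s != 0 by rewrite gt_eqF// (lt_le_trans r10).
  have dA : differentiable FA (s, t).
    apply: differentiable_scale; first by apply: differentiableM; exact: dinv.
    by apply: (@differentiableMA _ _ _ _ (f \o pol)) => //; exact: df.
  have dB : differentiable FB (s, t).
    apply: differentiable_scale; first exact: dinv.
    by apply: (@differentiableMA _ _ _ _ (f \o pol)) => //; exact: df.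
  split=> //; have cr := CR s t hs.
  have e1 := is_derive_curve (is_derive_pair2 s t) dA.
  have e2 := is_derive_curve (is_derive_pair1 s t) dB.
  have a1 := is_derive_scale (is_derive_cst (s^-1 * s^-1) t 1)
    (is_deriveMA (is_derive_pwV t gc) (is_derive_angular cr)).
  have b1 := is_derive_scale (is_derive_Rinv s0)
    (is_deriveMAr (ker2 c t) (is_derive_radial cr)).
  have E1 := @is_derive_unique R _ _ (fun y => FA (s, y)) t 1 _ _ e1 a1.
  have E2 := @is_derive_unique R _ _ (fun y => FB (y, t)) s 1 _ _ e2 b1.
  refine (etrans E1 (etrans _ (esym E2))).
  clear E1 E2 e1 e2 a1 b1 dA dB.
  set G := 'd f _ u; rewrite scale0r add0r scaleNr mulNr scalerDr scalerN.
  rewrite ker2E.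
  congr (_ + _); rewrite -scalerAr scalerA mulfVK//.
  by congr (_ *: _); rewrite !mulrA ker2_pw.
have r120 : 0 <= r2 - r1 by rewrite subr_ge0.
have := @goursat_rectangle R A FA FB r1 0 (r2 - r1) tau r120 (tau_ge0 R) H.
have -> : r1 + (r2 - r1) = r2 by ring.
rewrite add0r.
have -> : (fun s => FA (s, tau)) = (fun s => FA (s, 0)).
  by apply/funext => s; rewrite /FA /= pw_tau pol_tau.
rewrite subrr add0r => /eqP; rewrite subr_eq0 => /eqP E.
have cf r t : r1 <= r <= r2 -> {for t, continuous (fun t => ker2 c t * f (pol (r, t)))}.
  move=> hr; apply: contMA; first exact: ker2_continuous.
  by apply: circle_continuous => t'; have [] := CR r t' hr.
have h1 : r1 <= r1 <= r2 by rewrite lexx.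
have h2 : r1 <= r2 <= r2 by rewrite r12 lexx.
rewrite -(intZ _ (tau_ge0 R) (fun t _ => cf r1 t h1)).
by rewrite -(intZ _ (tau_ge0 R) (fun t _ => cf r2 t h2)); exact: esym E.
Qed.

Lemma pol0 t : pol (0, t) = x.
Proof. by rewrite /pol /= scale0r add0r. Qed.

Lemma polB r t : pol (r, t) - x = r *: (cos t *: u + sin t *: h).
Proof. by rewrite /pol /= addrK. Qed.

(** The circle is shrunk to x: [int_ker2] removes the constant f x, and the first-order term gives
    [kappa c * 'd f x u]. A formula for the derivative, rather than for f, yields at once the
    continuity of the derivative. *)
Lemma cauchy_derivative (r : R) : 0 < r ->
  (forall s t, 0 <= s <= r -> cauchy_riemann u h c f (pol (s, t))) ->
  kappa c * 'd f x u = r^-1 *: int 0 tau (fun t => ker2 c t * f (pol (r, t))).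
Proof.
move=> r0 CR.
have [dfx dfh] : cauchy_riemann u h c f x.
  by rewrite -(pol0 0); apply: CR; rewrite lexx ltW.
have [K K0 mK] := mulA_bounded L.
have [M HM] : exists M, forall t, 0 <= t <= tau -> `|ker2 c t| <= M.
  by apply: bounded_on_segment; [exact: tau_ge0 | move=> t _; exact: ker2_continuous].
have M0 : 0 <= M by apply: le_trans (HM 0 _); rewrite ?lexx ?tau_ge0.
pose C := K * M * (`|u| + `|h|) * tau.
have C0 : 0 <= C by rewrite !mulr_ge0 ?tau_ge0// ltW.
apply/eqP; rewrite -subr_eq0 -normr_le0; apply/ler_addgt0Pr => e e0; rewrite add0r.
have e1 : 0 < e / (C + 1) by rewrite divr_gt0// ltr_wpDl.
have /nbhs_ballP[d /= d0 Hd] := differentiableP_eps dfx e1.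
(* A radius at most r whose circle lies in the ball where f is close to its first-order
   expansion. *)
pose s := Num.min r (d / 2 / (`|u| + `|h| + 1)).
have n0 : 0 < `|u| + `|h| + 1 by rewrite ltr_wpDl// addr_ge0.
have s0 : 0 < s by rewrite lt_min r0 !divr_gt0.
have sr : s <= r by rewrite ge_min lexx.
rewrite -(@ker2_circle_invariance s r)//; last first.
  by move=> s' t /andP[ss s'r]; apply: CR; rewrite s'r (le_trans (ltW s0)).
have ce t : `|cos t *: u + sin t *: h| <= `|u| + `|h|.
  rewrite (le_trans (ler_normD _ _))// lerD// normrZ ler_piMl//.
    by rewrite ler_norml cos_geN1 cos_le1.
  by rewrite ler_norml sin_geN1 sin_le1.
have cfs t : {for t, continuous (fun t => f (pol (s, t)))}.
  by apply: circle_continuous => t'; have [] := CR s t' _ => //; rewrite sr ltW.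
have ck2 t : {for t, continuous (ker2 c)} by exact: ker2_continuous.
have ck1 t : {for t, continuous (ker1 c)} by exact: ker1_continuous.
have E : kappa c * 'd f x u - s^-1 *: int 0 tau (fun t => ker2 c t * f (pol (s, t))) =
    int 0 tau (fun t => - (s^-1 *: (ker2 c t * (f (pol (s, t)) - f x - 'd f x (pol (s, t) - x))))).
  rewrite -int_mulr ?tau_ge0// -intZ ?tau_ge0//; last by move=> t _; exact: contMA.
  have -> : int 0 tau (fun t => ker1 c t * 'd f x u) =
      int 0 tau (fun t => ker1 c t * 'd f x u + s^-1 *: (ker2 c t * f x)).
    rewrite (@intD R A _ _ _ _ (tau_ge0 R)); last 2 first.
    - by move=> t _; apply: contMA => //; exact: cont_cst.
    - by move=> t _; apply: contZr; apply: contMA => //; exact: cont_cst.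
    rewrite (@intZ R A _ _ _ _ (tau_ge0 R)); last by move=> t _; apply: contMA => //; exact: cont_cst.
    by have := int_mulr (f x) (tau_ge0 R) (fun t _ => ck2 t); rewrite int_ker2 mul0r => ->; rewrite scaler0 addr0.
  rewrite -(@intB R A _ _ _ _ (tau_ge0 R)); last 2 first.
  - move=> t _; apply: contD; first by apply: contMA => //; exact: cont_cst.
    by apply: contZr; apply: contMA => //; exact: cont_cst.
  - by move=> t _; apply: contZr; exact: contMA.
  apply: eq_int => [|t _]; first exact: tau_ge0.
  have -> : 'd f x (pol (s, t) - x) = s *: (pw c t * 'd f x u).
    by rewrite polB linearZ linearD !linearZ /= dfh mulrDl -!scalerAl mul1r.
  rewrite !mulrBr !scalerBr -scalerAr scalerA mulVf ?gt_eqF// scale1r mulrA ker2_pw//.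
  by fd_ring.
rewrite E (@le_trans _ _ (K * M * (`|u| + `|h|) * (e / (C + 1)) * (tau - 0)))//.
  apply: int_le; first exact: tau_ge0.
    move=> t _; apply: (@cont_comp _ _ _ _ _ (fun y : A => - y)); last exact: opp_continuous.
    apply: contZr; apply: contMA => //; apply: contB.
      by apply: contB => //; exact: cont_cst.
    apply: (@cont_comp _ _ _ _ (fun t => pol (s, t) - x) ('d f x)).
      apply: contB; last exact: cont_cst.
      exact: is_derive_continuous (is_derive_pol2 u h x s t).
    exact: diff_continuous.
  move=> t ht; rewrite normrN normrZ normfV (gtr0_norm s0) ler_pdivrMl//.
  rewrite (le_trans (mK _ _))//.
  have px := polB s t.
  have b1 : `|f (pol (s, t)) - f x - 'd f x (pol (s, t) - x)| <= e / (C + 1) * (s * (`|u| + `|h|)).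
    apply: (le_trans (Hd _ _)).
      rewrite -ball_normE /= distrC px normrZ (gtr0_norm s0).
      rewrite (@le_lt_trans _ _ (s * (`|u| + `|h| + 1)))//.
        by rewrite ler_pM2l// (le_trans (ce t))// lerDl.
      rewrite -ltr_pdivlMr// (@le_lt_trans _ _ (d / 2 / (`|u| + `|h| + 1)))//.
        by rewrite ge_min lexx orbT.
      by rewrite ltr_pM2r ?invr_gt0// gtr_pMr// invf_lt1// ltr1n.
    by rewrite ler_pM2l// px normrZ (gtr0_norm s0) ler_pM2l.
  have -> : s * (K * M * (`|u| + `|h|) * (e / (C + 1))) =
     K * M * (e / (C + 1) * (s * (`|u| + `|h|))) by ring.
  by apply: ler_pM => //; [rewrite mulr_ge0 ?(ltW K0) | rewrite ler_pM2l// HM].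
have -> : K * M * (`|u| + `|h|) * (e / (C + 1)) * (tau - 0) = e * (C / (C + 1)).
  by rewrite subr0 /C; ring.
by rewrite ler_piMr ?(ltW e0)// ler_pdivrMr ?ltr_wpDl// mul1r lerDl.
Qed.

End CauchyFormulas.

Definition C1_on (R : realType) (X V : normedModType R) (U : set X) (f : X -> V) :=
  forall y, U y -> differentiable f y /\ forall k, {for y, continuous (fun y => 'd f y k)}.

Section CauchyPompeiu.
Variables (R : realType) (L : falgType R).
Local Notation A := (fdnormed L).
Local Notation tau := (pi *+ 2 : R).
Variables (c : A) (gc : nonreal c).
Variables (X : normedModType R) (u h x : X) (f : X -> A) (U : set X).
Hypotheses (oU : open U) (fC1 : C1_on U f).
Local Notation pol := (pol u h x).

Lemma open_near_segment (T : topologicalType) (F : T -> X) (z : T) :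
  {for z, continuous F} -> U (F z) -> \forall w \near z, U (F w).
Proof. by move=> cF Uz; exact: (cF _ (open_nbhs_nbhs (conj oU Uz))). Qed.

Lemma C1_differential_continuous (T : topologicalType) (F : T -> X) (z : T) k :
  {for z, continuous F} -> U (F z) -> {for z, continuous (fun w => 'd f (F w) k)}.
Proof.
by move=> cF Uz; exact: (@cont_comp _ _ _ _ F (fun y => 'd f y k) cF ((fC1 Uz).2 k)).
Qed.

Lemma C1_continuous (T : topologicalType) (F : T -> X) (z : T) :
  {for z, continuous F} -> U (F z) -> {for z, continuous (fun w => f (F w))}.
Proof.
move=> cF Uz; apply: (@cont_comp _ _ _ _ F f cF); apply: differentiable_continuous.
by have [] := fC1 Uz.
Qed.

Let cpol2 s t : {for t, continuous (fun t => pol (s, t))}.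
Proof. exact: is_derive_continuous (is_derive_pol2 u h x s t). Qed.

Let csin (t : R) : {for t, continuous (sin : R -> R)}.
Proof. exact: continuous_sin. Qed.

Let ccos (t : R) : {for t, continuous (cos : R -> R)}.
Proof. exact: continuous_cos. Qed.

Let D0 y := 'd f y h - c * 'd f y u.

(** The weighted mean [K s] of f over the circle of radius s has for derivative the mean of
    [ker1 c t * P s t], P being the radial derivative. By [EP] this is an angular derivative, with
    zero integral, minus the term in D0; it remains to integrate from 0 to r. *)
Lemma cauchy_pompeiu r : 0 <= r -> (forall s t, 0 <= s <= r -> U (pol (s, t))) ->
  int 0 r (fun s => int 0 tau (fun t => (pw c t)^-1 * D0 (pol (s, t)))) =
  kappa c * f x - int 0 tau (fun t => ker1 c t * f (pol (r, t))).
Proof.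
move=> r0 Ur.
pose K s := int 0 tau (fun t => ker1 c t * f (pol (s, t))).
pose P s t := cos t *: 'd f (pol (s, t)) u + sin t *: 'd f (pol (s, t)) h.
pose E s t := - sin t *: 'd f (pol (s, t)) u + cos t *: 'd f (pol (s, t)) h.
have t0 := tau_ge0 R.
have cd s t k : 0 <= s <= r -> {for t, continuous (fun t => 'd f (pol (s, t)) k)}.
  by move=> hs; apply: C1_differential_continuous; [exact: cpol2 | exact: Ur].
have cE s t : 0 <= s <= r -> {for t, continuous (E s)}.
  move=> hs; apply: contD; apply: contZ; try exact: cd; last exact: ccos.
  by apply: (@cont_comp _ _ _ _ sin (fun y : R => - y)) => //; exact: opp_continuous.
have cD0 s t : 0 <= s <= r -> {for t, continuous (fun t => (pw c t)^-1 * D0 (pol (s, t)))}.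
  move=> hs; apply: contMA; first exact: pwV_continuous.
  by apply: contB; [exact: cd | apply: contMAr; exact: cd].
have EP s t : ker1 c t * P s t = E s t - (pw c t)^-1 * D0 (pol (s, t)).
  rewrite /P /E /D0; set a := 'd f _ u; set b := 'd f _ h.
  have Up : pw c t \is a GRing.unit by exact: pw_unit.
  apply: (@mulrI _ (pw c t)) => //; rewrite mulrBr !mulrA mulrV// !mul1r.
  rewrite /pw /dpw !mulrDl -!scalerAl !mul1r !mulrDr -!scalerAr.
  have cs : cos t ^+ 2 = 1 - sin t ^+ 2 by rewrite -(cos2Dsin2 t) addrK.
  by apply: fd_ext => i; rewrite ?(fdcD, fdcN, fdcZ); ring: cs.
have intE0 s : 0 <= s <= r -> int 0 tau (E s) = 0.
  (* For s > 0 the function E s is the derivative of f on the circle divided by s; for s = 0 an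
     explicit primitive is needed. *)
  move=> hs; have [->|s0] := eqVneq s 0.
    have d t : 0 <= t <= tau ->
        is_derive t 1 (fun t => cos t *: 'd f x u + sin t *: 'd f x h) (E 0 t).
      move=> _; rewrite /E pol0.
      have := is_deriveD (is_derive_scale (is_derive_cos t) (is_derive_cst ('d f x u) t 1))
        (is_derive_scale (is_derive_sin t) (is_derive_cst ('d f x h) t 1)).
      by rewrite !scaler0 !addr0.
    by rewrite (int_FTC t0 d) cos2pi sin2pi cos0 sin0 subrr.
  have d t : 0 <= t <= tau -> is_derive t 1 (fun t => f (pol (s, t))) (s *: E s t).
    move=> _; have [df _] := fC1 (Ur s t hs).
    have := is_derive_curve (is_derive_pol2 u h x s t) df.
    by rewrite linearZ linearD !linearZ.
  have := int_FTC t0 d; rewrite pol_tau subrr.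
  rewrite (@intZ R A _ _ s (E s) t0 (fun t _ => cE s t hs)) => /eqP.
  by rewrite scaler_eq0 (negbTE s0) => /eqP.
have dK s : 0 <= s <= r ->
    is_derive s 1 (fun s => - K s) (int 0 tau (fun t => (pw c t)^-1 * D0 (pol (s, t)))).
  move=> hs.
  have near_U : \forall z \near s, forall t, 0 <= t <= tau -> U (pol (z, t)).
    apply: (@near_segment R R s 0 tau (fun z t => U (pol (z, t)))) => t _.
    apply: (@open_near_segment _ (fun z : R * R => pol (z.1, z.2)) (s, t)); last exact: Ur.
    rewrite (_ : (fun z : R * R => pol (z.1, z.2)) = pol); first exact: pol_continuous.
    by apply/funext => -[].
  have dK : is_derive s 1 K (int 0 tau (fun t => ker1 c t * P s t)).
    apply: (@int_parameter_derive R A (fun s t => ker1 c t * f (pol (s, t)))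
      (fun s t => ker1 c t * P s t) s 0 tau t0).
    - near=> z => t ht; have Uz : U (pol (z, t)) by move: t ht; near: z.
      have [df _] := fC1 Uz; apply: is_deriveMAr.
      have := is_derive_curve (is_derive_pol1 u h x z t) df.
      by rewrite linearD !linearZ.
    - near=> z => t ht; have Uz : U (pol (z, t)) by move: t ht; near: z.
      apply: contMA; first exact: ker1_continuous.
      by apply: C1_continuous => //; exact: cpol2.
    - move=> t ht.
      have c2 (W : topologicalType) (F : R -> W) : {for t, continuous F} ->
          {for (s, t), continuous (fun z : R * R => F z.2)}.
        by move=> cF; apply: (@cont_comp _ _ _ _ (fun z : R * R => z.2) F); [exact: cvg_snd | exact: cF].
      have cdd k : {for (s, t), continuous (fun z : R * R => 'd f (pol (z.1, z.2)) k)}.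
        apply: (@C1_differential_continuous _ (fun z : R * R => pol (z.1, z.2))); last exact: Ur.
        rewrite (_ : (fun z : R * R => pol (z.1, z.2)) = pol); first exact: pol_continuous.
        by apply/funext => -[].
      apply: contMA; first by apply: c2; exact: ker1_continuous.
      by apply: contD; apply: contZ => //; apply: c2; [exact: ccos | exact: csin].
  have := is_deriveN dK; congr (is_derive _ _ _ _).
  have -> : int 0 tau (fun t => ker1 c t * P s t) =
     int 0 tau (fun t => E s t - (pw c t)^-1 * D0 (pol (s, t))).
    by apply: eq_int => // t _; exact: EP.
  rewrite (@intB R A _ _ (E s) _ t0 (fun t _ => cE s t hs) (fun t _ => cD0 s t hs)).
  by rewrite intE0// sub0r opprK.
rewrite (int_FTC r0 dK) opprK addrC; congr (_ - _).
rewrite /K; under eq_fun do rewrite pol0.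
exact: (int_mulr (f x) t0 (fun t _ => ker1_continuous gc (x:=t))).
Unshelve. all: by end_near. Qed.

Lemma cauchy_mean_value r : 0 <= r -> (forall s t, 0 <= s <= r -> U (pol (s, t))) ->
  (forall y, U y -> 'd f y h = c * 'd f y u) ->
  kappa c * f x = int 0 tau (fun t => ker1 c t * f (pol (r, t))).
Proof.
move=> r0 Ur CR; have := cauchy_pompeiu r0 Ur.
have -> : int 0 r (fun s => int 0 tau (fun t => (pw c t)^-1 * D0 (pol (s, t)))) = 0.
  rewrite (@eq_int R A 0 r _ (fun=> 0) r0); first by rewrite int_cst// scaler0.
  move=> s hs; rewrite (@eq_int R A 0 tau _ (fun=> 0) (tau_ge0 R)).
    by rewrite int_cst ?tau_ge0// scaler0.
  by move=> t _; rewrite /D0 CR ?subrr ?mulr0//; exact: Ur.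
by move/esym/eqP; rewrite subr_eq0 => /eqP.
Qed.

End CauchyPompeiu.

(** * Invertibility of [kappa c] *)

Lemma real_poly_factor (R : rcfType) (p : {poly R}) : (1 < size p)%N ->
  exists a q, p = q * ('X - a%:P) \/
    exists2 b, b != 0 & p = q * (('X - a%:P) ^+ 2 + (b ^+ 2)%:P).
Proof.
move=> p1; pose pC := map_poly (real_complex R) p.
have [g gp] : exists g, root pC g.
  by apply/closed_rootP; rewrite size_map_poly; rewrite neq_ltn p1 orbT.
case: g gp => a b; have [->|b0] := eqVneq b 0 => gp.
  have : root p a by rewrite -(fmorph_root (real_complex R)).
  by move=> /factor_theorem[q ->]; exists a, q; left.
pose Q : {poly R} := ('X - a%:P) ^+ 2 + (b ^+ 2)%:P.
have sQ : size Q = 3%N.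
  by rewrite size_polyDl size_exp_XsubC// size_polyC; case: (_ != 0).
have Q0 : Q != 0 by rewrite -size_poly_eq0 sQ.
have rQ : root (map_poly (real_complex R) Q) (Complex a b).
  rewrite /root /Q rmorphD rmorphXn rmorphB /= map_polyX !map_polyC /=.
  rewrite !hornerE /=; apply/eqP.
  by rewrite /GRing.exp /=; simpc; congr (_ +i* _)%C; ring.
exists a, (p %/ Q); right; exists b => //.
rewrite -/Q {1}(divp_eq p Q).
have sr : (size (p %% Q)%R <= 2)%N by rewrite -ltnS -sQ ltn_modp.
have rr : root (map_poly (real_complex R) (p %% Q)) (Complex a b).
  move: gp; rewrite /pC {1}(divp_eq p Q) rmorphD rmorphM /= /root hornerD hornerM.
  by rewrite (rootP rQ) mulr0 add0r.
(* The remainder has degree at most 1 and a nonreal root. *)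
suff -> : p %% Q = 0 by rewrite addr0.
have E : p %% Q = ((p %% Q)`_0)%:P + (p %% Q)`_1 *: 'X.
  apply/polyP => i; rewrite coefD coefC coefZ coefX.
  case: i => [|[|i]] /=; rewrite ?mulr0 ?mulr1 ?addr0 ?add0r//.
  by rewrite nth_default// (leq_trans sr).
move: rr; rewrite E rmorphD /= map_polyC map_polyZ map_polyX /root !hornerE /=.
move: (_`_0) (_`_1) => r0 r1; simpc => /eqP[] rr0 /eqP.
rewrite mulf_eq0 (negbTE b0) orbF => /eqP r10.
by move: rr0; rewrite r10 mul0r addr0 => ->; rewrite scale0r addr0.
Qed.

Section KappaUnit.
Variables (R : realType) (L : falgType R).
Local Notation A := (fdnormed L).
Local Notation tau := (pi *+ 2 : R).

Lemma annihilating_poly (c : A) : exists2 p : {poly R}, p != 0 & horner_alg c p = 0.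
Proof.
pose n := \dim {:A}.
pose X := [tuple c ^+ i | i < n.+1].
have nf : ~~ free X.
  apply/negP; rewrite /free size_tuple => /eqP E.
  by have := dimvS (subvf <<X>>%VS); rewrite E ltnn.
have /existsNP[k /not_implyP[kX kn]] : ~ forall k : 'I_n.+1 -> R,
    \sum_(i < n.+1) k i *: X`_i = 0 -> forall i, k i = 0.
  by move/freeP; apply/negP.
exists (\poly_(i < n.+1) (if insub i is Some j then k j else 0)).
  apply/eqP => /polyP p0; apply: kn => i.
  by have := p0 i; rewrite coef_poly ltn_ord valK coef0.
rewrite -kX poly_def rmorph_sum; apply: eq_bigr => i _.
rewrite valK -mul_polyC rmorphM rmorphXn /= horner_algC horner_algX mulr_algl.
by congr (_ *: _); rewrite (nth_map i) ?size_enum_ord// nth_ord_enum.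
Qed.

Lemma quadratic_eigenvector (c x : A) : nonreal c -> x != 0 ->
  exists a b q, [/\ b != 0, horner_alg c q * x != 0 &
    (c - a%:A) ^+ 2 * (horner_alg c q * x) = - (b ^+ 2) *: (horner_alg c q * x)].
Proof.
move=> gc x0.
have [p p0 pcx] : exists2 p : {poly R}, p != 0 & horner_alg c p * x = 0.
  by have [p p0 pc] := annihilating_poly c; exists p => //; rewrite pc mul0r.
have [m] := ubnP (size p); elim: m p p0 pcx => // m IH p p0 pcx pm.
have p1 : (1 < size p)%N.
  rewrite ltn_neqAle eq_sym size_poly_gt0 p0 andbT; apply/negP => /size_poly1P[k k0 pk].
  move: pcx; rewrite pk /= horner_algC mulr_algl => /eqP.
  by rewrite scaler_eq0 (negbTE k0) (negbTE x0).
have [a [q []]] := real_poly_factor p1 => [pE|[b b0 pE]].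
  have q0 : q != 0 by apply: contraNneq p0 => q0; rewrite pE q0 mul0r.
  apply: (IH q q0); last first.
    by move: pm; rewrite pE size_Mmonic ?monicXsubC// size_XsubC addn2.
  have Uc : (c - a%:A : A) \is a GRing.unit.
    have := gc (- a) 1; rewrite oner_eq0 orbT scale1r => /(_ isT).
    by rewrite scaleNr addrC.
  apply: (mulrI Uc); rewrite mulr0 mulrA -[RHS]pcx pE; congr (_ * x).
  have -> : c - a%:A = horner_alg c ('X - a%:P) by rewrite rmorphB /= horner_algX horner_algC.
  by rewrite -rmorphM mulrC.
have q0 : q != 0 by apply: contraNneq p0 => q0; rewrite pE q0 mul0r.
have [qx|qx] := eqVneq (horner_alg c q * x) 0.
  apply: (IH q q0 qx); move: pm; rewrite pE size_mul//.
    have -> : size (('X - a%:P) ^+ 2 + (b ^+ 2)%:P) = 3%N.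
      by rewrite size_polyDl size_exp_XsubC// size_polyC; case: (_ != 0).
    by rewrite !addnS addn0 /= ltnS => /ltnW.
  rewrite -size_poly_eq0 size_polyDl size_exp_XsubC// size_polyC.
  by case: (_ != 0).
exists a, b, q; split => //.
apply/eqP; rewrite scaleNr -addr_eq0; apply/eqP.
have -> : b ^+ 2 *: (horner_alg c q * x) = horner_alg c (b ^+ 2)%:P * (horner_alg c q * x).
  by rewrite horner_algC mulr_algl.
have -> : (c - a%:A) ^+ 2 = horner_alg c (('X - a%:P) ^+ 2).
  by rewrite rmorphXn rmorphB /= horner_algX horner_algC.
by rewrite -mulrDl -rmorphD mulrA -rmorphM mulrC -pE.
Qed.

Lemma int_kappa_mul (c y : A) : nonreal c ->
  int 0 tau (fun t => ker1 c t * y) = kappa c * y.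
Proof.
by move=> gc; exact: (int_mulr y (tau_ge0 R) (fun t _ => ker1_continuous gc (x:=t))).
Qed.

(** If [kappa c] kills x, it kills the vector y = q(c) x of [quadratic_eigenvector]. With j = c - a,
    the coefficient of j y in [ker1 c t * y] is 1 / N t > 0, so its integral over a period cannot
    vanish. *)
Lemma kappa_unit (c : A) : nonreal c -> kappa c \is a GRing.unit.
Proof.
move=> gc; apply: unit_of_mul_injective => x kx; apply/eqP; apply: contrapT => /negP x0.
have [a [b [q [b0]]]] := quadratic_eigenvector gc x0.
have kq : kappa c * horner_alg c q = horner_alg c q * kappa c.
  rewrite -int_kappa_mul// -(int_mull _ (tau_ge0 R) (fun t _ => ker1_continuous gc (x:=t))).
  apply: eq_int => [|t _]; first exact: tau_ge0.
  have cq : horner_alg c q * c = c * horner_alg c q.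
    by rewrite -{2 3}(horner_algX c) -!rmorphM mulrC.
  by rewrite /ker1 mulrA (comm_pwV t cq) -!mulrA (comm_dpw t cq).
have : kappa c * (horner_alg c q * x) = 0 by rewrite mulrA kq -mulrA kx mulr0.
move: (horner_alg c q * x) => y ky y0 jy {q kq x x0 kx}.
set j : A := c - a%:A in jy; have cE : c = a%:A + j by rewrite /j addrC subrK.
have b2 : 0 < b ^+ 2 by rewrite exprn_even_gt0.
have fr : free [tuple j * y; y].
  rewrite /= free_cons; apply/andP; split; last first.
    by rewrite free_cons nil_free andbT span_nil memv0.
  rewrite span_seq1; apply/negP => /vlineP[k jk].
  have := jy; rewrite expr2 -mulrA jk -scalerAr jk scalerA => /eqP.
  rewrite -subr_eq0 -scalerBl scaler_eq0 (negbTE y0) orbF subr_eq0 => /eqP kk.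
  by have := sqr_ge0 k; rewrite expr2 kk oppr_ge0 leNgt b2.
pose X : 2.-tuple A := [tuple j * y; y].
have lin : linear (coord X ord0 : A -> R) by move=> k u v; exact: linearP.
pose l := HB.pack_for {linear A -> R} (coord X ord0 : A -> R)
  (GRing.isLinear.Build _ _ _ _ _ lin).
have lj : l (j * y) = 1.
  by rewrite -[LHS]/(coord X ord0 X`_(ord0 : 'I_2)) coord_free.
have ly : l y = 0.
  by rewrite -[LHS]/(coord X ord0 X`_(lift ord0 ord0 : 'I_2)) coord_free.
(* The squared modulus of cos t + (a + bi) sin t, that is, of the action of [pw c t] on y. *)
pose N t : R := (cos t + a * sin t) ^+ 2 + b ^+ 2 * sin t ^+ 2.
have N0 t : 0 < N t.
  have q1 := sqr_ge0 (cos t + a * sin t).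
  have q2 : 0 <= b ^+ 2 * sin t ^+ 2 by exact: mulr_ge0 (ltW b2) (sqr_ge0 _).
  rewrite lt_neqAle eq_sym (paddr_eq0 q1 q2) (addr_ge0 q1 q2) andbT.
  apply/negP => /andP[]; rewrite !expf_eq0 /= mulf_eq0 (gt_eqF b2) /= !expf_eq0 /=.
  move=> /eqP cs /eqP s0; have := cos2Dsin2 t; move: cs; rewrite s0 mulr0 addr0 => ->.
  by rewrite expr0n /= addr0 => /esym/eqP; rewrite oner_eq0.
have pwE t v : pw c t * v = (cos t + a * sin t) *: v + sin t *: (j * v).
  rewrite /pw cE mulrDl -!scalerAl mulrDl mul1r mulr_algl scalerDr scalerA.
  by rewrite scalerDl mulrC addrA.
have dpwE t v : dpw c t * v = (- sin t + a * cos t) *: v + cos t *: (j * v).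
  rewrite /dpw cE mulrDl -!scalerAl mulrDl mul1r mulr_algl scalerDr scalerA.
  by rewrite scalerDl mulrC addrA.
have jjy : j * (j * y) = - b ^+ 2 *: y by rewrite mulrA -expr2.
have kE t : exists m : R, ker1 c t * y = m *: y + (N t)^-1 *: (j * y).
  exists ((N t)^-1 * ((cos t + a * sin t) * (- sin t + a * cos t) + b ^+ 2 * sin t * cos t)).
  have Up := pw_unit t gc.
  apply: (mulrI Up); rewrite /ker1 mulrA mulrA mulrV// mul1r.
  rewrite dpwE pwE [j * (_ + _)]mulrDr -!scalerAr jjy.
  have Nn : N t != 0 by rewrite gt_eqF.
  have cs : cos t ^+ 2 = 1 - sin t ^+ 2 by rewrite -(cos2Dsin2 t) addrK.
  have : (cos t + a * sin t) * cos t = 1 + sin t * (- sin t + a * cos t) by ring: cs.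
  have NE : N t = (cos t + a * sin t) ^+ 2 + b ^+ 2 * sin t ^+ 2 by [].
  move: NE Nn; move: (N t) => n; move: (cos t + a * sin t) => C.
  move: (- sin t + a * cos t) => D; move: (sin t) (cos t) => S E NE Nn CE.
  have e1 : D = n^-1 * (C * (C * D + b ^+ 2 * S * E) - S * b ^+ 2).
    rewrite (_ : C * (C * D + b ^+ 2 * S * E) - S * b ^+ 2 = n * D) ?mulKf//.
    have -> : C * (C * D + b ^+ 2 * S * E) = C ^+ 2 * D + b ^+ 2 * S * (C * E) by ring.
    by rewrite CE NE; ring.
  have e2 : E = n^-1 * (C + S * (C * D + b ^+ 2 * S * E)).
    rewrite (_ : C + S * (C * D + b ^+ 2 * S * E) = n * E) ?mulKf//.
    have -> : S * (C * D + b ^+ 2 * S * E) = C * (S * D) + b ^+ 2 * S ^+ 2 * E by ring.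
    have -> : S * D = C * E - 1 by rewrite CE addrC addKr.
    by rewrite NE; ring.
  transitivity ((n^-1 * (C * (C * D + b ^+ 2 * S * E) - S * b ^+ 2)) *: y +
    (n^-1 * (C + S * (C * D + b ^+ 2 * S * E))) *: (j * y)); first by rewrite -e1 -e2.
  by fd_ring.
have ck t : 0 <= t <= tau -> {for t, continuous (fun t => ker1 c t * y)}.
  by move=> _; apply: contMA; [exact: ker1_continuous | exact: cont_cst].
have [G pG] : exists G, primitive_on 0 tau (fun t => ker1 c t * y) G.
  by apply: primitive_exists => t; rewrite (min_idPl (tau_ge0 R)) (max_idPr (tau_ge0 R)); exact: ck.
have GE : G tau - G 0 = 0 by rewrite -(intE pG) int_kappa_mul.
have tau0 : 0 < tau by rewrite mulrn_wgt0// pi_gt0.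
have dG t : 0 <= t <= tau -> is_derive t 1 (l \o G) (l (ker1 c t * y)).
  move=> ht; apply: is_derive_lin; first exact: fd_linear_continuous.
  by apply: pG; rewrite (min_idPl (tau_ge0 R)) (max_idPr (tau_ge0 R)).
(* As the integral of [ker1 c t * y] is 0, the mean value theorem gives a point where the coordinate
   1 / N s would be 0. *)
have [||s _] := @MVT_segment R (l \o G) (fun t => l (ker1 c t * y)) 0 tau (tau_ge0 R).
- by move=> t; rewrite in_itv /= => /andP[/ltW t1 /ltW t2]; apply: dG; rewrite t1.
- apply: derivable_within_continuous => t; rewrite in_itv /= => ht.
  by have [] := dG t ht.
rewrite -[LHS]/(l (G tau) - l (G 0)) -linearB GE linear0 subr0 => /esym/eqP.
rewrite mulf_eq0 (gt_eqF tau0) orbF => /eqP.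
have [m ->] := kE s; rewrite linearD !linearZ_LR lj ly scaler0 add0r [_ *: 1]mulr1.
by move/eqP; rewrite invr_eq0 gt_eqF.
Qed.

End KappaUnit.

(** * The Cauchy transform *)

Section CauchyTransform.
Variables (R : realType) (L : falgType R).
Local Notation A := (fdnormed L).
Local Notation tau := (pi *+ 2 : R).
Variables (c : A) (gc : nonreal c).
Variables (X : normedModType R) (u h : X) (r0 : R) (r00 : 0 <= r0).
Implicit Types (al be : X -> A).

Definition circle_average al (x : X) (s : R) : A :=
  int 0 tau (fun t => (pw c t)^-1 * al (pol u h x (s, t))).

(* A right inverse of [D_h - c D_u], in polar coordinates so that the kernel
   [1 / z] of the Cauchy transform is absorbed by the Jacobian. *)
Definition cauchy_transform al (x : X) : A :=
  (kappa c)^-1 * int 0 r0 (circle_average al x).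

Lemma cont_pol (T : topologicalType) (X0 : T -> X) (S T0 : T -> R) (z : T) :
  {for z, continuous X0} -> {for z, continuous S} -> {for z, continuous T0} ->
  {for z, continuous (fun w => pol u h (X0 w) (S w, T0 w))}.
Proof.
move=> cX cS cT; apply: contD => //; apply: contZ => //.
apply: contD; apply: contZ; try exact: cont_cst.
  by apply: (@cont_comp _ _ _ _ T0 cos) => //; exact: continuous_cos.
by apply: (@cont_comp _ _ _ _ T0 sin) => //; exact: continuous_sin.
Qed.

Lemma circle_integrand_continuous al (T : topologicalType) (X0 : T -> X) (S T0 : T -> R) (z : T) :
  continuous al ->
  {for z, continuous X0} -> {for z, continuous S} -> {for z, continuous T0} ->
  {for z, continuous (fun w => (pw c (T0 w))^-1 * al (pol u h (X0 w) (S w, T0 w)))}.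
Proof.
move=> cal cX cS cT; apply: contMA.
  by apply: (@cont_comp _ _ _ _ T0 (fun t => (pw c t)^-1 : A)) => //; exact: pwV_continuous.
apply: (@cont_comp _ _ _ _ (fun w => pol u h (X0 w) (S w, T0 w)) al); last exact: cal.
exact: cont_pol.
Qed.

Lemma circle_average_continuous al (T : topologicalType) (X0 : T -> X) (S : T -> R) (z : T) :
  continuous al -> continuous X0 -> continuous S ->
  {for z, continuous (fun w => circle_average al (X0 w) (S w))}.
Proof.
move=> cal cX cS.
apply: (@int_continuous_all R T A (fun w t => (pw c t)^-1 * al (pol u h (X0 w) (S w, t))) z 0 tau (tau_ge0 R)).
  move=> t; apply: (@circle_integrand_continuous al _ (fun z => X0 z.1) (fun z => S z.1) (fun z => z.2)); first exact: cal.
  - by apply: (@cont_comp _ _ _ _ fst X0); [exact: cvg_fst | exact: cX].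
  - by apply: (@cont_comp _ _ _ _ fst S); [exact: cvg_fst | exact: cS].
  - exact: cvg_snd.
move=> w t.
apply: (@circle_integrand_continuous al _ (fun=> X0 w) (fun=> S w) id); first exact: cal.
- exact: cont_cst.
- exact: cont_cst.
- exact: cvg_id.
Qed.

Lemma circle_average_radial_continuous al x : continuous al ->
  forall s, {for s, continuous (circle_average al x)}.
Proof.
move=> cal s; apply: (@circle_average_continuous al R (fun=> x) id); first exact: cal.
- by move=> y; exact: cont_cst.
- by move=> y; exact: cvg_id.
Qed.

Lemma cauchy_transform_continuous al : continuous al -> continuous (cauchy_transform al).
Proof.
move=> cal x; apply: contMAr.
apply: (@int_continuous_all R X A (circle_average al) x 0 r0 r00).
  move=> s; apply: (@circle_average_continuous al _ fst snd); first exact: cal.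
  - by move=> y; exact: cvg_fst.
  - by move=> y; exact: cvg_snd.
by move=> y s; exact: circle_average_radial_continuous.
Qed.

Lemma pol_shift x y z : pol u h (y + x) z = y + pol u h x z.
Proof. by rewrite /pol addrCA. Qed.

(** In polar form the transform averages translates of its argument, so it commutes with derivatives
    in every direction, including those outside the plane of u and h. *)
Lemma cauchy_transform_derive al be x k : continuous al -> continuous be ->
  (forall y, is_derive y k al (be y)) ->
  is_derive x k (cauchy_transform al) (cauchy_transform be x).
Proof.
move=> cal cbe dal; apply: is_derive_at_line; apply: is_deriveMAr.
have ck (e : R) : {for e, continuous (fun e : R => e *: k + x)}.
  apply: contD; last exact: cont_cst.
  by apply: contZ; [exact: cvg_id | exact: cont_cst].
have E0 : x = 0 *: k + x by rewrite scale0r add0r.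
rewrite {2}E0.
apply: (@int_parameter_derive_all R A (fun e s => circle_average al (e *: k + x) s)
   (fun e s => circle_average be (e *: k + x) s) 0 0 r0 r00).
- move=> e s.
  apply: (@int_parameter_derive_all R A
    (fun e t => (pw c t)^-1 * al (pol u h (e *: k + x) (s, t)))
    (fun e t => (pw c t)^-1 * be (pol u h (e *: k + x) (s, t))) e 0 tau (tau_ge0 R)).
  + move=> e' t; apply: is_deriveMAr.
    have := is_derive_line (x := pol u h x (s, t)) (dal (e' *: k + pol u h x (s, t))).
    rewrite -pol_shift; apply: is_derive_ext => e''.
    by rewrite -pol_shift.
  + move=> e' t.
    apply: (@circle_integrand_continuous al _ (fun=> e' *: k + x) (fun=> s) id); first exact: cal.
    * exact: cont_cst.
    * exact: cont_cst.
    * exact: cvg_id.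
  + move=> t.
    apply: (@circle_integrand_continuous be _ (fun z : R * R => z.1 *: k + x) (fun=> s) (fun z : R * R => z.2)); first exact: cbe.
    * by apply: (@cont_comp _ _ _ _ fst (fun e : R => e *: k + x)); [exact: cvg_fst | exact: ck].
    * exact: cont_cst.
    * exact: cvg_snd.
- by move=> e s; exact: circle_average_radial_continuous.
move=> s.
apply: (@circle_average_continuous be _ (fun z : R * R => z.1 *: k + x) (fun z : R * R => z.2)); first exact: cbe.
- by move=> z; apply: (@cont_comp _ _ _ _ fst (fun e : R => e *: k + x)); [exact: cvg_fst | exact: ck].
- by move=> z; exact: cvg_snd.
Qed.

Lemma cauchy_transform_eq0 al x :
  (forall s t, 0 <= s <= r0 -> al (pol u h x (s, t)) = 0) -> cauchy_transform al x = 0.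
Proof.
move=> al0; rewrite /cauchy_transform (@eq_int R A 0 r0 _ (fun=> 0) r00).
  by rewrite int_cst// scaler0 mulr0.
move=> s hs; rewrite /circle_average (@eq_int R A 0 tau _ (fun=> 0) (tau_ge0 R)).
  by rewrite int_cst ?tau_ge0// scaler0.
by move=> t _; rewrite al0// mulr0.
Qed.

Lemma kappa_comm (a : A) : a * c = c * a -> a * kappa c = kappa c * a.
Proof.
move=> ac; rewrite -int_kappa_mul// -(int_mull _ (tau_ge0 R) (fun t _ => ker1_continuous gc (x:=t))).
apply: eq_int => [|t _]; first exact: tau_ge0.
by rewrite /ker1 mulrA (comm_pwV t ac) -!mulrA (comm_dpw t ac).
Qed.

Lemma circle_integrand_radial_continuous al x s t : continuous al ->
  {for t, continuous (fun t => (pw c t)^-1 * al (pol u h x (s, t)))}.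
Proof.
move=> cal; apply: (@circle_integrand_continuous al _ (fun=> x) (fun=> s) id); first exact: cal.
- exact: cont_cst.
- exact: cont_cst.
- exact: cvg_id.
Qed.

(** An element commuting with c passes through both the kernel and the inverse of [kappa c]. This
    lets operators with other coefficients act under the transform. *)
Lemma cauchy_transformBM (a : A) al be x : a * c = c * a ->
  continuous al -> continuous be ->
  cauchy_transform (fun y => al y - a * be y) x =
  cauchy_transform al x - a * cauchy_transform be x.
Proof.
move=> ac cal cbe; rewrite /cauchy_transform.
have -> : a * ((kappa c)^-1 * int 0 r0 (circle_average be x)) =
    (kappa c)^-1 * int 0 r0 (fun s => a * circle_average be x s).
  rewrite mulrA (commrV (kappa_comm ac)) -mulrA; congr (_ * _).
  by rewrite (int_mull _ r00)// => s _; exact: circle_average_radial_continuous.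
rewrite -mulrBr; congr (_ * _).
rewrite -(@intB R A _ _ _ _ r00); last 2 first.
- by move=> s _; exact: circle_average_radial_continuous.
- by move=> s _; apply: contMAr; exact: circle_average_radial_continuous.
apply: eq_int => // s _; rewrite /circle_average.
rewrite -(int_mull _ (tau_ge0 R)); last first.
  by move=> t _; exact: circle_integrand_radial_continuous.
rewrite -(@intB R A _ _ _ _ (tau_ge0 R)); last 2 first.
- by move=> t _; exact: circle_integrand_radial_continuous.
- by move=> t _; apply: contMAr; exact: circle_integrand_radial_continuous.
apply: eq_int => [|t _]; first exact: tau_ge0.
by rewrite mulrBr [a * (_^-1 * _)]mulrA (comm_pwV t ac) -[_ * a * _]mulrA.
Qed.

Lemma cauchy_transform_dbar (Phi : X -> A) x : C1_on setT Phi ->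
  (forall t, Phi (pol u h x (r0, t)) = 0) ->
  cauchy_transform (fun y => 'd Phi y h - c * 'd Phi y u) x = Phi x.
Proof.
move=> C1 P0; rewrite /cauchy_transform /circle_average.
rewrite (@cauchy_pompeiu R L c gc X u h x Phi setT openT C1 r0 r00)//.
rewrite (@eq_int R A 0 tau _ (fun=> 0) (tau_ge0 R)); last by move=> t _; rewrite P0 mulr0.
by rewrite int_cst ?tau_ge0// scaler0 subr0 mulrA mulVr ?mul1r// kappa_unit.
Qed.

End CauchyTransform.

(** * Unique continuation *)

Section Regularity.
Variables (R : realType) (L : falgType R).
Local Notation A := (fdnormed L).
Local Notation tau := (pi *+ 2 : R).

Lemma cont_near_eq (T U : topologicalType) (F G : T -> U) (x : T) :
  (\forall y \near x, F y = G y) -> {for x, continuous F} -> {for x, continuous G}.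
Proof.
move=> FG cF; rewrite /prop_for /continuous_at -(nbhs_singleton FG).
exact: cvg_trans (near_eq_cvg FG) cF.
Qed.

Lemma pol_dist (X : normedModType R) (u h x : X) (s t : R) : 0 <= s ->
  `|pol u h x (s, t) - x| <= s * (`|u| + `|h|).
Proof.
move=> s0; rewrite polB normrZ ger0_norm// ler_wpM2l// (le_trans (ler_normD _ _))//.
rewrite lerD// normrZ ler_piMl//.
  by rewrite ler_norml cos_geN1 cos_le1.
by rewrite ler_norml sin_geN1 sin_le1.
Qed.

Lemma polar_disc (X : normedModType R) (u h x0 : X) (U : set X) : open U -> U x0 ->
  exists2 r : R, 0 < r & \forall x \near x0, forall s t, 0 <= s <= r -> U (pol u h x (s, t)).
Proof.
move=> oU Ux0; have /nbhs_ballP[d /= d0 dU] := open_nbhs_nbhs (conj oU Ux0).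
have n0 : 0 < `|u| + `|h| + 1 by rewrite ltr_wpDl// addr_ge0.
have d2 : 0 < d / 2 by rewrite divr_gt0.
exists (d / 2 / (`|u| + `|h| + 1)); first by rewrite !divr_gt0.
near=> x => s t /andP[s0 sr]; apply: dU; rewrite -ball_normE /=.
have xx0 : `|x0 - x| < d / 2.
  by near: x; exact: near_dist_lt.
rewrite -(subrKA x) (splitr d) (le_lt_trans (ler_normD _ _))// ltr_leD//.
rewrite distrC (le_trans (pol_dist _ _ _ _ s0))//.
rewrite (@le_trans _ _ (s * (`|u| + `|h| + 1)))//; first by rewrite ler_wpM2l// lerDl.
by rewrite -ler_pdivlMr.
Unshelve. all: by end_near. Qed.

(** [cauchy_derivative] with a fixed radius writes the derivative near x0 as an integral of f
    itself, which is continuous. *)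
Lemma cauchy_riemann_derive_continuous (X : normedModType R) (u h : X) (c : A)
    (f : X -> A) (U : set X) x0 : nonreal c -> open U ->
  (forall y, U y -> cauchy_riemann u h c f y) -> U x0 ->
  {for x0, continuous (fun y => 'd f y u)}.
Proof.
move=> gc oU CR Ux0; have [r r0 HU] := polar_disc u h oU Ux0.
have rr : 0 <= r <= r by rewrite ltW// lexx.
apply: (@cont_near_eq _ _ (fun y => (kappa c)^-1 *
    (r^-1 *: int 0 tau (fun t => ker2 c t * f (pol u h y (r, t)))))).
  near=> y.
  have Uy : forall s t, 0 <= s <= r -> U (pol u h y (s, t)) by near: y.
  rewrite -(@cauchy_derivative R L c gc X u h y f r r0); last first.
    by move=> s t hs; exact/CR/Uy.
  by rewrite mulrA mulVr ?mul1r// kappa_unit.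
have cf y : U y -> {for y, continuous f}.
  by move=> /CR[df _]; exact: differentiable_continuous.
apply: contMAr; apply: contZr; apply: int_continuous; first exact: tau_ge0.
  move=> t _; apply: contMA.
    apply: (@cont_comp _ _ _ _ (fun z : X * R => z.2) (ker2 c)); first exact: cvg_snd.
    exact: ker2_continuous.
  apply: (@cont_comp _ _ _ _ (fun z : X * R => pol u h z.1 (r, z.2)) f).
    apply: (@cont_pol R X u h _ (fun z : X * R => z.1) (fun=> r) (fun z => z.2)).
    - exact: cvg_fst.
    - exact: cont_cst.
    - exact: cvg_snd.
  by apply: cf; move: (nbhs_singleton HU); exact.
near=> y => t _.
have Uy : forall s t, 0 <= s <= r -> U (pol u h y (s, t)) by near: y.
apply: contMA; first exact: ker2_continuous.
by apply: circle_continuous => t'; have [] := CR _ (Uy r t' rr).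
Unshelve. all: by end_near. Qed.

End Regularity.

Section Division.
Variables (R : realType) (L : falgType R).
Local Notation A := (fdnormed L).
Local Notation tau := (pi *+ 2 : R).
Variables (c : A) (gc : nonreal c) (p : R * R).

(** The analogue of the complex number z - p. *)
Definition plane_dist (z : R * R) : A := (z.1 - p.1) *: 1 + (z.2 - p.2) *: c.
Local Notation q := plane_dist.

Lemma plane_dist_unit z : z != p -> q z \is a GRing.unit.
Proof.
move=> zp; apply: gc; rewrite !subr_eq0; apply: contraNT zp.
by rewrite negb_or !negbK => /andP[/eqP z1 /eqP z2]; apply/eqP; rewrite [z]surjective_pairing [p]surjective_pairing z1 z2.
Qed.

Lemma plane_distC z : q z * c = c * q z.
Proof. by rewrite (@comm_lin _ _ c _ _ c). Qed.

Lemma plane_dist_differentiable z : differentiable q z.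
Proof.
by apply: differentiableD; apply: differentiable_scale; try exact: differentiable_cst;
  apply: differentiableB; try exact: differentiable_cst;
  [exact: differentiable_fst | exact: differentiable_snd].
Qed.

Lemma diff_plane_dist z k : 'd q z k = k.1 *: 1 + k.2 *: c.
Proof.
have dq := differentiable_is_derive k (plane_dist_differentiable z).
apply: (is_derive_unique dq); apply/is_deriveP => e e0; near=> s.
rewrite (_ : _ - _ - _ = 0); first by rewrite normr0 mulr_ge0 ?(ltW e0).
have key (a b a' b' P Q : R) : (s * a + a' - P) *: (1 : A) + (s * b + b' - Q) *: c -
  ((a' - P) *: 1 + (b' - Q) *: c) - s *: (a *: 1 + b *: c) = 0 by fd_ring.
exact: key.
Unshelve. all: by end_near. Qed.

Variables (D : set (R * R)) (oD : open D) (G : R * R -> A).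
Hypotheses (C1G : C1_on D G) (CRG : forall z, D z -> 'd G z (0, 1) = c * 'd G z (1, 0))
  (G0 : \forall z \near p, G z = 0).

(** The analogue of G(z) / (z - p). The inverse is meaningless at p, but G vanishes near p, so H
    does too. *)
Let H (z : R * R) : A := (q z)^-1 * G z.

Lemma division_near0 : \forall z \near p, H z = 0.
Proof. by near=> z; rewrite /H (_ : G z = 0) ?mulr0//; near: z. Unshelve. all: by end_near. Qed.

Lemma near_zero_diff (V : normedModType R) (F : R * R -> V) (z : R * R) :
  (\forall y \near z, F y = 0) -> differentiable F z /\ forall k, 'd F z k = 0.
Proof.
move=> F0; have [||dF dE] := @near_eq_differentiable R _ V (fun=> 0) F z.
- by near=> y; apply/esym; near: y.
- exact: differentiable_cst.
by split=> // k; rewrite dE (diff_cst 0 z).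
Unshelve. all: by end_near. Qed.

Lemma division_diff z : D z -> z != p -> differentiable H z /\
  forall k, 'd H z k = - ((q z)^-1 * (k.1 *: 1 + k.2 *: c) * (q z)^-1) * G z + (q z)^-1 * 'd G z k.
Proof.
move=> Dz zp; have Uq := plane_dist_unit zp; have dq := plane_dist_differentiable z.
have [dG _] := C1G Dz.
have dV : differentiable (fun y => (q y)^-1 : A) z by exact: differentiableVA.
have dH : differentiable H z by exact: differentiableMA.
split=> // k.
have dVk : is_derive z k (fun y => (q y)^-1 : A) (- ((q z)^-1 * (k.1 *: 1 + k.2 *: c) * (q z)^-1)).
  apply: is_derive_at_line; have [_ E] := differentiable_inv Uq.
  have q0 : q z = q (0 *: k + z) by rewrite scale0r add0r.
  rewrite q0; apply: (@is_derive_inv R L (fun s : R => q (s *: k + z))); first by rewrite -q0.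
  apply: is_derive_line; rewrite scale0r add0r -(diff_plane_dist z).
  exact: differentiable_is_derive.
apply: (is_derive_unique (differentiable_is_derive k dH)).
exact: is_deriveMA dVk (differentiable_is_derive k dG).
Qed.

Lemma near_neq (z : R * R) : z != p -> \forall y \near z, y != p.
Proof.
move=> zp; have zp0 : 0 < `|z - p| by rewrite normr_gt0 subr_eq0.
have := near_dist_lt z zp0; apply: filterS => y.
by apply: contraTneq => ->; rewrite ltxx.
Qed.

Lemma division_C1 : C1_on D H.
Proof.
move=> z Dz; have [->|zp] := eqVneq z p.
  have nn := division_near0.
  split=> [|k]; first by have [] := near_zero_diff nn.
  have cc : {for p, continuous (fun _ : R * R => 0 : A)} by exact: cont_cst.
  apply: cont_near_eq cc.
  have := nbhs_interior nn; apply: filterS => y /near_zero_diff[_ ->//].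
have [dH dE] := division_diff Dz zp; split=> // k.
have nD : \forall y \near z, D y by exact: open_nbhs_nbhs.
apply: (@cont_near_eq _ _ (fun z => - ((q z)^-1 * (k.1 *: 1 + k.2 *: c) * (q z)^-1) * G z + (q z)^-1 * 'd G z k)).
  near=> y; have yp : y != p by near: y; exact: near_neq.
  have Dy : D y by near: y.
  exact: esym ((division_diff Dy yp).2 k).
have cV : {for z, continuous (fun y => (q y)^-1 : A)}.
  by apply: differentiable_continuous; apply: differentiableVA;
    [exact: plane_dist_unit | exact: plane_dist_differentiable].
have [dG cG] := C1G Dz.
apply: contD; apply: contMA => //; last exact: differentiable_continuous.
apply: (@cont_comp _ _ _ _ _ (fun y : A => - y)); last exact: opp_continuous.
by apply: contMA => //; apply: contMA => //; exact: cont_cst.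
Unshelve. all: by end_near. Qed.

(** Away from p the inverse of q satisfies the same equation as G: the derivatives of q along the
    axes are 1 and c, and q commutes with c. *)
Lemma division_CR z : D z -> 'd H z (0, 1) = c * 'd H z (1, 0).
Proof.
move=> Dz; have [->|zp] := eqVneq z p.
  by have [_ E] := near_zero_diff division_near0; rewrite !E mulr0.
have [_ E] := division_diff Dz zp.
refine (etrans (E (0, 1)) (etrans _ (congr1 (fun y => c * y) (esym (E (1, 0)))))).
have cq : c * (q z)^-1 = (q z)^-1 * c by apply: commrV; rewrite /GRing.comm plane_distC.
rewrite CRG//= !scale0r add0r addr0 !scale1r mulr1 mulrDr !mulNr mulrN.
by rewrite !mulrA cq -(mulrA _ c) cq !mulrA.
Qed.

End Division.

Section VanishingStep.
Variables (R : realType) (L : falgType R).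
Local Notation A := (fdnormed L).
Local Notation tau := (pi *+ 2 : R).
Variables (c : A) (gc : nonreal c).

Lemma plane_dist_circle (p : R * R) (r t : R) :
  plane_dist c p (r * cos t, r * sin t) = r *: pw c t + plane_dist c p (0, 0).
Proof.
have key (P Q x y : R) : (r * x - P) *: (1 : A) + (r * y - Q) *: c =
  r *: (x *: 1 + y *: c) + ((0 - P) *: 1 + (0 - Q) *: c) by fd_ring.
exact: key.
Qed.

(** On the circle, z - p is r [pw c t] times 1 + v, where v = (r [pw c t])^-1 (0 - p) is small as
    soon as p is small compared with r. The quotient to bound is then (1 + v)^-1 v. *)
Lemma plane_dist_ratio (K : R) : 0 < K -> exists2 d : R, 0 < d &
  forall (p : R * R) r t, 0 < r -> `|p.1| <= d * r -> `|p.2| <= d * r -> 0 <= t <= tau ->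
  plane_dist c p (r * cos t, r * sin t) \is a GRing.unit /\
  K * `|(plane_dist c p (r * cos t, r * sin t))^-1 * plane_dist c p (0, 0) : A| <= 2^-1.
Proof.
move=> K0; have [K1 K10 mK] := @mulA_bounded R L; have [b b0 Hb] := @unit_near1 R L.
have [M HM] : exists M : R, forall t, 0 <= t <= tau -> `|(pw c t)^-1 : A| <= M.
  by apply: bounded_on_segment => [|t _]; [exact: tau_ge0 | exact: pwV_continuous].
have n1 : 0 < `|1 : A| by rewrite normr_gt0 oner_neq0.
have M0 : 0 <= M by apply: le_trans (HM 0 _); rewrite ?normr_ge0// lexx tau_ge0.
(* The bound e on v has two tasks: e <= b makes 1 + v invertible, and the other term of the minimum
   gives the final 1/2. *)
pose B := `|1 : A| + `|c| + 1; pose e := Num.min b (2^-1 / (K * (K1 * (2 * `|1 : A|)))).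
have B0 : 0 < B by rewrite ltr_wpDl// addr_ge0.
have e0 : 0 < e by rewrite lt_min b0 /= divr_gt0// ?invr_gt0// !mulr_gt0.
(* Forces [|v|] <= e, since the image of p has norm at most d r B and the inverse of [pw] is bounded
   by M. *)
pose d := e / (K1 * (M + 1) * B).
have KM0 : 0 < K1 * (M + 1) * B by rewrite !mulr_gt0// ltr_wpDl.
exists d; first exact: divr_gt0.
move=> p r t r0 p1 p2 ht.
set q0 := plane_dist c p (0, 0).
have Upw : pw c t \is a GRing.unit by exact: pw_unit.
pose v : A := r^-1 *: ((pw c t)^-1 * q0).
have nq0 : `|q0| <= d * r * B.
  rewrite /q0 /plane_dist /= !sub0r (le_trans (ler_normD _ _))// !normrZ !normrN.
  have n1' := normr_ge0 (1 : A); have nc := normr_ge0 c.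
  have dr : 0 <= d * r by exact: le_trans p1.
  have h1 := ler_wpM2r n1' p1; have h2 := ler_wpM2r nc p2.
  by rewrite /B !mulrDr mulr1; move: (`|p.1| * _) (`|p.2| * _) h1 h2 dr => ? ?; lra.
have nv : `|v| <= e.
  rewrite /v normrZ normfV gtr0_norm// ler_pdivrMl//.
  rewrite (le_trans (mK _ _))//.
  have -> : r * e = K1 * (M + 1) * (d * r * B).
    have <- : d * (K1 * (M + 1) * B) = e by rewrite divfK// gt_eqF.
    have key (y1 y2 y3 y4 y5 : R) : y1 * (y2 * (y3 * y4 * y5)) = y3 * y4 * (y2 * y1 * y5) by ring.
    exact: key.
  rewrite ler_pM ?mulr_ge0 ?(ltW K10)// ler_wpM2l ?(ltW K10)//.
  by rewrite (le_trans (HM t ht))// lerDl.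
have [U1 n1v] : ((1 + v : A) \is a GRing.unit) /\ `|(1 + v : A)^-1| <= 2 * `|1 : A|.
  by apply: Hb; apply: le_trans nv _; rewrite ge_min lexx.
have Ur : (r *: pw c t : A) \is a GRing.unit by rewrite scaler_unit// unitfE gt_eqF.
have qE : plane_dist c p (r * cos t, r * sin t) = (r *: pw c t) * (1 + v).
  rewrite plane_dist_circle mulrDr mulr1 /v -scalerAl -scalerAr scalerA divff ?gt_eqF//.
  by rewrite scale1r mulrA mulrV// mul1r.
rewrite qE; split; first by rewrite unitrMl.
have -> : ((r *: pw c t) * (1 + v))^-1 * q0 = (1 + v)^-1 * v.
  by rewrite invrM// -mulrA invrZ ?unitfE ?gt_eqF// -scalerAl.
rewrite (le_trans (ler_wpM2l (ltW K0) (mK _ _)))//.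
have e2 : e <= 2^-1 / (K * (K1 * (2 * `|1 : A|))) by rewrite ge_min lexx orbT.
have := le_trans nv e2; rewrite ler_pdivlMr; last by rewrite !mulr_gt0.
move=> hv; apply: le_trans hv; rewrite (mulrC `|v|) -!mulrA.
by rewrite ler_wpM2l ?(ltW K0)// ler_wpM2l ?(ltW K10)// (mulrA 2) ler_wpM2r.
Qed.

Lemma power_bound (K : R) (y : A) : 0 < K -> (forall a b : A, `|a * b| <= K * `|a| * `|b|) ->
  K * `|y| <= 2^-1 -> forall k, `|y ^+ k.+1| <= K^-1 * 2^-1 ^+ k.+1.
Proof.
move=> K0 mK yK; elim=> [|k IH].
  by rewrite !expr1 -ler_pdivrMl ?invr_gt0// invrK.
rewrite [y ^+ k.+2]exprS [2^-1 ^+ k.+2]exprS; apply: le_trans (mK _ _) _.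
by rewrite mulrCA; apply: ler_pM => //; rewrite mulr_ge0// ltW.
Qed.

Fixpoint iter_division (p : R * R) (G : R * R -> A) k : R * R -> A :=
  if k is k'.+1 then fun z => (plane_dist c p z)^-1 * iter_division p G k' z else G.

Lemma iter_divisionE p G k z : iter_division p G k z = (plane_dist c p z)^-1 ^+ k * G z.
Proof. by elim: k => [|k IH] /=; rewrite ?mul1r// IH exprS mulrA. Qed.

Lemma iter_division_CR p (D : set (R * R)) G k : open D -> C1_on D G ->
  (forall z, D z -> 'd G z (0, 1) = c * 'd G z (1, 0)) ->
  (\forall z \near p, G z = 0) ->
  [/\ C1_on D (iter_division p G k),
      forall z, D z -> 'd (iter_division p G k) z (0, 1) = c * 'd (iter_division p G k) z (1, 0)
    & \forall z \near p, iter_division p G k z = 0].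
Proof.
move=> oD C1 CR G0; elim: k => [|k [I1 I2 I3]]; first by split.
split.
- exact: (division_C1 gc oD I1 I3).
- exact: (division_CR gc I1 I2 I3).
- exact: (division_near0 c I3).
Qed.

(* Dividing by [plane_dist c p] keeps the Cauchy-Riemann equation since [G]
   vanishes near [p]. The mean value formula for the k-th quotient bounds [G (0, 0)]
   by the k-th power of [plane_dist_ratio], which is contracting. *)
Lemma plane_vanish : exists2 d : R, 0 < d &
  forall (D : set (R * R)) (G : R * R -> A) (p : R * R) r,
  open D -> 0 < r -> `|p.1| <= d * r -> `|p.2| <= d * r -> C1_on D G ->
  (forall z, D z -> 'd G z (0, 1) = c * 'd G z (1, 0)) ->
  (forall s t, 0 <= s <= r -> D (s * cos t, s * sin t)) ->
  (\forall z \near p, G z = 0) -> G (0, 0) = 0.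
Proof.
have [K K0 mK] := @mulA_bounded R L; have [d d0 Hd] := plane_dist_ratio K0.
exists d => // D G p r oD r0 p1 p2 C1 CR hD G0.
have rr : 0 <= r <= r by rewrite ltW// lexx.
have [p00|pn0] := eqVneq (0, 0) p; first by rewrite p00; exact: (nbhs_singleton G0).
have U0 : plane_dist c p (0, 0) \is a GRing.unit by exact: plane_dist_unit.
set q0 := plane_dist c p (0, 0) in U0 *; pose q t := plane_dist c p (r * cos t, r * sin t).
have q0c : q0 * c = c * q0 by exact: plane_distC.
have tau0 := tau_ge0 R.
have polE (s t : R) : pol ((1, 0) : R * R) (0, 1) (0, 0) (s, t) = (s * cos t, s * sin t).
  rewrite /pol /=; apply/pair_equal_spec; split=> /=.
    by rewrite /GRing.scale /=; ring.
  by rewrite /GRing.scale /=; ring.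
have cz t : {for t, continuous (fun t => (r * cos t, r * sin t) : R * R)}.
  have := is_derive_continuous (is_derive_pol2 ((1, 0) : R * R) (0, 1) (0, 0) r t).
  by rewrite (_ : (fun t => _) = (fun t => (r * cos t, r * sin t) : R * R))//; apply/funext => t'.
have cG t : {for t, continuous (fun t => G (r * cos t, r * sin t))}.
  apply: (@cont_comp _ _ _ _ (fun t => (r * cos t, r * sin t) : R * R) G); first exact: cz.
  by apply: differentiable_continuous; have [] := C1 _ (hD r t rr).
have [M1 HM1] : exists M : R, forall t, 0 <= t <= tau -> `|ker1 c t : A| <= M.
  by apply: bounded_on_segment => // t _; exact: ker1_continuous.
have [M2 HM2] : exists M : R, forall t, 0 <= t <= tau -> `|G (r * cos t, r * sin t)| <= M.
  by apply: bounded_on_segment => // t _; exact: cG.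
have t00 : 0 <= (0 : R) <= tau by rewrite lexx tau0.
have M10 : 0 <= M1 by apply: le_trans (HM1 0 t00).
have M20 : 0 <= M2 by apply: le_trans (HM2 0 t00).
have key k : `|kappa c * G (0, 0)| <= K * (K * M1) * M2 * K^-1 * tau * 2^-1 ^+ k.+1.
  have [I1 I2 _] := iter_division_CR k.+1 oD C1 CR G0.
  have hD' s t : 0 <= s <= r -> D (pol ((1, 0) : R * R) (0, 1) (0, 0) (s, t)).
    by move=> hs; rewrite polE; exact: hD.
  have E := @cauchy_mean_value R L c gc (R * R)%type (1, 0) (0, 1) (0, 0) _ D oD I1 r (ltW r0) hD' I2.
  have cI t : 0 <= t <= tau -> {for t, continuous (fun t => ker1 c t * iter_division p G k.+1 (r * cos t, r * sin t))}.
    move=> ht; apply: contMA; first exact: ker1_continuous.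
    apply: (@cont_comp _ _ _ _ (fun t => (r * cos t, r * sin t) : R * R)); first exact: cz.
    by apply: differentiable_continuous; have [] := I1 _ (hD r t rr).
  (* G (0, 0) is the value at the centre of the quotient of order k + 1, multiplied by [q0 ^+ k.+1];
     this power commutes with the kernel and enters the integral. *)
  have {}E : kappa c * G (0, 0) = int 0 tau
      (fun t => q0 ^+ k.+1 * (ker1 c t * iter_division p G k.+1 (r * cos t, r * sin t))).
    rewrite (@int_mull R L 0 tau _ _ tau0 cI) -(@eq_int R A 0 tau _ _ tau0 (fun t _ => congr1 (fun z => ker1 c t * iter_division p G k.+1 z) (polE r t))).
    rewrite -E iter_divisionE -/q0 !mulrA -(commrX k.+1 (esym (kappa_comm gc q0c) : GRing.comm _ _)).
    by rewrite -(mulrA (kappa c)) -exprMn_comm ?mulrV ?expr1n ?mulr1//; exact: commrV.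
  rewrite E; apply: le_trans (@int_le R A 0 tau (K * (K * M1) * M2 * (K^-1 * 2^-1 ^+ k.+1)) _ tau0 _ _) _.
  - by move=> t ht; apply: contMAr; exact: cI.
  - move=> t ht; have [Uq yK] := Hd p r t r0 p1 p2 ht; rewrite -/q0 -/(q t) in Uq yK.
    have qq : q0 * (q t)^-1 = (q t)^-1 * q0.
      by apply: commrV; exact: comm_lin q0c.
    rewrite iter_divisionE -/(q t).
    have -> : q0 ^+ k.+1 * (ker1 c t * ((q t)^-1 ^+ k.+1 * G (r * cos t, r * sin t))) =
       ker1 c t * ((q t)^-1 * q0) ^+ k.+1 * G (r * cos t, r * sin t).
      have kc : q0 * ker1 c t = ker1 c t * q0.
        by rewrite /ker1 mulrA (comm_pwV t q0c) -!mulrA (comm_dpw t q0c).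
      rewrite -qq exprMn_comm; last exact: qq.
      have e1 : ker1 c t * q0 ^+ k.+1 = q0 ^+ k.+1 * ker1 c t.
        by apply: commrX; exact: esym kc.
      have key (y1 y2 y3 y4 : A) : y1 * y2 = y2 * y1 -> y2 * (y1 * (y3 * y4)) = y1 * (y2 * y3) * y4.
        by move=> y12; rewrite !mulrA y12.
      exact: key e1.
    have h1 : `|ker1 c t * ((q t)^-1 * q0) ^+ k.+1| <= K * M1 * (K^-1 * 2^-1 ^+ k.+1).
      apply: le_trans (mK _ _) _; apply: ler_pM => //.
      + by rewrite mulr_ge0 ?(ltW K0).
      + by rewrite ler_wpM2l ?(ltW K0)// HM1.
      + exact: power_bound.
    apply: le_trans (mK _ _) _.
    apply: le_trans (ler_pM _ _ (ler_wpM2l (ltW K0) h1) (HM2 t ht)) _ => //.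
      by rewrite mulr_ge0 ?(ltW K0).
    by rewrite le_eqVlt; apply/orP; left; apply/eqP; move: K^-1 (2^-1 ^+ _) => ? ?; ring.
  by rewrite subr0 le_eqVlt; apply/orP; left; apply/eqP; move: K^-1 (2^-1 ^+ _) => ? ?; ring.
apply: (mulrI (kappa_unit gc)); rewrite mulr0; apply/eqP; rewrite -normr_le0.
apply/ler_addgt0Pl => e e0; rewrite addr0.
have [|k /(_ k.+1 (leqnSn k)) Hk] := half_powers_small e0 (_ : 0 <= K * (K * M1) * M2 * K^-1 * tau).
  by rewrite !mulr_ge0 ?invr_ge0 ?(ltW K0).
exact: le_trans (key k) (ltW Hk).
Qed.

(** [plane_vanish] in the plane through x directed by u and h. That d depends on c alone makes the
    steps of [vanish_walk] uniform. *)
Lemma vanish_step : exists2 d : R, 0 < d &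
  forall (X : normedModType R) (u h : X) (f : X -> A) (O : set X) x (p : R * R) r,
  open O -> 0 < r -> `|p.1| <= d * r -> `|p.2| <= d * r -> C1_on O f ->
  (forall y, O y -> 'd f y h = c * 'd f y u) ->
  (forall s t, 0 <= s <= r -> O (pol u h x (s, t))) ->
  (\forall y \near p.1 *: u + p.2 *: h + x, f y = 0) -> f x = 0.
Proof.
have [d d0 Hd] := plane_vanish; exists d => // X u h f O x p r oO r0 p1 p2 C1 CR hO f0.
pose a (z : R * R) := z.1 *: u + z.2 *: h + x.
have a_diff z : differentiable a z.
  apply: differentiableD; last exact: differentiable_cst.
  by apply: differentiableD; apply: differentiable_scale; try exact: differentiable_cst;
    [exact: differentiable_fst | exact: differentiable_snd].
have a_cont z : {for z, continuous a} by exact: differentiable_continuous.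
have dG z k : O (a z) -> differentiable (fun z => f (a z)) z /\
    'd (fun z => f (a z)) z k = 'd f (a z) (k.1 *: u + k.2 *: h).
  move=> Oz; have [df _] := C1 _ Oz.
  have dfa : differentiable (fun z => f (a z)) z by exact: (@differentiable_comp _ _ _ _ a f).
  split=> //; apply: (is_derive_unique (differentiable_is_derive k dfa)).
  have dc : is_derive (0 : R) 1 (fun s : R => a (s *: k + z)) (k.1 *: u + k.2 *: h).
    have := is_deriveD (is_derive_scalel 0 (k.1 *: u + k.2 *: h)) (is_derive_cst (a z) (0 : R) 1).
    rewrite addr0; apply: is_derive_ext => s.
    have key (k1 k2 z1 z2 : R) : s *: (k1 *: u + k2 *: h) + (z1 *: u + z2 *: h + x) =
        (s * k1 + z1) *: u + (s * k2 + z2) *: h + x.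
      by rewrite scalerDr !scalerDl !scalerA addrA; congr (_ + x); rewrite addrACA.
    exact: key.
  apply: is_derive_at_line; have z0 : 0 *: k + z = z by rewrite scale0r add0r.
  have df' : differentiable f (a (0 *: k + z)) by rewrite z0.
  by have := is_derive_curve dc df'; rewrite z0.
pose G z := f (a z); pose D := a @^-1` O.
have oD : open D by apply: open_comp => // z _; exact: a_cont.
have -> : f x = G (0, 0) by rewrite /G /a /= !scale0r !add0r.
apply: (Hd D G p r) => //.
- move=> z Dz; split=> [|k]; first by have [] := dG z 0 Dz.
  apply: (@cont_near_eq _ _ (fun z => 'd f (a z) (k.1 *: u + k.2 *: h))).
    near=> y; have Dy : D y by near: y; exact: open_nbhs_nbhs.
    exact: esym (dG y k Dy).2.
  apply: (@cont_comp _ _ _ _ a (fun y => 'd f y (k.1 *: u + k.2 *: h))); first exact: a_cont.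
  by have [_] := C1 _ Dz; exact.
- move=> z Dz; refine (etrans (dG z (0, 1) Dz).2 (etrans _ (congr1 (fun y => c * y) (esym (dG z (1, 0) Dz).2)))).
  by rewrite /= !scale0r !scale1r add0r addr0; exact: CR.
- move=> s t hs; have := hO s t hs; rewrite /D /= /a /pol /=.
  by rewrite scalerDr !scalerA.
- exact: (a_cont p _ f0).
Unshelve. all: by end_near. Qed.

End VanishingStep.

Section Identity.
Variables (R : realType) (L : falgType R).
Local Notation A := (fdnormed L).
Variables (X : normedModType R) (I : finType) (hs us : I -> X) (cs : I -> A) (xi : I -> X -> R).
Hypotheses (gcs : forall i, nonreal (cs i))
  (xiE : forall x, x = \sum_i xi i x *: hs i).
Variables (U : set X) (oU : open U) (f : X -> A).

Lemma cont_sum (T : topologicalType) (V : normedModType R) (J : Type) (r : seq J) (F : J -> T -> V) (t : T) :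
  (forall j, {for t, continuous (F j)}) -> {for t, continuous (fun s => \sum_(j <- r) F j s)}.
Proof.
move=> cF; elim: r => [|j r IH].
  rewrite (_ : (fun s => _) = (fun=> 0)); first exact: cont_cst.
  by apply/funext => s; rewrite big_nil.
rewrite (_ : (fun s => _) = (fun s => F j s + \sum_(j <- r) F j s)); first exact: contD.
by apply/funext => s; rewrite big_cons.
Qed.

(** Since the hs i span, every derivative of f is a combination of its derivatives along the us i,
    which are continuous. *)
Lemma cauchy_riemann_C1 :
  (forall i y, U y -> cauchy_riemann (us i) (hs i) (cs i) f y) ->
  (exists i : I, True) -> C1_on U f.
Proof.
move=> CR [i0 _] y Uy; split=> [|k]; first by have [] := CR i0 y Uy.
apply: (@cont_near_eq _ _ (fun y => \sum_i xi i k *: (cs i * 'd f y (us i)))).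
  near=> z; have Uz : U z by near: z; exact: open_nbhs_nbhs.
  rewrite [in RHS](xiE k) linear_sum; apply: eq_bigr => i _.
  by rewrite linearZ; have [_ ->] := CR i z Uz.
apply: cont_sum => i; apply: contZr; apply: contMAr.
by apply: (cauchy_riemann_derive_continuous (gcs i) oU) => // z; exact: CR.
Unshelve. all: by end_near. Qed.

Hypothesis C1 : C1_on U f.
Hypothesis CR : forall i y, U y -> 'd f y (hs i) = cs i * 'd f y (us i).
Variable B : R.
Hypotheses (B0 : 0 < B) (xiB : forall i x, `|xi i x| <= B * `|x|).

Lemma finite_positive (P : I -> R -> Prop) :
  (forall i d d', P i d -> 0 < d' -> d' <= d -> P i d') ->
  (forall i, exists2 d, 0 < d & P i d) -> exists2 d, 0 < d & forall i, P i d.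
Proof.
move=> Pd Pe.
have [|d Hd] := @choice I R (fun i d => 0 < d /\ P i d).
  by move=> i; have [d d0 Hd] := Pe i; exists d.
exists (\big[Num.min/1]_i d i).
  by elim/big_ind: _ => [|x y x0 y0|i _]; rewrite ?ltr01 ?lt_min ?x0//; have [] := Hd i.
have d0 : 0 < \big[Num.min/1]_i d i.
  by elim/big_ind: _ => [|x y x0 y0|i _]; rewrite ?ltr01 ?lt_min ?x0//; have [] := Hd i.
by move=> i; apply: (Pd i (d i)) => //; [have [] := Hd i | exact: bigmin_le].
Qed.

Let vanishes (x : X) : Prop := \forall y \near x, f y = 0.

(** Vanishing near x passes to vanishing near a point reached along one hs i, with a step length
    valid throughout a neighbourhood of x0. *)
Lemma vanish_walk x0 : U x0 -> exists2 e : R, 0 < e &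
  forall i x k, `|x - x0| < e -> `|k *: hs i + x - x0| < e -> `|k| < e ->
    vanishes x -> vanishes (k *: hs i + x).
Proof.
move=> Ux0; have /nbhs_ballP[d /= d0 dU] := open_nbhs_nbhs (conj oU Ux0).
apply: finite_positive => [i e e' H e'0 ee x k h1 h2 h3|i].
  by apply: H; exact: lt_le_trans ee.
have [b b0 Hb] := vanish_step (gcs i).
have d2 : 0 < d / 2 by rewrite divr_gt0.
have n0 : 0 < `|us i| + `|hs i| + 1 by rewrite ltr_wpDl// addr_ge0.
pose r := d / 2 / (`|us i| + `|hs i| + 1); have r0 : 0 < r by rewrite !divr_gt0.
exists (Num.min (d / 2) (b * r)); first by rewrite lt_min d2 mulr_gt0.
move=> x k _; rewrite !lt_min => /andP[xk _] /andP[_ kb] vx.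
have vx' := nbhs_interior vx.
have cs' : {for k *: hs i + x, continuous (fun z => z - k *: hs i)}.
  by apply: contB; [exact: cvg_id | exact: cont_cst].
have Ex : k *: hs i + x - k *: hs i = x by rewrite addrAC subrr add0r.
have near_shift : \forall z \near k *: hs i + x, vanishes (z - k *: hs i).
  by apply: cs'; rewrite Ex.
have near_x0 : \forall z \near k *: hs i + x, `|z - x0| < d / 2.
  pose e := d / 2 - `|k *: hs i + x - x0|; have e0 : 0 < e by rewrite subr_gt0.
  apply: filterS (near_dist_lt (k *: hs i + x) e0) => z.
  rewrite distrC ltrBrDr; apply: le_lt_trans.
  by rewrite -(subrKA (k *: hs i + x)) ler_normD.
apply: filterS2 near_shift near_x0 => z vz zx0.
apply: (Hb X (us i) (hs i) f U z (0, - k) r) => //=.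
- by rewrite normr0 mulr_ge0 ?ltW.
- by rewrite normrN ltW.
- by move=> y; exact: CR.
- move=> s t /andP[s0 sr]; apply: dU; rewrite -ball_normE /=.
  rewrite distrC (splitr d) -(subrKA z) (le_lt_trans (ler_normD _ _))// ler_ltD//.
  rewrite (le_trans (pol_dist _ _ _ _ s0))//.
  rewrite (@le_trans _ _ (s * (`|us i| + `|hs i| + 1)))//; first by rewrite ler_wpM2l// lerDl.
  by rewrite -ler_pdivlMr.
- by rewrite scale0r add0r scaleNr addrC.
Qed.

(** From a vanishing point y close to x0, any x near x0 is reached by successive steps along the hs
    i, one for each coordinate of x - y. *)
Lemma vanish_near x0 : U x0 ->
  (forall W, nbhs x0 W -> exists2 y, W y & vanishes y) -> vanishes x0.
Proof.
move=> Ux0 acc; have [e e0 step] := vanish_walk Ux0.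
pose H := \sum_i `|hs i|.
have H0 : 0 <= H by rewrite sumr_ge0.
(* Keeps every step, at most 2 g B, and every intermediate point, within g + 2 g B H of x0, below
   the threshold e. *)
pose g := e / (2 * (1 + 2 * B * (1 + H))).
have D0 : 0 < 1 + 2 * B * (1 + H) by rewrite addr_gt0 ?mulr_gt0// ltr_wpDr.
have g0 : 0 < g by rewrite divr_gt0// mulr_gt0.
have gE : g * (1 + 2 * B * (1 + H)) = e / 2.
  by rewrite /g; field; rewrite gt_eqF.
have gB : 2 * g * B < e.
  by rewrite (@lt_trans _ _ (e / 2))//; last lra; rewrite -gE; have := mulr_ge0 (ltW (mulr_gt0 g0 B0)) H0; have := mulr_gt0 g0 B0; move: (g) g0 => ? ?; lra.
have gH : g + 2 * g * B * H < e.
  by rewrite (@lt_trans _ _ (e / 2))//; last lra; rewrite -gE; have := mulr_ge0 (ltW (mulr_gt0 g0 B0)) H0; have := mulr_gt0 g0 B0; move: (g) g0 => ? ?; lra.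
have [y yx0 vy] := acc _ (near_dist_lt x0 g0).
apply: filterS (near_dist_lt x0 g0) => x xx0.
have xy : `|x - y| <= 2 * g.
  rewrite -(subrKA x0) (le_trans (ler_normD _ _))// mulr2n mulrDl mul1r.
  by rewrite lerD// ltW// distrC.
have xiy i : `|xi i (x - y)| <= 2 * g * B.
  by rewrite (le_trans (xiB _ _))// mulrC ler_wpM2r// ltW.
(* The partial sums over lists of indices are the intermediate points of the walk; the bound on
   their distance to x0 is part of the induction. *)
suff walk (r : seq I) : g + 2 * g * B * (\sum_(i <- r) `|hs i|) < e ->
    vanishes (\sum_(i <- r) xi i (x - y) *: hs i + y) /\
    `|\sum_(i <- r) xi i (x - y) *: hs i + y - x0| <= g + 2 * g * B * (\sum_(i <- r) `|hs i|).
  have [/nbhs_singleton + _] := walk (index_enum I) gH.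
  by rewrite -xiE subrK.
elim: r => [|i r IH] le_e.
  by rewrite !big_nil mulr0 addr0 add0r distrC ltW.
have hi := normr_ge0 (hs i); have g2B : 0 <= 2 * g * B by rewrite -mulrA pmulr_rge0 ?ltr0n// mulr_ge0// ltW.
have [|v1 b1] := IH.
  by apply: le_lt_trans le_e; rewrite big_cons lerD2l ler_wpM2l// lerDr.
have b2 : `|\sum_(j <- i :: r) xi j (x - y) *: hs j + y - x0| <=
    g + 2 * g * B * (\sum_(j <- i :: r) `|hs j|).
  rewrite !big_cons -!addrA (le_trans (ler_normD _ _))// mulrDr [leRHS]addrCA lerD//.
    by rewrite normrZ ler_wpM2r.
  by rewrite addrA.
split=> //; move: b2; rewrite big_cons -[_ + _ + y]addrA => b2.
apply: step => //.
- apply: le_lt_trans b1 _; apply: le_lt_trans le_e.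
  by rewrite big_cons lerD2l ler_wpM2l// lerDr.
- exact: le_lt_trans b2 le_e.
- exact: le_lt_trans gB.
Qed.

End Identity.

(** * Cutoff functions *)

Section Cutoff.
Variable R : realType.

Lemma is_derive_positive_part_pow (k : nat) (t : R) :
  is_derive t 1 (fun t => Num.max t 0 ^+ k.+2) (k.+2%:R * Num.max t 0 ^+ k.+1).
Proof.
have [t0|t0|->] := ltgtP t 0.
- apply: (@near_eq_is_derive_ext R R R (fun=> 0)); last first.
    by rewrite expr0n /= mulr0; exact: is_derive_cst.
  have nt : 0 < - t by rewrite oppr_gt0.
  apply: filterS (nbhsx_ballx (t : R) _ nt) => s; rewrite /ball /= distrC => ts.
  have s0 : s <= 0 by have := le_lt_trans (ler_norm _) ts; lra.
  by rewrite (max_idPr s0) expr0n.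
- apply: (@near_eq_is_derive_ext R R R (fun s => s ^+ k.+2)); last first.
    have := @is_deriveX R R id k.+2 t 1 1 (is_derive_id _ _).
    by rewrite [_ *: 1]mulr1; apply: is_derive_ext => s; rewrite exprfctE.
  apply: filterS (nbhsx_ballx (t : R) _ t0) => s; rewrite /ball /= => ts.
  have s0 : 0 <= s by have := le_lt_trans (ler_norm _) ts; lra.
  by rewrite (max_idPl s0).
- apply/is_deriveP => e e0.
  have e1 : 0 < Num.min e 1 by rewrite lt_min e0 ltr01.
  apply: filterS (nbhsx_ballx (0 : R) _ e1) => h /=.
  rewrite /ball /= sub0r normrN lt_min => /andP[/ltW he /ltW h1].
  rewrite [h *: 1]mulr1 addr0 maxxx !expr0n /= subr0 mulr0 [h *: _]mulr0 subr0.
  have m0 : `|Num.max h 0| <= `|h| by case: (leP h 0) => [h0|h0]; rewrite ?normr0.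
  rewrite normrX exprSr ler_pM// exprS; apply: le_trans he; rewrite -[leRHS]mulr1.
  by apply: ler_pM => //; rewrite exprn_ile1// (le_trans m0).
Qed.

Lemma positive_part_continuous (t : R) : {for t, continuous (fun t : R => Num.max t 0)}.
Proof. by apply: continuous_max; [exact: cvg_id | exact: cvg_cst]. Qed.

Definition C2_1 (phi : R -> R) := exists phi1 phi2 : R -> R,
  [/\ forall t : R, is_derive t 1 phi (phi1 t), forall t : R, is_derive t 1 phi1 (phi2 t) & continuous phi2].

Lemma C2_cube : C2_1 (fun t => Num.max t 0 ^+ 3).
Proof.
exists (fun t => 3 * Num.max t 0 ^+ 2), (fun t => 6 * Num.max t 0); split=> t.
- exact: is_derive_positive_part_pow.
- have := is_deriveZ 3 (is_derive_positive_part_pow 0 t).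
  by move=> D; apply: is_derive_eq D _; rewrite expr1 /GRing.scale /=; ring.
- by apply: cvgM; [exact: cvg_cst | exact: positive_part_continuous].
Qed.

Variable X : fdModType R.
Implicit Types g : X -> R.

(** The symmetry of the second derivatives is carried as data, stable under sums and compositions,
    so that Schwarz's theorem is avoided; [dsource_swap] relies on it. *)
Definition C2_on g (D1 : X -> X -> R) (D2 : X -> X -> X -> R) :=
  [/\ forall y, differentiable g y, forall k y, is_derive y k g (D1 k y),
     forall k y, differentiable (D1 k) y, forall k l y, is_derive y l (D1 k) (D2 k l y)
   & forall k l, continuous (D2 k l) /\ D2 k l = D2 l k].

Definition C2 g := exists D1 D2, C2_on g D1 D2.

Lemma C2_cst (a : R) : C2 (fun=> a).
Proof.
exists (fun _ _ => 0), (fun _ _ _ => 0); split=> //; try by move=> *; exact: differentiable_cst.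
- by move=> k y; exact: is_derive_cst.
- by move=> k l y; exact: is_derive_cst.
- by move=> k l; split=> // y; exact: cont_cst.
Qed.

Lemma C2D g1 g2 : C2 g1 -> C2 g2 -> C2 (fun y => g1 y + g2 y).
Proof.
move=> [D1 [D2 [a1 a2 a3 a4 a5]]] [E1 [E2 [b1 b2 b3 b4 b5]]].
exists (fun k y => D1 k y + E1 k y), (fun k l y => D2 k l y + E2 k l y); split.
- by move=> y; exact: differentiableD.
- by move=> k y; exact: is_deriveD.
- by move=> k y; exact: differentiableD.
- by move=> k l y; exact: is_deriveD.
- move=> k l; have [c1 s1] := a5 k l; have [c2 s2] := b5 k l.
  split; last by rewrite s1 s2.
  by move=> y; apply: cvgD; [exact: c1 | exact: c2].
Qed.

Lemma C2_sum (J : Type) (r : seq J) (F : J -> X -> R) :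
  (forall j, C2 (F j)) -> C2 (fun y => \sum_(j <- r) F j y).
Proof.
move=> cF; elim: r => [|j r IH].
  by rewrite (_ : (fun s => _) = (fun=> 0)); [exact: C2_cst | apply/funext => s; rewrite big_nil].
rewrite (_ : (fun s => _) = (fun s => F j s + \sum_(j <- r) F j s)); first exact: C2D.
by apply/funext => s; rewrite big_cons.
Qed.

Lemma is_derive_comp1 (phi : R -> R) (d : R) g y k (dg : R) :
  is_derive (g y) 1 phi d -> is_derive y k g dg -> is_derive y k (fun y => phi (g y)) (d * dg).
Proof.
move=> /is_derive_differentiable[dphi phiE] Dg; apply: is_derive_at_line.
have y0 : 0 *: k + y = y by rewrite scale0r add0r.
have Dl : is_derive (0 : R) 1 (fun s : R => g (s *: k + y)) dg.
  by apply: is_derive_line; rewrite y0.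
have dphi' : differentiable phi (g (0 *: k + y)) by rewrite y0.
by have := is_derive_curve Dl dphi'; rewrite y0 phiE [dg *: d]mulrC.
Qed.

Lemma differentiable_comp1 (phi : R -> R) (d : R) g y :
  is_derive (g y) 1 phi d -> differentiable g y -> differentiable (fun y => phi (g y)) y.
Proof. by move=> /is_derive_differentiable[dphi _] dg; exact: (@differentiable_comp _ _ _ _ g phi). Qed.

Lemma C2_comp (phi : R -> R) g : C2_1 phi -> C2 g -> C2 (fun y => phi (g y)).
Proof.
move=> [phi1 [phi2 [p1 p2 p3]]] [D1 [D2 [a1 a2 a3 a4 a5]]].
have cg y : {for y, continuous g} by exact: differentiable_continuous.
have cD1 k y : {for y, continuous (D1 k)} by exact: differentiable_continuous.
exists (fun k y => phi1 (g y) * D1 k y),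
  (fun k l y => (phi2 (g y) * D1 l y) * D1 k y + phi1 (g y) * D2 k l y); split.
- by move=> y; apply: differentiable_comp1.
- by move=> k y; exact: is_derive_comp1.
- move=> k y; apply: (@differentiable_scale R X R (fun y => phi1 (g y)) (D1 k)) => //.
  exact: differentiable_comp1.
- move=> k l y.
  have := is_derive_scale (is_derive_comp1 (p2 (g y)) (a2 l y)) (a4 k l y).
  by move=> D; apply: is_derive_eq D _.
- move=> k l; have [c1 s1] := a5 k l; split; last first.
    by apply/funext => y; rewrite s1; congr (_ + _); ring.
  move=> y; apply: cvgD.
    apply: cvgM; last exact: cD1.
    apply: cvgM; last exact: cD1.
    by apply: (@cont_comp _ _ _ _ g phi2) => //; exact: p3.
  apply: cvgM; last exact: c1.
  apply: (@cont_comp _ _ _ _ g phi1) => //; exact: is_derive_continuous (p2 _).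
Qed.

Lemma C2_fdc i (a : R) : C2 (fun y => fdc i y - a).
Proof.
have lc : continuous (fdc i : X -> R) by exact: fdc_continuous.
have ld y : differentiable (fdc i : X -> R) y by exact: linear_differentiable.
have Dd y k : is_derive y k (fun y => fdc i y - a) (fdc i k).
  have := is_deriveB (differentiable_is_derive k (ld y)) (is_derive_cst a y k).
  by rewrite subr0 diff_lin.
exists (fun k _ => fdc i k), (fun _ _ _ => 0); split=> //.
- by move=> y; apply: differentiableB; [exact: ld | exact: differentiable_cst].
- by move=> k l y; exact: is_derive_cst.
- by move=> k l; split=> // y; exact: cont_cst.
Qed.

Lemma C2_1sqr : C2_1 (fun t : R => t ^+ 2).
Proof.
exists (fun t => 2 * t), (fun=> 2); split=> [t|t|t].
- have := @is_deriveX R R id 2 t 1 1 (is_derive_id _ _).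
  by rewrite [_ *: 1]mulr1; apply: is_derive_ext => s; rewrite exprfctE.
- by have := is_deriveZ 2 (is_derive_id t (1 : R)); rewrite [2 *: 1]mulr1.
- exact: cont_cst.
Qed.

Lemma C2Z (a : R) g : C2 g -> C2 (fun y => a * g y).
Proof.
apply: (@C2_comp ( *%R a)).
exists (fun=> a), (fun=> 0); split=> [t|t|t].
- by have := is_deriveZ a (is_derive_id t (1 : R)); rewrite [a *: 1]mulr1.
- exact: is_derive_cst.
- exact: cont_cst.
Qed.

(** The Euclidean square of the distance, which is smooth, unlike the sup norm. *)
Definition dist2 (p y : X) : R := \sum_i (fdc i y - fdc i p) ^+ 2.

Lemma C2_dist2 p : C2 (dist2 p).
Proof. by apply: C2_sum => i; apply: (@C2_comp (fun t => t ^+ 2)); [exact: C2_1sqr | exact: C2_fdc]. Qed.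

Lemma C2_continuous g : C2 g -> continuous g.
Proof. by move=> [D1 [D2 [a1 _ _ _ _]]] y; exact: differentiable_continuous. Qed.

Lemma dist2_small p (O : set X) : open O -> O p ->
  exists2 a : R, 0 < a & forall y, a * dist2 p y <= 2 -> O y.
Proof.
move=> oO Op; have /nbhs_ballP[d /= d0 dO] := open_nbhs_nbhs (conj oO Op).
(* With this a, the bound a |y - p|^2 <= 2 puts every coordinate of y - p within d / 2. *)
exists (8 / d ^+ 2); first by rewrite divr_gt0// exprn_gt0.
move=> y; rewrite mulrAC ler_pdivrMr ?exprn_gt0// => yp.
apply: dO; rewrite -ball_normE /= distrC; apply: (@le_lt_trans _ _ (d / 2)); last first.
  by rewrite ltr_pdivrMr// ltr_pMr// ltr1n.
apply: fdnorm_le => [|i]; first by rewrite divr_ge0// ltW.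
rewrite fdcD fdcN -ler_sqr ?nnegrE ?divr_ge0 ?(ltW d0)// real_normK ?num_real//.
have : (fdc i y - fdc i p) ^+ 2 <= dist2 p y.
  by rewrite /dist2 (bigD1 i)//= lerDl sumr_ge0// => j _; exact: sqr_ge0.
have -> : (d / 2) ^+ 2 = d ^+ 2 / 4 by rewrite expr_div_n; congr (_ / _); rewrite -natrX.
set y1 := (_ - _) ^+ 2; lra.
Qed.

Lemma open_sublevel g (b : R) : continuous g -> open [set y | g y < b].
Proof.
move=> cg; apply: (@open_comp _ _ g [set t | t < b]); last exact: open_lt.
by move=> y _; exact: cg.
Qed.

Lemma open_superlevel g (b : R) : continuous g -> open [set y | b < g y].
Proof.
move=> cg; apply: (@open_comp _ _ g [set t | b < t]); last exact: open_gt.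
by move=> y _; exact: cg.
Qed.

Lemma open_forall_seq (J : eqType) (r : seq J) (F : J -> set X) :
  (forall j, open (F j)) -> open [set y | forall j, j \in r -> F j y].
Proof.
move=> oF; elim: r => [|j r IH].
  by rewrite (_ : mkset _ = setT); [exact: openT | apply/seteqP; split].
rewrite (_ : mkset _ = F j `&` [set y | forall j, j \in r -> F j y]); first exact: openI.
apply/seteqP; split=> y /=.
  by move=> H; split=> [|k kr]; apply: H; rewrite inE ?eqxx// kr orbT.
by move=> [Fj H] k; rewrite inE => /predU1P[->//|]; exact: H.
Qed.

(* With [cube] the C^2 function max(t, 0)^3, take xi = cube (1 - S) where S is a
   finite sum of bumps cube (2 - a |y - p|^2): S vanishes off [O], where xi = cube 1,
   and S >= 1 near [K]. *)
Lemma C2_cutoff (K O : set X) : compact K -> open O -> K `<=` O ->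
  exists xi Y0 Y1, [/\ C2 xi, open Y0 /\ open Y1, K `<=` Y0 /\ ~` O `<=` Y1,
    forall y, Y0 y -> xi y = 0 & forall y, Y1 y -> xi y = 1].
Proof.
move=> cK oO KO; pose cube (t : R) := Num.max t 0 ^+ 3.
have cube0 t : t <= 0 -> cube t = 0 by move=> t0; rewrite /cube (max_idPr t0) expr0n.
have cube_ge0 t : 0 <= cube t by rewrite exprn_ge0// le_max lexx orbT.
have cube_ge1 t : 1 <= t -> 1 <= cube t.
  by move=> t1; rewrite exprn_ege1// le_max t1.
have [|a Ha] := @choice X R (fun p a => K p -> 0 < a /\ forall y, a * dist2 p y <= 2 -> O y).
  move=> p; have [Kp|nKp] := pselect (K p); last by exists 0.
  by have [a a0 aO] := dist2_small oO (KO p Kp); exists a.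
pose g p y := a p * dist2 p y.
have C2g p : C2 (g p) by apply: C2Z; exact: C2_dist2.
move: cK; rewrite compact_cover => /(_ X K (fun p => [set y | g p y < 1])).
case=> [p _|p Kp|D DK KD].
- by apply: open_sublevel; apply: C2_continuous.
- exists p => //=; rewrite /g /dist2 big1 ?mulr0// => i _; by rewrite subrr expr0n.
have C2_flip (b : R) h : C2 h -> C2 (fun y => b + -1 * h y).
  by move=> C2h; apply: C2D; [exact: C2_cst | exact: C2Z].
pose r := finmap.enum_fset D.
pose S y := \sum_(p <- r) cube (2 + -1 * g p y).
exists (fun y => cube (1 + -1 * S y)),
  (\bigcup_(p in [set p | p \in r]) [set y : X | g p y < 1]),
  [set y : X | forall p, p \in r -> 2 < g p y].
split.
- apply: C2_comp C2_cube _; apply: (C2_flip); apply: C2_sum => p.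
  by apply: C2_comp C2_cube _; exact: C2_flip.
- split; first by apply: bigcup_open => p _; apply: open_sublevel; apply: C2_continuous.
  apply: (@open_forall_seq X r (fun p => [set y : X | 2 < g p y])) => p.
  by apply: open_superlevel; apply: C2_continuous.
- split=> // y nOy p pD /=; rewrite ltNge; apply/negP => gy; apply: nOy.
  have Kp : K p by have := DK p pD; rewrite inE.
  by have [_] := Ha p Kp; exact.
- move=> y [p /= pD gy]; apply: cube0.
  have h1 : 1 <= cube (2 + -1 * g p y) by apply: cube_ge1; lra.
  have h2 : cube (2 + -1 * g p y) <= S y.
    by rewrite /S (bigD1_seq p)//= ?finmap.fset_uniq// lerDl sumr_ge0.
  lra.
- move=> y Yy; have -> : S y = 0.
    rewrite /S big_seq big1// => p pD; apply: cube0.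
    have := Yy p pD; rewrite /=; lra.
  by rewrite mulr0 addr0 /cube (max_idPl ler01) expr1n.
Qed.

End Cutoff.

(** * Hartogs extension *)

Section Source.
Variables (R : realType) (L : falgType R).
Local Notation A := (fdnormed L).
Variables (X : fdModType R) (I : Type) (hs us : I -> X) (cs : I -> A).
Hypothesis cC : forall i (b : A), b * cs i = cs i * b.
Variables (xi : X -> R) (D1 : X -> X -> R) (D2 : X -> X -> X -> R).
Hypothesis xiC2 : C2_on xi D1 D2.
Variables (Y0 Y1 V : set X) (f : X -> A).
Hypotheses (oY0 : open Y0) (oY1 : open Y1) (oV : open V)
  (xi0 : forall y, Y0 y -> xi y = 0) (xi1 : forall y, Y1 y -> xi y = 1)
  (C1 : C1_on V f) (CR : forall i y, V y -> 'd f y (hs i) = cs i * 'd f y (us i))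
  (cover : forall y, V y \/ (Y0 y \/ Y1 y)).

Lemma is_derive_locally_cst (W : normedModType R) (g : X -> W) (a : W) (O : set X) y k d :
  open O -> (forall y, O y -> g y = a) -> O y -> is_derive y k g d -> d = 0.
Proof.
move=> oO ga Oy dg; apply: (is_derive_unique dg).
apply: (near_eq_is_derive_ext _ (is_derive_cst a y k)).
by apply: filterS (open_nbhs_nbhs (conj oO Oy)) => z /ga.
Qed.

Lemma cutoff_derivatives_eq0 y : Y0 y \/ Y1 y ->
  forall k, D1 k y = 0 /\ forall l, D2 k l y = 0.
Proof.
have [a1 a2 a3 a4 a5] := xiC2.
have key (O : set X) (a : R) : open O -> (forall y, O y -> xi y = a) -> O y ->
    forall k, D1 k y = 0 /\ forall l, D2 k l y = 0.
  move=> oO Oa Oy k.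
  have D10 z : O z -> D1 k z = 0 by move=> Oz; exact: is_derive_locally_cst oO Oa Oz (a2 k z).
  split=> [|l]; first exact: D10.
  exact: is_derive_locally_cst oO D10 Oy (a4 k l y).
by case=> Yy k; [apply: (key Y0 0) | apply: (key Y1 1)].
Qed.

Definition cutoff_dbar i y : A := D1 (hs i) y *: 1 - D1 (us i) y *: cs i.
Definition cutoff_ddbar i k y : A := D2 (hs i) k y *: 1 - D2 (us i) k y *: cs i.
(* [source i] is what [D_(hs i) - cs i * D_(us i)] makes of [xi *: f]; it also makes
   sense where [f] is not defined, as the derivatives of [xi] vanish off [V]. *)
Definition source i y : A := cutoff_dbar i y * f y.
Definition dsource i k y : A := cutoff_ddbar i k y * f y + cutoff_dbar i y * 'd f y k.

Lemma flat_near0 y : Y0 y \/ Y1 y -> \forall z \near y,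
  forall i, source i z = 0 /\ forall k, dsource i k z = 0.
Proof.
move=> Yy; have nY : \forall z \near y, (Y0 `|` Y1) z.
  by apply: open_nbhs_nbhs; split=> //; exact: openU.
apply: filterS nY => z Yz i; have D0 := cutoff_derivatives_eq0 Yz.
have c0 : cutoff_dbar i z = 0.
  by rewrite /cutoff_dbar (D0 (hs i)).1 (D0 (us i)).1 !scale0r subrr.
split=> [|k]; first by rewrite /source c0 mul0r.
rewrite /dsource c0 /cutoff_ddbar ((D0 (hs i)).2 k) ((D0 (us i)).2 k).
by rewrite !scale0r subrr !mul0r addr0.
Qed.

Lemma source_diff i y : differentiable (source i) y /\
  forall k, is_derive y k (source i) (dsource i k y).
Proof.
have [a1 a2 a3 a4 a5] := xiC2.
case: (cover y) => [Vy|Yy].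
  have [df _] := C1 Vy; split=> [|k].
    apply: differentiableMA => //; apply: differentiableB;
      by apply: differentiable_scale; [exact: a3 | exact: differentiable_cst].
  apply: is_deriveMA; last exact: differentiable_is_derive.
  have sc h (b : A) : is_derive y k (fun y => D1 h y *: b) (D2 h k y *: b).
    by have := is_derive_scale (a4 h k y) (is_derive_cst b y k); rewrite scaler0 addr0.
  exact: is_deriveB.
have nY := flat_near0 Yy; have n0 : \forall z \near y, 0 = source i z.
  by apply: filterS nY => z /(_ i)[->].
have [dn _] := near_eq_differentiable n0 (differentiable_cst (0 : A) y).
split=> // k; have [_ /(_ k) ->] := nbhs_singleton nY i.
by apply: near_eq_is_derive_ext n0 _; exact: is_derive_cst.
Qed.

Lemma dsource_continuous i k : continuous (dsource i k).
Proof.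
have [a1 a2 a3 a4 a5] := xiC2; move=> y; case: (cover y) => [Vy|Yy].
  have [df cdf] := C1 Vy.
  have sc (g : X -> R) (b : A) : {for y, continuous g} -> {for y, continuous (fun y => g y *: b)}.
    by move=> cg; apply: contZ => //; exact: cont_cst.
  apply: (@contD R X y A (fun y => cutoff_ddbar i k y * f y) (fun y => cutoff_dbar i y * 'd f y k)).
    apply: (@contMA R L X (cutoff_ddbar i k) f y); last exact: differentiable_continuous.
    apply: (@contB R X y A (fun y => D2 (hs i) k y *: 1) (fun y => D2 (us i) k y *: cs i));
      by apply: sc; exact: (a5 _ _).1.
  apply: (@contMA R L X (cutoff_dbar i) (fun y => 'd f y k) y); last exact: cdf.
  apply: (@contB R X y A (fun y => D1 (hs i) y *: 1) (fun y => D1 (us i) y *: cs i));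
    by apply: sc; apply: differentiable_continuous; exact: a3.
apply: (@cont_near_eq _ _ (fun=> 0)); last exact: cont_cst.
by apply: filterS (flat_near0 Yy) => z /(_ i)[_ ->].
Qed.

Lemma dsource_linear i y : linear (fun k => dsource i k y).
Proof.
have [_ sd] := source_diff i y; have [ds _] := source_diff i y.
move=> a k l; have E k' : dsource i k' y = 'd (source i) y k'.
  exact: is_derive_unique (sd k') (differentiable_is_derive k' ds).
by rewrite !E linearP.
Qed.

(** Compatibility of the sources: with P_i = D_(hs i) - cs i D_(us i), each side is (P_i P_j xi) f
    where f is defined, and 0 elsewhere. The P_i commute because the coefficients are central and
    the second derivatives of xi symmetric. *)
Lemma dsource_swap i j y :
  dsource i (hs j) y - cs j * dsource i (us j) y =
  dsource j (hs i) y - cs i * dsource j (us i) y.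
Proof.
have [a1 a2 a3 a4 a5] := xiC2; case: (cover y) => [Vy|Yy]; last first.
  have nY := nbhs_singleton (flat_near0 Yy).
  by rewrite !(nY i).2 !(nY j).2 !mulr0.
(* In the Leibniz rule the terms with a derivative of f cancel by [CR]. *)
have half i' j' : dsource i' (hs j') y - cs j' * dsource i' (us j') y =
    (cutoff_ddbar i' (hs j') y - cs j' * cutoff_ddbar i' (us j') y) * f y.
  have key (P Q d e c F : A) : d * c = c * d ->
      P * F + d * (c * e) - c * (Q * F + d * e) = (P - c * Q) * F.
    by move=> dc; rewrite mulrDr mulrBl !mulrA dc opprD addrACA subrr addr0.
  by rewrite /dsource CR//; apply: key; exact: cC.
rewrite !half; congr (_ * _); rewrite /cutoff_ddbar.
rewrite !mulrBr -!scalerAr !mulr1 -(cC i (cs j)).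
rewrite (a5 (hs j) (hs i)).2 (a5 (us j) (us i)).2 (a5 (hs j) (us i)).2 (a5 (us j) (hs i)).2.
rewrite !opprB !addrA; fd_ring.
Qed.

End Source.

Section Hartogs.
Variables (R : realType) (L : falgType R).
Local Notation A := (fdnormed L).
Variable X : fdModType R.

(** It provides a radius for which circles in the plane leave a bounded set. By homogeneity it
    suffices to minimise the norm of v + t w over |t| <= 1, with v the vector whose coefficient is
    the larger in absolute value; that coefficient is at least 1/2. *)
Lemma plane_norm_lower (u h : X) :
  (forall s t : R, s *: u + t *: h = 0 -> s = 0 /\ t = 0) ->
  exists2 m : R, 0 < m & forall t, m <= `|cos t *: u + sin t *: h|.
Proof.
move=> ind.
have edge (v w : X) : (forall s t : R, s *: v + t *: w = 0 -> s = 0 /\ t = 0) ->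
    exists2 m : R, 0 < m & forall s t : R, `|t| <= `|s| -> m * `|s| <= `|s *: v + t *: w|.
  move=> vw; have le11 : -1 <= 1 :> R by lra.
  have [|t0 t0I Hm] := @EVT_min R (fun t => `|v + t *: w|) (-1) 1 le11.
    apply: continuous_subspaceT => t.
    apply: (@cont_comp R t X R (fun t : R => v + t *: w) (fun y : X => `|y|)); last exact: norm_continuous.
    by apply: contD; [exact: cont_cst | apply: contZ; [exact: cvg_id | exact: cont_cst]].
  exists `|v + t0 *: w|.
    rewrite normr_gt0 -[v]scale1r; apply/eqP => /vw[/eqP]; by rewrite oner_eq0.
  move=> s t; have [->|s0] := eqVneq s 0.
    by rewrite normr0 mulr0.
  move=> ts; have -> : s *: v + t *: w = s *: (v + (s^-1 * t) *: w).
    by rewrite scalerDr scalerA mulrA divff// mul1r.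
  rewrite normrZ mulrC ler_wpM2l//; apply: Hm.
  by rewrite in_itv /= -ler_norml normrM normfV ler_pdivrMl ?normr_gt0// mulr1.
have [m1 m10 H1] := edge u h ind.
have [m2 m20 H2] : exists2 m : R, 0 < m & forall s t : R, `|t| <= `|s| -> m * `|s| <= `|s *: h + t *: u|.
  by apply: edge => s t; rewrite addrC => /ind[].
exists (Num.min m1 m2 / 2) => [|t]; first by rewrite divr_gt0// lt_min m10.
have c1 : m1 >= Num.min m1 m2 by rewrite ge_min lexx.
have c2 : m2 >= Num.min m1 m2 by rewrite ge_min lexx orbT.
have m0 : 0 < Num.min m1 m2 by rewrite lt_min m10.
have sq := cos2Dsin2 t.
have half (z w : R) : `|w| <= `|z| -> z ^+ 2 + w ^+ 2 = 1 -> 2^-1 <= `|z|.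
  move=> wz; rewrite -(real_normK (num_real z)) -(real_normK (num_real w)).
  have := normr_ge0 z; have := normr_ge0 w; move: `|z| `|w| wz => z' w' wz w0 z0 e.
  rewrite leNgt; apply/negP => zl; nra.
have [le|/ltW le] := leP `|sin t| `|cos t|.
  have h1 := half _ _ le sq; have h2 := H1 _ _ le; apply: le_trans h2.
  by apply: ler_pM => //; rewrite ltW.
have h1 := half _ _ le (etrans (addrC _ _) sq); have h2 := H2 _ _ le.
rewrite addrC; apply: le_trans h2.
by apply: ler_pM => //; rewrite ltW.
Qed.

Variables (I : finType) (hs us : I -> X) (cs : I -> A) (co : I -> X -> R) (B : R).
Hypotheses (gcs : forall i, nonreal (cs i))
  (cC : forall i (b : A), b * cs i = cs i * b)
  (coE : forall x, x = \sum_i co i x *: hs i)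
  (B0 : 0 < B) (coB : forall i x, `|co i x| <= B * `|x|).
Variables (i0 : I) (lam : {linear X -> R}) (w0 : X).
Hypotheses (lu : lam (us i0) = 0) (lh : lam (hs i0) = 0) (lw : 0 < lam w0).
Hypothesis ind : forall s t : R, s *: us i0 + t *: hs i0 = 0 -> s = 0 /\ t = 0.

Section Transform.
Variables (al : I -> X -> A) (be : I -> X -> X -> A) (M r0 : R).
Hypotheses (r00 : 0 <= r0)
  (alD : forall i y, differentiable (al i) y /\ forall k, is_derive y k (al i) (be i k y))
  (bec : forall i k, continuous (be i k))
  (bel : forall i y, linear (fun k => be i k y))
  (beS : forall i j y, be i (hs j) y - cs j * be i (us j) y =
                       be j (hs i) y - cs i * be j (us i) y)
  (r0E : forall x t, `|x| < M -> forall i, al i (pol (us i0) (hs i0) x (r0, t)) = 0).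

Let u := cauchy_transform (cs i0) (us i0) (hs i0) r0 (al i0).
Let Du k := cauchy_transform (cs i0) (us i0) (hs i0) r0 (be i0 k).

Let alc i : continuous (al i).
Proof. by move=> y; apply: differentiable_continuous; have [] := alD i y. Qed.

Let Du_continuous k : continuous (Du k).
Proof. by apply: cauchy_transform_continuous. Qed.

Lemma transform_linear x : linear (fun k => Du k x).
Proof.
move=> a k l; rewrite /Du.
(* Written as a difference with a real multiple of 1, so that [cauchy_transformBM] applies. *)
have -> : be i0 (a *: k + l) = (fun y => be i0 l y - (- a)%:A * be i0 k y).
  by apply/funext => y; rewrite bel mulr_algl scaleNr opprK addrC.
rewrite (@cauchy_transformBM R L (cs i0) (gcs i0) X (us i0) (hs i0) r0 r00)//.
by rewrite mulr_algl scaleNr opprK addrC.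
Qed.

Lemma transform_derive x k : is_derive x k u (Du k x).
Proof.
by apply: (cauchy_transform_derive (gcs i0)) => // y; have [_] := alD i0 y; exact.
Qed.

Lemma transform_diff x : differentiable u x /\ forall k, 'd u x k = Du k x.
Proof.
pose DF x := HB.pack_for {linear X -> A} (fun k => Du k x)
  (GRing.isLinear.Build _ _ _ _ _ (@transform_linear x)).
have [||du dE] := @differentiable_of_continuous_derive R X A u DF x.
- by near=> y => k; exact: transform_derive.
- by move=> k; exact: (@Du_continuous k x).
by split=> // k; rewrite dE.
Unshelve. all: by end_near. Qed.

Lemma transform_C1 : C1_on setT u.
Proof.
move=> y _; have [du _] := transform_diff y; split=> // k.
have -> : (fun y => 'd u y k) = Du k by apply/funext => z; exact: (transform_diff z).2.
exact: Du_continuous.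
Qed.

Lemma al_C1 i : C1_on setT (al i).
Proof.
move=> y _; have [da dd] := alD i y; split=> // k.
have -> : (fun y => 'd (al i) y k) = be i k.
  apply/funext => z; have [dz ddz] := alD i z.
  exact: is_derive_unique (differentiable_is_derive k dz) (ddz k).
exact: bec.
Qed.

(** The transform inverts the operator of index i0 only. The operator of index j goes under the
    integral, [beS] exchanges it for that of index i0 acting on [al j], and Cauchy-Pompeiu returns
    [al j], its boundary term being 0 by [r0E]. *)
Lemma transform_dbar j x : `|x| < M ->
  'd u x (hs j) - cs j * 'd u x (us j) = al j x.
Proof.
move=> xM; have [_ dE] := transform_diff x.
rewrite (dE (hs j)) (dE (us j)) /Du.
rewrite -(@cauchy_transformBM R L (cs i0) (gcs i0) X (us i0) (hs i0) r0 r00)//.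
rewrite -(@cauchy_transform_dbar R L (cs i0) (gcs i0) X (us i0) (hs i0) r0 r00 (al j) x (@al_C1 j)).
  congr (cauchy_transform _ _ _ _ _ x); apply/funext => y; rewrite beS.
  have [dy ddy] := alD j y.
  by congr (_ - _ * _);
    exact: is_derive_unique (ddy _) (differentiable_is_derive _ dy).
by move=> t; exact: r0E.
Qed.

End Transform.

Theorem hartogs (Omega V : set X) (f : X -> A) :
  open Omega -> bounded_set Omega -> connected (boundary Omega) ->
  open V -> boundary Omega `<=` V -> boundary Omega !=set0 ->
  (forall i y, V y -> cauchy_riemann (us i) (hs i) (cs i) f y) ->
  exists (F : X -> A) (W : set X),
    [/\ open W, boundary Omega `<=` W, W `<=` V, forall y, W y -> F y = f y &
      forall i y, (Omega `|` W) y -> cauchy_riemann (us i) (hs i) (cs i) F y].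
Proof.
move=> oO bO cO oV bV [b0 b0b] fCR.
have intO : interior Omega = Omega by exact/interior_id.
have nbO y : boundary Omega y -> ~ Omega y.
  by move=> [_]; rewrite intO.
have [M M0 OM] : exists2 M : R, 0 < M & forall y, closure Omega y -> `|y| <= M.
  have [M [_ HM]] := bO; pose M1 := Num.max M 0 + 1.
  have M10 : 0 < M1 by rewrite ltr_wpDl// le_max lexx orbT.
  exists M1 => //; move=> y; rewrite leNgt => cy; apply/negP => My.
  have yM1 : 0 < `|y| - M1 by rewrite subr_gt0.
  have [z [Oz /= yz]] := cy _ (near_dist_lt y yM1).
  have zM1 : `|z| <= M1.
    by apply: (HM M1 _ z Oz); rewrite /M1 ltr_pwDr// le_max lexx.
  have := ler_distD z y 0; rewrite !subr0; lra.
have cptO : compact (closure Omega).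
  apply: fd_bounded_closed_compact; last exact: closed_closure.
  exists M; split=> [|t Mt y cy]; first exact: num_real.
  exact: le_trans (OM y cy) (ltW Mt).
(* The points of the closure where nothing is known of f; they are interior to Omega as V covers the
   boundary. *)
pose K := closure Omega `&` ~` V.
have cptK : compact K.
  apply: (subclosed_compact _ cptO); last by move=> y [].
  by apply: closedI; [exact: closed_closure | exact: open_closedC].
have KO : K `<=` Omega.
  move=> y [cy nVy]; apply: contrapT => nOy; apply/nVy/bV; split=> //.
  by rewrite intO.
have [xi [Y0 [Y1 [[D1 [D2 xiC2]] [oY0 oY1] [KY0 OY1] xi0 xi1]]]] := C2_cutoff cptK oO KO.
have C1 : C1_on V f by apply: (cauchy_riemann_C1 gcs coE oV fCR); exists i0.
have CR i y : V y -> 'd f y (hs i) = cs i * 'd f y (us i) by move=> /(fCR i)[].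
have cover y : V y \/ (Y0 y \/ Y1 y).
  have [Vy|nVy] := pselect (V y); [by left | right].
  have [cy|ncy] := pselect (closure Omega y); first by left; apply: KY0.
  by right; apply: OY1 => Oy; apply: ncy; exact: subset_closure.
pose al := source hs us cs D1 f; pose be := dsource hs us cs D1 D2 f.
have alO i y : ~ Omega y -> al i y = 0.
  move=> nOy; have Yy : Y0 y \/ Y1 y by right; apply: OY1.
  by have [] := nbhs_singleton (flat_near0 hs us cs xiC2 f oY0 oY1 xi0 xi1 Yy) i.
have alD i y := source_diff hs us cs xiC2 oY0 oY1 xi0 xi1 C1 cover i y.
have bec i k : continuous (be i k).
  exact: (dsource_continuous xiC2 oY0 oY1 xi0 xi1 C1 cover).
have bel i y := dsource_linear hs us cs xiC2 oY0 oY1 xi0 xi1 C1 cover i y.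
have beS i j y := dsource_swap cC xiC2 oY0 oY1 xi0 xi1 CR cover i j y.
have [mu mu0 Hmu] := plane_norm_lower ind.
(* Every circle of this radius around a point of norm less than M + 1 stays at norm larger than M,
   hence outside Omega. *)
pose r0 := (M + 1 + M + 1) / mu.
have r00 : 0 <= r0 by rewrite divr_ge0// ltW// !addr_gt0.
have r0E x t : `|x| < M + 1 -> forall i, al i (pol (us i0) (hs i0) x (r0, t)) = 0.
  move=> xM i; apply: alO => Oy; have := OM _ (subset_closure Oy).
  apply/negP; rewrite -ltNge /pol /=.
  have rm : M + 1 + M + 1 <= `|r0 *: (cos t *: us i0 + sin t *: hs i0)|.
    by rewrite normrZ ger0_norm// /r0 mulrAC ler_pdivlMr// ler_wpM2l// ltW// !addr_gt0.
  have := lerB_normD (r0 *: (cos t *: us i0 + sin t *: hs i0)) x.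
  lra.
pose u := cauchy_transform (cs i0) (us i0) (hs i0) r0 (al i0).
have uD j x : `|x| < M + 1 -> 'd u x (hs j) - cs j * 'd u x (us j) = al j x.
  exact: (transform_dbar r00 alD bec bel beS r0E).
have uC1 : C1_on setT u by exact: (transform_C1 r00 alD bec bel).
pose O1 := [set y : X | `|y| < M + 1].
have oO1 : open O1 by apply: (@open_sublevel R X (fun y => `|y|)); exact: norm_continuous.
have OO1 y : closure Omega y -> O1 y by move=> /OM yM; rewrite /O1 /=; lra.
(* Here xi is 1, the sources vanish and u solves the homogeneous equations, so that unique
   continuation applies. *)
pose G := Y1 `&` O1; have oG : open G by exact: openI.
have bG y : boundary Omega y -> G y.
  by move=> yb; split; [apply: OY1; exact: nbO | apply: OO1; case: yb].
have uCR i y : G y -> 'd u y (hs i) = cs i * 'd u y (us i).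
  move=> [Y1y O1y]; apply/eqP; rewrite -subr_eq0 uD//.
  by rewrite /al; have [-> _] := nbhs_singleton (flat_near0 hs us cs xiC2 f oY0 oY1 xi0 xi1 (or_intror Y1y)) i.
have uC1G : C1_on G u by move=> y _; exact: uC1.
pose C := [set y : X | \forall z \near y, u z = 0].
have oC : open C.
  by rewrite openE => y; exact: nbhs_interior.
have Cclosed y : boundary Omega y -> closure C y -> C y.
  move=> yb cy; apply: (vanish_near gcs coE oG uC1G uCR B0 coB (bG y yb)) => W nW.
  by have [z [Cz Wz]] := cy W nW; exists z.
have lamc : continuous lam by exact: fd_linear_continuous.
(* At a maximum x1 of [lam] on the closure, points a little further along w0 have a larger value of
   [lam]. Their planes directed by us i0 and hs i0, on which [lam] is constant, miss Omega, so the
   transform vanishes near them. *)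
have [x1 x1b Cx1] : exists2 x1, boundary Omega x1 & closure C x1.
  have [|x1 + x1m] := @compact_EVT_max X R lam (closure Omega) (ex_intro _ b0 (proj1 b0b)) cptO.
    exact: continuous_subspaceT.
  rewrite inE => cx1.
  have lam_lt y : closure Omega y -> lam y <= lam x1 by move=> cy; apply: x1m; rewrite inE.
  have line W : nbhs x1 W -> exists2 e : R, 0 < e & W (e *: w0 + x1).
    move=> nW.
    have cl : {for (0 : R), continuous (fun e : R => e *: w0 + x1)}.
      by apply: contD; [apply: contZ; [exact: cvg_id | exact: cont_cst] | exact: cont_cst].
    have nW0 : nbhs (0 *: w0 + x1) W by rewrite scale0r add0r.
    have /nbhs_ballP[d /= d0 dW] := cl _ nW0.
    have d2 : 0 < d / 2 by rewrite divr_gt0.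
    exists (d / 2) => //; apply: dW.
    by rewrite /ball /= sub0r normrN gtr0_norm// ltr_pdivrMr// ltr_pMr// ltr1n.
  exists x1.
    split=> // /line[e e0 Oe]; have := lam_lt _ (subset_closure Oe).
    by rewrite linearD linearZ /= gerDr leNgt mulr_gt0.
  move=> W /line[e e0 We]; exists (e *: w0 + x1); split=> //.
  have gt : lam x1 < lam (e *: w0 + x1) by rewrite linearD linearZ /= ltrDr mulr_gt0.
  have : nbhs (e *: w0 + x1) [set y | lam x1 < lam y].
    by apply: open_nbhs_nbhs; split=> //; exact: open_superlevel.
  apply: filterS => y /= yl; apply: (@cauchy_transform_eq0 R L (cs i0) X (us i0) (hs i0) r0 r00 (al i0) y) => s t _; apply: alO => /subset_closure /lam_lt.
  have -> : lam (pol (us i0) (hs i0) y (s, t)) = lam y.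
    rewrite /pol /= linearD linearZ linearD !linearZ lu lh.
    have key (p q z : R) : s * (p * 0 + q * 0) + z = z by rewrite !mulr0 addr0 mulr0 add0r.
    exact: key.
  by rewrite leNgt yl.
(* The trace of C on the boundary is nonempty, open, and closed by unique continuation. *)
have bC : boundary Omega `<=` C.
  have E : boundary Omega `&` C = boundary Omega.
    apply: cO.
    - by exists x1; split=> //; exact: Cclosed.
    - by exists C.
    - exists (closure C); first exact: closed_closure.
      apply/seteqP; split=> y [yb Cy]; split=> //; first exact: subset_closure.
      exact: Cclosed.
  by rewrite -E => y [].
pose W := (C `&` Y1) `&` (V `&` O1).
have oW : open W by apply: openI; exact: openI.
pose F y := xi y *: f y - u y.
have FW y : W y -> F y = f y.
  move=> [[Cy Y1y] _]; rewrite /F xi1// scale1r.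
  by rewrite (_ : u y = 0) ?subr0//; exact: (nbhs_singleton Cy).
exists F, W; split=> //.
- by move=> y yb; have [Y1y O1y] := bG y yb; split; split=> //; [exact: bC | exact: bV].
- by move=> y [_ []].
have [a1 a2 _ _ _] := xiC2.
have FV i y : V y -> O1 y -> cauchy_riemann (us i) (hs i) (cs i) F y.
  move=> Vy O1y; have [df dfE] := fCR i y Vy; have [du _] := uC1 y Logic.I.
  have dF : differentiable F y.
    by apply: differentiableB => //; apply: differentiable_scale => //; exact: a1.
  have FE k : 'd F y k = (D1 k y *: f y + xi y *: 'd f y k) - 'd u y k.
    apply: (is_derive_unique (differentiable_is_derive k dF)).
    apply: is_deriveB; last exact: differentiable_is_derive.
    exact: is_derive_scale (a2 k y) (differentiable_is_derive k df).
  split; first exact: dF.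
  apply: subr0_eq.
  have FEh := etrans (FE (hs i))
    (congr1 (fun b => D1 (hs i) y *: f y + xi y *: b - 'd u y (hs i)) dfE).
  refine (etrans (congr2 (fun a b => a - cs i * b) FEh (FE (us i))) _).
  have key (a b x : R) (c F0 fu uh uu : A) : uh - c * uu = (a *: 1 - b *: c) * F0 ->
      a *: F0 + x *: (c * fu) - uh - c * (b *: F0 + x *: fu - uu) = 0.
    move=> E; have -> : uh = c * uu + (a *: 1 - b *: c) * F0 by rewrite -E addrCA subrr addr0.
    by rewrite mulrBr mulrDr mulrBl -!scalerAr -!scalerAl mul1r; fd_ring.
  exact: key (uD i y O1y).
move=> i y [Oy|[_ [Vy O1y]]]; last exact: FV.
have [Vy|nVy] := pselect (V y); first by apply: FV => //; apply: OO1; exact: subset_closure.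
(* Outside V: xi is 0 near y, so F is - u there whatever f may be, and the sources vanish. *)
have Y0y : Y0 y by apply: KY0; split=> //; exact: subset_closure.
have O1y : O1 y by apply: OO1; exact: subset_closure.
have Fn : \forall z \near y, - u z = F z.
  apply: filterS (open_nbhs_nbhs (conj oY0 Y0y)) => z Y0z.
  by rewrite /F xi0// scale0r sub0r.
have [du _] := uC1 y Logic.I.
have [dF FE] := near_eq_differentiable Fn (differentiableN du).
split=> //; rewrite FE.
have dE k : 'd (fun z => - u z) y k = - 'd u y k.
  apply: (is_derive_unique (differentiable_is_derive k (differentiableN du))).
  exact: is_deriveN (differentiable_is_derive k du).
refine (etrans (dE _) (etrans _ (congr1 (fun a => cs i * a) (esym (dE _))))).
rewrite mulrN; congr (- _); apply/eqP; rewrite -subr_eq0 uD//.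
by rewrite /al; have [-> _] := nbhs_singleton (flat_near0 hs us cs xiC2 f oY0 oY1 xi0 xi1 (or_introl Y0y)) i.
Qed.

End Hartogs.

(** * Characters and generic directions *)

Section Characters.
Variables (R : realType) (L : falgType R).
Local Notation A := (fdnormed L).
Local Notation N := (fddim A).
Local Notation C := R[i].
Local Notation toC := (real_complex R).
Implicit Types (a b x : A).

Let row_coord x : 'rV[R]_N := \row_j fdc j x.
(** The matrices act on row vectors, so products are reversed in [mul_matrixM]. *)
Let mul_matrix a : 'M[R]_N := \matrix_(i, j) fdc j (a * fdbasis i : A).

Let row_coordM a x : row_coord (a * x) = row_coord x *m mul_matrix a.
Proof.
apply/rowP => j; rewrite !mxE [in LHS](fdc_sum x) mulr_sumr linear_sum.
by apply: eq_bigr => i _; rewrite -scalerAr linearZ !mxE.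
Qed.

Let mul_matrixM a b : mul_matrix (a * b) = mul_matrix b *m mul_matrix a.
Proof.
apply/matrixP => i j.
have -> : mul_matrix (a * b) i j = row_coord (a * (b * fdbasis i)) 0 j.
  by rewrite !mxE mulrA.
by rewrite row_coordM !mxE; apply: eq_bigr => k _; rewrite !mxE.
Qed.

Let mul_matrix1 : mul_matrix 1 = 1%:M.
Proof.
apply/matrixP => i j; rewrite !mxE mul1r.
have -> : fdbasis i = \sum_k (k == i)%:R *: fdbasis k :> A.
  rewrite (bigD1 i)//= eqxx scale1r big1 ?addr0// => k /negbTE ->.
  by rewrite scale0r.
by rewrite fdc_sumK eq_sym.
Qed.

Let mul_matrix_is_linear : linear mul_matrix.
Proof. by move=> k a b; apply/matrixP => i j; rewrite !mxE mulrDl -scalerAl linearP. Qed.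

HB.instance Definition _ := GRing.isLinear.Build R A 'M[R]_N *:%R mul_matrix mul_matrix_is_linear.

Let row_coord_inj x : row_coord x = 0 -> x = 0.
Proof.
move=> /rowP x0; apply: fd_ext => i; have := x0 i; rewrite !mxE => ->.
by rewrite linear0.
Qed.

Let emb (M : 'M[R]_N) : 'M[C]_N := map_mx toC M.

(* The diagonal entries of a simultaneous triangularization of the
   multiplication operators are the characters of the algebra spanned by
   commuting elements. *)
Lemma exists_characters (E : finType) (a : E -> A) :
  (forall d d', a d * a d' = a d' * a d) ->
  exists psi : 'I_N -> E -> C,
  [/\ forall v : E -> R, (forall i, complex.Im (\sum_d toC (v d) * psi i d) != 0) ->
        nonreal (\sum_d v d *: a d),
      forall D : pred E, \sum_(d | D d) a d ^+ 2 = 0 ->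
        forall i, \sum_(d | D d) psi i d ^+ 2 = 0
    & forall d, a d = 1 -> forall i, psi i d = 1].
Proof.
move=> comm; pose Ms := [seq emb (mul_matrix (a d)) | d <- enum E].
have Ms_comm : {in Ms &, forall M1 M2, comm_mx M1 M2}.
  move=> _ _ /mapP[d _ ->] /mapP[d' _ ->].
  by rewrite /comm_mx /emb -!map_mxM -!mul_matrixM comm.
have [P Pu /allP Ptrig] := cotrigonalization Ms_comm.
have Punit : P \in unitmx by exact: unitarymx_unit.
pose T x := P *m emb (mul_matrix x) *m invmx P.
have TE x : T x = conjmx P (emb (mul_matrix x)) by rewrite conjumx.
have trig d : is_trig_mx (T (a d)).
  by rewrite TE; apply: Ptrig; apply: map_f; rewrite mem_enum.
have T_lt0 d (i j : 'I_N) : (i < j)%N -> T (a d) i j = 0.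
  by move=> ij; move/is_trig_mxP: (trig d) => /(_ i j ij).
have TM x y : T (x * y) = T y *m T x.
  by rewrite /T mul_matrixM /emb map_mxM !mulmxA mulmxKV.
have T1 : T 1 = 1%:M by rewrite /T mul_matrix1 /emb map_mx1 mulmx1 mulmxV.
have TZ (k : R) x : T (k *: x) = toC k *: T x.
  by rewrite /T linearZ /emb map_mxZ -scalemxAr -scalemxAl.
have TD x y : T (x + y) = T x + T y by rewrite /T linearD /emb map_mxD mulmxDr mulmxDl.
have Tsum (D : pred E) (v : E -> R) (b : E -> A) :
    T (\sum_(d | D d) v d *: b d) = \sum_(d | D d) toC (v d) *: T (b d).
  rewrite /T linear_sum /emb map_mx_sum mulmx_sumr mulmx_suml.
  by apply: eq_bigr => d _; exact: TZ.
exists (fun i d => T (a d) i i); split.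
- move=> v Im0 s t st; apply: unit_of_mul_injective => x.
  pose c := \sum_d v d *: a d; rewrite -/c => xE.
  apply/eqP; apply: contraTT st => x0.
  have TE' i j : T (s *: 1 + t *: c) i j =
      toC s * (i == j)%:R + toC t * \sum_d toC (v d) * T (a d) i j.
    rewrite TD !TZ T1 (Tsum xpredT v a) !mxE summxE; congr (_ + _ * _).
    by apply: eq_bigr => d _; rewrite mxE.
  (* A zero divisor has a singular triangular matrix, hence a zero diagonal entry s + t z, where z
     has nonzero imaginary part; so t = 0, then s = 0. *)
  have : \det (T (s *: 1 + t *: c)) == 0.
    rewrite !det_mulmx /emb det_map_mx (_ : \det (mul_matrix _) = 0) ?rmorph0 ?mulr0 ?mul0r//.
    apply/eqP/det0P; exists (row_coord x); last by rewrite -row_coordM xE; apply/rowP => j; rewrite !mxE linear0.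
    by apply: contraNneq x0 => /row_coord_inj ->.
  rewrite det_trig; last first.
    apply/is_trig_mxP => i j ij; rewrite TE' (_ : i == j = false) ?mulr0 ?add0r.
      rewrite big1 ?mulr0// => d _.
      by rewrite T_lt0 ?mulr0.
    by apply/negbTE; apply: contraTneq ij => ->; rewrite ltnn.
  move=> /prodf_eq0[i _]; rewrite TE' eqxx mulr1; have := Im0 i.
  case: (\sum_d _) => re im /= im0; rewrite eq_complex /= => /andP[/eqP re1 /eqP im1].
  have t0 : t = 0.
    by apply/eqP; move: im1; rewrite !mul0r addr0 add0r => /eqP; rewrite mulf_eq0 (negbTE im0) orbF.
  by move: re1; rewrite t0 !mul0r subr0 addr0 => ->; rewrite eqxx.
- move=> D D0 i.
  have : T (\sum_(d | D d) a d ^+ 2) = 0 by rewrite D0 /T linear0 /emb map_mx0 mulmx0 mul0mx.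
  have -> : \sum_(d | D d) a d ^+ 2 = \sum_(d | D d) 1 *: a d ^+ 2.
    by apply: eq_bigr => d _; rewrite scale1r.
  rewrite Tsum => /matrixP/(_ i i); rewrite summxE mxE; apply: etrans.
  (* The diagonal of the square of a triangular matrix consists of the squares of its diagonal
     entries. *)
  apply: eq_bigr => d _; rewrite [RHS]mxE rmorph1 mul1r !expr2 TM.
  move: (T (a d)) (T_lt0 d) => M M0; rewrite mxE (bigD1 i)//= big1 ?addr0// => j ji.
  have [ij|ij] := ltnP i j; first by rewrite M0 ?mul0r.
  by rewrite mulrC M0 ?mul0r// ltn_neqAle ji.
- by move=> d -> i; rewrite T1 mxE eqxx.
Qed.

End Characters.

Section GenericDirections.
Variables (R : realType).

(** The integers below [size p] are too many to be all roots. *)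
Lemma poly_nonroot (p : {poly R}) : p != 0 -> exists x, p.[x] != 0.
Proof.
move=> p0; apply: contrapT => nex.
suff : (size [seq k%:R : R | k <- iota 0 (size p)] < size p)%N by rewrite size_map size_iota ltnn.
apply: max_poly_roots => //.
- by apply/allP => x _; apply/negPn/negP => px; apply: nex; exists x.
- by rewrite map_inj_uniq ?iota_uniq//; exact: mulrIn (oner_neq0 R).
Qed.

Lemma avoid_zeros (J : finType) (al be : J -> R) :
  (forall i, (al i != 0) || (be i != 0)) -> exists x, forall i, al i + x * be i != 0.
Proof.
move=> ab; have [|x xP] := @poly_nonroot (\prod_i ((al i)%:P + be i *: 'X)).
  rewrite prodf_seq_neq0; apply/allP => i _ /=; apply: contraT; rewrite negbK => /eqP E.
  have := ab i.
  have e0 : ((al i)%:P + be i *: 'X)`_0 = al i by rewrite coefD coefC coefZ coefX mulr0 addr0.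
  have e1 : ((al i)%:P + be i *: 'X)`_1 = be i by rewrite coefD coefC coefZ coefX mulr1 add0r.
  by move: e0 e1; rewrite E !coef0 => <- <-; rewrite eqxx.
exists x => i; move: xP; rewrite horner_prod prodf_seq_neq0 => /allP/(_ i).
by rewrite mem_index_enum /= => /(_ isT); rewrite hornerD hornerC hornerZ hornerX mulrC.
Qed.

(** The coefficients are powers x^(rank d) on D: each condition on x then says that x is not a root
    of a nonzero polynomial, and one x avoids the roots of their product. *)
Lemma generic_combination (J E : finType) (phi : J -> E -> R) (D : pred E) :
  (forall j, exists2 d, D d & phi j d != 0) ->
  exists2 v : E -> R, forall d, ~~ D d -> v d = 0 & forall j, \sum_d v d * phi j d != 0.
Proof.
move=> H; pose p j : {poly R} := \sum_(d | D d) phi j d *: 'X^(enum_rank d).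
have [|x xP] := @poly_nonroot (\prod_j p j).
  rewrite prodf_seq_neq0; apply/allP => j _ /=; have [d Dd pd] := H j.
  apply: contraNneq pd => /(congr1 (fun q : {poly R} => q`_(enum_rank d))).
  rewrite coef0 /p coef_sum (bigD1 d)//= coefZ coefXn eqxx mulr1 big1 ?addr0 => [->//|d' /andP[_ dd']].
  rewrite coefZ coefXn (_ : (_ == _) = false) ?mulr0//.
  by apply/negbTE; apply: contraNneq dd' => /val_inj/enum_rank_inj ->.
exists (fun d => if D d then x ^+ enum_rank d else 0) => [d /negbTE ->//|j].
move: xP; rewrite horner_prod prodf_seq_neq0 => /allP/(_ j).
rewrite mem_index_enum /= => /(_ isT); rewrite /p horner_sum big_mkcond /=.
by congr (_ != 0); apply: eq_bigr => d _; case: (D d); rewrite ?mul0r// hornerZ hornerXn mulrC.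
Qed.

Variables (L : falgType R).
Local Notation A := (fdnormed L).
Local Notation C := R[i].
Local Notation toC := (real_complex R).

Lemma Im_sum (J : finType) (v : J -> R) (z : J -> C) :
  complex.Im (\sum_d toC (v d) * z d) = \sum_d v d * complex.Im (z d).
Proof.
elim/big_rec2: _ => // d y1 y2 _ <-.
by case: (z d) y2 => re im [re2 im2] /=; rewrite mul0r addr0.
Qed.

(** The groups are the fibres of [ld]. One vector [v] serves a whole group, while [n] depends on the
    element. *)
Lemma good_directions (E : finType) (a : E -> A) (ld : E -> E) :
  (forall d d', a d * a d' = a d' * a d) ->
  (forall d, ld (ld d) = ld d) -> (forall d, a (ld d) = 1) ->
  (forall d, \sum_(d' | ld d' == ld d) a d' ^+ 2 = 0) ->
  exists (v : E -> E -> R) (n : E -> R), forall d,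
    [/\ forall d', ld d' != ld d -> v (ld d) d' = 0,
        nonreal (\sum_d' v (ld d) d' *: a d') &
        nonreal (a d + n d *: \sum_d' v (ld d) d' *: a d')].
Proof.
move=> comm ldK a1 sq; have [psi [Hreal Hsq H1]] := exists_characters comm.
pose phi i d := complex.Im (psi i d).
have Hgood (v : E -> R) : (forall i, \sum_d v d * phi i d != 0) -> nonreal (\sum_d v d *: a d).
  by move=> Hv; apply: Hreal => i; rewrite Im_sum; exact: Hv.
have [v Hv] : {v : E -> E -> R & forall d, (forall d', ld d' != ld d -> v d d' = 0) /\
    forall i, \sum_d' v d d' * phi i d' != 0}.
  apply: (@choice E (E -> R) (fun d v => (forall d', ld d' != ld d -> v d' = 0) /\
    forall i, \sum_d' v d' * phi i d' != 0)) => d.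
  have [|v v1 v2] := @generic_combination _ E phi (fun d' => ld d' == ld d); last by exists v.
  (* If all values of the group in this character were real, their squares could not add up to 0, as
     the leader contributes 1. *)
  move=> i; apply: contrapT => nex.
  have im0 d' : ld d' == ld d -> psi i d' = toC (complex.Re (psi i d')).
    move=> gd; have : phi i d' = 0.
      by apply/eqP; apply: contrapT => /negP pd; apply: nex; exists d'.
    by rewrite /phi; case: (psi i d') => re im /= ->.
  have : \sum_(d' | ld d' == ld d) complex.Re (psi i d') ^+ 2 = 0.
    have := Hsq (fun d' => ld d' == ld d) (sq d) i.
    rewrite (eq_bigr (fun d' => toC (complex.Re (psi i d') ^+ 2))); last first.
      by move=> d' gd; rewrite [in LHS](im0 d' gd) rmorphXn.
    by rewrite -rmorph_sum => /(congr1 (@complex.Re R)).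
  rewrite (bigD1 (ld d)) ?ldK//= (H1 (ld d) (a1 d)) /= expr1n => /eqP.
  by rewrite gt_eqF// ltr_pwDl// sumr_ge0// => d' _; exact: sqr_ge0.
have [n Hn] : {n : E -> R & forall d i, phi i d + n d * \sum_d' v (ld d) d' * phi i d' != 0}.
  apply: (@choice E R (fun d n => forall i, phi i d + n * \sum_d' v (ld d) d' * phi i d' != 0)) => d.
  apply: avoid_zeros => i; apply/orP; right.
  by have [_] := Hv (ld d); exact.
exists v, n => d; have [Hv1 Hv2] := Hv (ld d); split.
- by move=> d' dd'; apply: Hv1; rewrite ldK.
- exact: Hgood.
have -> : a d + n d *: (\sum_d' v (ld d) d' *: a d') =
    \sum_d' ((d' == d)%:R + n d * v (ld d) d') *: a d'.
  under [RHS]eq_bigr => d' _ do rewrite scalerDl -scalerA.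
  rewrite big_split /= -scaler_sumr; congr (_ + _).
  rewrite (bigD1 d)//= eqxx scale1r big1 ?addr0// => d' /negbTE ->.
  by rewrite scale0r.
apply: Hgood => i.
under eq_bigr => d' _ do rewrite mulrDl -mulrA.
rewrite big_split /= -mulr_sumr (bigD1 d)//= eqxx mul1r big1 ?addr0 => [|d' /negbTE ->]; first exact: Hn.
by rewrite mul0r.
Qed.

End GenericDirections.

Section HartogsCoordinates.
Variables (R : realType) (L : falgType R).
Local Notation A := (fdnormed L).
Variables (X : fdModType R) (E : finType) (dir : E -> X) (crd : E -> {linear X -> R}).
Variables (cf : E -> A) (ld : E -> E).
Hypotheses (crdE : forall x, x = \sum_d crd d x *: dir d)
  (crd_dir : forall d d', crd d (dir d') = (d == d')%:R)
  (cfC : forall d (b : A), b * cf d = cf d * b)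
  (ldK : forall d, ld (ld d) = ld d) (cf1 : forall d, cf (ld d) = 1)
  (cf_sq : forall d, \sum_(d' | ld d' == ld d) cf d' ^+ 2 = 0)
  (card_E : #|E| != 2%N).

Definition cr_system (f : X -> A) y :=
  differentiable f y /\ forall d, 'd f y (dir d) = cf d * 'd f y (dir (ld d)).

Lemma crdZ d (k : R) x : crd d (k *: x) = k * crd d x.
Proof. exact: linearZ. Qed.

Lemma crd_sum (v : E -> R) d : crd d (\sum_d' v d' *: dir d') = v d.
Proof.
rewrite linear_sum (bigD1 d)//= crdZ crd_dir eqxx big1 => [|d' d'd].
  by rewrite addr0 mulr1.
by rewrite crdZ crd_dir eq_sym (negbTE d'd) mulr0.
Qed.

Theorem hartogs_coordinates (Omega V : set X) (f : X -> A) :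
  open Omega -> bounded_set Omega -> connected (boundary Omega) ->
  open V -> boundary Omega `<=` V -> (forall y, V y -> cr_system f y) ->
  exists (F : X -> A) (W : set X),
    [/\ open W, boundary Omega `<=` W, W `<=` V, forall y, W y -> F y = f y &
      forall y, (Omega `|` W) y -> cr_system F y].
Proof.
move=> oO bO cO oV bV fCR.
(* For an empty boundary there is nothing to match: W is empty and F is 0. *)
have [[b0 b0b]|nb] := pselect (boundary Omega !=set0); last first.
  exists (fun=> 0), set0; split => //.
  - exact: open0.
  - by move=> y yb; case: nb; exists y.
  move=> y _; split=> [|d]; first exact: differentiable_cst.
  have d0 k : 'd (fun _ : X => 0 : A) y k = 0 by rewrite (diff_cst (0 : A) y).
  by rewrite !d0 mulr0.
(* Without coordinates the space is a point, where no set has a boundary. *)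
have [d0 _] : exists d : E, True.
  apply: contrapT => nE; case: b0b => cb; apply.
  have all0 (x : X) : x = 0.
    by rewrite (crdE x) big1// => d; case: nE; exists d.
  have [z [Oz _]] := cb setT (filterT).
  by apply: open_nbhs_nbhs; split=> //; rewrite (all0 b0) -(all0 z).
have comm d d' : cf d * cf d' = cf d' * cf d by exact: cfC.
have [v [n Hvn]] := good_directions comm ldK cf1 cf_sq.
(* The coefficient [n d] makes [cf d + n d *: K] nonreal, so that each [dir d] is
   the difference of two vectors attached to nonreal coefficients. *)
pose H g : X := \sum_d v g d *: dir d; pose K g : A := \sum_d v g d *: cf d.
pose us (i : E * bool) := dir (ld i.1).
pose hs (i : E * bool) := if i.2 then dir i.1 + n i.1 *: H (ld i.1) else H (ld i.1).
pose cs (i : E * bool) := if i.2 then cf i.1 + n i.1 *: K (ld i.1) else K (ld i.1).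
pose co (i : E * bool) x := if i.2 then crd i.1 x else - (n i.1 * crd i.1 x).
have gcs i : nonreal (cs i) by case: i => d [] /=; have [] := Hvn d.
have KC g (b : A) : b * K g = K g * b.
  rewrite /K mulr_sumr mulr_suml; apply: eq_bigr => d _.
  by rewrite -scalerAr -scalerAl cfC.
have csC i (b : A) : b * cs i = cs i * b.
  by case: i => d []; rewrite /cs /= ?mulrDr ?mulrDl -?scalerAr -?scalerAl KC// cfC.
have coE x : x = \sum_i co i x *: hs i.
  have -> : \sum_i co i x *: hs i = \sum_d \sum_b co (d, b) x *: hs (d, b).
    by rewrite pair_bigA; apply: eq_bigr => -[].
  rewrite {1}(crdE x); apply: eq_bigr => d _.
  by rewrite big_bool /co /hs /= scalerDr scalerA mulrC scaleNr addrK.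
have [B B0 coB] : exists2 B : R, 0 < B & forall i x, `|co i x| <= B * `|x|.
  have [|M HM] := @choice E R (fun d M => 0 <= M /\ forall x, `|crd d x| <= M * `|x|).
    by move=> d; have [M M0 HM] := fd_linear_bounded (crd d); exists M; split=> // ; rewrite ltW.
  have M0 d : 0 <= M d by have [] := HM d.
  pose S := \sum_d M d * (1 + `|n d|).
  have S0 d : M d * (1 + `|n d|) <= S.
    rewrite /S (bigD1 d)//= lerDl sumr_ge0// => d' _.
    by rewrite mulr_ge0// addr_ge0.
  exists (1 + S) => [|[d b] x].
    by rewrite ltr_pwDl// (le_trans _ (S0 d0))// mulr_ge0// addr_ge0.
  have [_ /(_ x) Hx] := HM d.
  have Sx : M d * (1 + `|n d|) * `|x| <= (1 + S) * `|x|.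
    by rewrite ler_wpM2r// (le_trans (S0 d))// lerDr.
  apply: le_trans Sx.
  have Mx : 0 <= M d * `|x| by rewrite mulr_ge0.
  have nx := ler_wpM2l (normr_ge0 (n d)) Hx.
  have nM : 0 <= `|n d| * (M d * `|x|) by rewrite mulr_ge0.
  rewrite mulrDr mulr1 mulrDl -mulrA (mulrCA (M d)).
  by case: b; rewrite /co /= ?normrN ?normrM; lra.
have crH (g : X -> A) y d : cr_system g y -> 'd g y (H (ld d)) = K (ld d) * 'd g y (dir (ld d)).
  move=> [dg gE]; have [vg _ _] := Hvn d.
  rewrite /H /K linear_sum mulr_suml; apply: eq_bigr => d' _.
  have [E1|/vg ->] := eqVneq (ld d') (ld d); last by rewrite !scale0r mul0r linear0.
  by rewrite linearZ -scalerAl -E1; congr (_ *: _); exact: gE.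
have cr_to (g : X -> A) y : cr_system g y -> forall i, cauchy_riemann (us i) (hs i) (cs i) g y.
  move=> gcr [d b]; have [dg gE] := gcr; split=> //; have gH := crH g y d gcr.
  case: b; rewrite /hs /cs /us /=; last exact: gH.
  refine (etrans (linearD _ _ _) (etrans (congr2 +%R (gE d) (etrans (linearZ _ _) (congr1 _ gH))) _)).
  by rewrite mulrDl -scalerAl.
have cr_from (g : X -> A) y : (forall i, cauchy_riemann (us i) (hs i) (cs i) g y) -> cr_system g y.
  move=> gcr; split=> [|d]; first by have [] := gcr (d0, true).
  have [_ E1] := gcr (d, true); have [_ E2] := gcr (d, false).
  move: E1 E2; rewrite /hs /cs /us /= linearD linearZ => E1 E2.
  have := E1; rewrite E2 mulrDl -scalerAl; exact: addIr.
pose g0 := ld d0.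
have g0K : ld g0 = g0 by exact: ldK.
(* Otherwise [K g0] would be a real multiple of 1. *)
have [d1 d1g vd1] : exists2 d1, d1 != g0 & v g0 d1 != 0.
  apply: contrapT => nex; have [_ nrK _] := Hvn d0.
  have KE : K g0 = v g0 g0 *: 1.
    rewrite /K (bigD1 g0)//= -{3}g0K cf1 big1 ?addr0// => d dg.
    have [->|vd] := eqVneq (v g0 d) 0; first by rewrite scale0r.
    by case: nex; exists d.
  have := nrK (- v g0 g0) 1; rewrite oner_neq0 orbT => /(_ isT).
  by rewrite -/(K g0) KE scale1r scaleNr addNr unitr0.
(* As g0 and d1 are distinct and the dimension is not 2, there is a third coordinate. *)
have [d2 d2g d21] : exists2 d2, d2 != g0 & d2 != d1.
  apply: contrapT => nex; move/negP: card_E; apply; apply/eqP.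
  have d1g' : g0 != d1 by rewrite eq_sym.
  have := cards2 g0 d1; rewrite d1g' => <-; rewrite -cardsT; apply: eq_card => d.
  rewrite !inE; apply/esym; apply: contraT; rewrite negb_or => /andP[dg dd1].
  by case: nex; exists d.
(* Vanishes on dir g0, since d1 and d2 differ from g0, and on H g0, whose coordinates are v g0 d1
   and v g0 d2. *)
pose lamf x := v g0 d1 * crd d2 x - v g0 d2 * crd d1 x.
have lam_lin : linear lamf.
  move=> k x y; suff : lamf (k *: x + y) = k * lamf x + lamf y by [].
  have crdD d : crd d (k *: x + y) = k * crd d x + crd d y by rewrite linearD crdZ.
  by rewrite /lamf !crdD; ring.
pose lam := HB.pack_for {linear X -> R} lamf (GRing.isLinear.Build _ _ _ _ _ lam_lin).
have crH' d : crd d (H g0) = v g0 d by exact: crd_sum.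
have lu : lam (us (d0, false)) = 0.
  by rewrite /= /lamf /us /= !crd_dir (negbTE d2g) (negbTE d1g) !mulr0 subrr.
have lh : lam (hs (d0, false)) = 0.
  by rewrite /= /lamf /hs /= !crH' mulrC subrr.
have lw : 0 < lam (v g0 d1 *: dir d2).
  rewrite /= /lamf !crdZ !crd_dir eqxx eq_sym (negbTE d21).
  by rewrite mulr1 !mulr0 subr0 -expr2 exprn_even_gt0.
have ind (s t : R) : s *: us (d0, false) + t *: hs (d0, false) = 0 -> s = 0 /\ t = 0.
  rewrite /us /hs /= -/g0 => st.
  have t0 : t = 0.
    have := congr1 (crd d1) st; rewrite linearD !crdZ crH' crd_dir (negbTE d1g).
    by rewrite !linear0 ?mulr0 add0r => /eqP; rewrite mulf_eq0 (negbTE vd1) orbF => /eqP.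
  split=> //; have := congr1 (crd g0) st; rewrite t0 scale0r addr0 crdZ crd_dir eqxx.
  by rewrite mulr1 !linear0.
have [F [W [oW bW WV FW FCR]]] := hartogs gcs csC coE B0 coB lu lh lw ind
  oO bO cO oV bV (ex_intro _ b0 b0b) (fun i y Vy => cr_to f y (fCR y Vy) i).
exists F, W; split=> // y OWy; apply: cr_from => i; exact: FCR.
Qed.

End HartogsCoordinates.

(** * The operator d'' in coordinates *)

Section Translation.
Variables (R : realType) (L : falgType R) (L0 L1 : {vspace L}).
Variables (p : nat) (e : p.+1.-tuple L).
Variables (q : nat) (eps : q.-tuple L) (r : nat) (s : nat -> nat) (a : q.-tuple L).
Variables (n m : nat).
Hypotheses (hL : is_csa L0 L1) (hA0 : condA0 L0 e) (hA1 : condA1 L0 L1 eps r s a).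
Local Notation X := (superspace L0 L1 n m).

HB.instance Definition _ := FdModule.on X.

Lemma block_start_le b b' : (b <= b')%N -> (b' <= r)%N -> (s b <= s b')%N.
Proof.
move=> bb'; rewrite -(subnK bb'); elim: (b' - b)%N => [|k IH]//.
rewrite addSn => kr; apply: leq_trans (IH (ltnW kr)) _.
by apply: ltnW; exact: (A1_incr hA1).
Qed.

Lemma block_unique b b' k : (b < r)%N -> (b' < r)%N ->
  (s b <= k < s b.+1)%N -> (s b' <= k < s b'.+1)%N -> b = b'.
Proof.
move=> br b'r /andP[h1 h2] /andP[h3 h4]; have [lt|lt|//] := ltngtP b b'.
  by have := leq_trans (leq_trans h2 (block_start_le lt (ltnW b'r))) h3; rewrite ltnn.
by have := leq_trans (leq_trans h4 (block_start_le lt (ltnW br))) h1; rewrite ltnn.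
Qed.

Lemma block_exists k : (k < q)%N -> exists2 b, (b < r)%N & (s b <= k < s b.+1)%N.
Proof.
rewrite -(A1_last hA1) => kr; have ex : exists b, (k < s b)%N by exists r.
case: (ex_minnP ex) => -[|b] kb bmin; first by rewrite (A1_first hA1) in kb.
have br : (b < r)%N by exact: bmin.
exists b => //; rewrite kb andbT leqNgt; apply/negP => /bmin.
by rewrite ltnn.
Qed.

(** Gives, as a function on indices, the first index of the block, the one whose derivative appears
    on the right in the equations. *)
Lemma block_leader : exists ld : 'I_q -> 'I_q, forall k : 'I_q, exists b,
  [/\ (b < r)%N, (s b <= k < s b.+1)%N & ld k = s b :> nat].
Proof.
have [|ld Hld] := @choice 'I_q 'I_q (fun k l => exists b, [/\ (b < r)%N, (s b <= k < s b.+1)%N & l = s b :> nat]).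
  move=> k; have [b br kb] := block_exists (ltn_ord k).
  have sq : (s b < q)%N by case/andP: kb => sk _; exact: leq_ltn_trans sk (ltn_ord k).
  by exists (Ordinal sq), b.
by exists ld.
Qed.

Section Leader.
Variable ldt : 'I_q -> 'I_q.
Hypothesis ldtP : forall k : 'I_q, exists b, [/\ (b < r)%N, (s b <= k < s b.+1)%N & ldt k = s b :> nat].

Let E : finType := ('I_n * 'I_p.+1 + 'I_m * 'I_q)%type.
Definition basis_dir (d : E) : X :=
  match d with inl (i, j) => ydir L0 L1 m i e`_j | inr (l, k) => tdir L0 L1 n l eps`_k end.
Definition basis_coord (d : E) (x : X) : R :=
  match d with inl (i, j) => ycoord e i j x | inr (l, k) => tcoord eps l k x end.
Definition basis_coef (d : E) : fdnormed L :=
  match d with inl (i, j) => e`_j | inr (l, k) => a`_k end.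
Definition leader (d : E) : E :=
  match d with inl (i, j) => inl (i, ord0) | inr (l, k) => inr (l, ldt k) end.

Lemma basis_coord_is_linear d : linear (basis_coord d).
Proof.
move=> k x y; case: d => -[i j] /=.
  by rewrite /ycoord /= ffunE ffunE !linearP.
by rewrite /tcoord /= ffunE ffunE !linearP.
Qed.

Lemma same_block (k k' : 'I_q) b : (b < r)%N -> (s b <= k < s b.+1)%N -> 
  (ldt k' == ldt k) = (s b <= k' < s b.+1)%N.
Proof.
move=> br kb; have [b1 [b1r kb1 E1]] := ldtP k; have [b2 [b2r kb2 E2]] := ldtP k'.
have bb1 := block_unique b1r br kb1 kb; rewrite {}bb1 in E1 kb1 b1r *.
apply/idP/idP => [/eqP EE|kb'].
  suff -> : b = b2 by [].
  apply: (@block_unique b b2 (s b)) => //.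
    by rewrite leqnn (A1_incr hA1).
  have : ldt k = ldt k' :> nat by rewrite EE.
  by rewrite E1 E2 => ->; rewrite leqnn (A1_incr hA1).
have := block_unique b2r br kb2 kb' => bb2.
by apply/eqP/val_inj; rewrite /= E1 E2 bb2.
Qed.

Lemma ldtK (k : 'I_q) : ldt (ldt k) = ldt k.
Proof.
have [b [br kb E1]] := ldtP k; apply/eqP; rewrite (same_block _ br kb) E1.
by rewrite leqnn (A1_incr hA1).
Qed.

Lemma leaderK d : leader (leader d) = leader d.
Proof. by case: d => -[i j] //=; rewrite ldtK. Qed.

Lemma leader_coef d : basis_coef (leader d) = 1.
Proof.
case: d => -[i j] /=; first by have [_ -> _] := hA0.
by have [b [br kb ->]] := ldtP j; exact: (A1_unit hA1).
Qed.

(** The fibres of [leader] are the even coordinates of one y_i, where this is condition (A_0), and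
    one block of one theta_l, where it is condition (A_1). *)
Lemma leader_sq d : \sum_(d' | leader d' == leader d) basis_coef d' ^+ 2 = 0.
Proof.
rewrite big_sumType /=; case: d => -[i j] /=.
  rewrite [X in _ + X]big_pred0 ?addr0; last by case.
  have [_ _ sq] := hA0; rewrite -[RHS]sq.
  transitivity (\sum_(i' | i' == i) \sum_(j' < p.+1) (e`_j' : fdnormed L) ^+ 2).
    by rewrite pair_big_dep; apply: eq_big => [[i' j']|[i' j'] _] //=; rewrite andbT.
  by rewrite big_pred1_eq.
rewrite [X in X + _]big_pred0 ?add0r; last by case.
have [b [br jb E1]] := ldtP j; rewrite -[RHS](A1_squares hA1 br).
transitivity (\sum_(i' | i' == i) \sum_(j' < q | ldt j' == ldt j) (a`_j' : fdnormed L) ^+ 2).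
  by rewrite pair_big_dep; apply: eq_big => [[i' j']|[i' j'] _] //=.
rewrite big_pred1_eq.
have sq : (s b.+1 <= q)%N by rewrite -(A1_last hA1); exact: block_start_le.
rewrite (big_nat_widen _ _ _ _ _ sq) (big_nat_widenl _ 0)// big_mkord.
by apply: eq_bigl => k /=; rewrite (same_block _ br jb) andbC.
Qed.

Lemma card_basis : #|E| = (n * p.+1 + m * q)%N.
Proof. by rewrite card_sum !card_prod !card_ord. Qed.

Lemma basis_coef_central d (b : fdnormed L) : b * basis_coef d = basis_coef d * b.
Proof.
apply/esym; case: d => -[i j]; apply: (csa_comm hL).
  by have [eb _ _] := hA0; apply: (basis_mem eb); rewrite mem_nth// size_tuple.
exact: (A1_even hA1).
Qed.

Let free_e : free e. Proof. by have [eb _ _] := hA0; exact: basis_free eb. Qed.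
Let free_eps : free eps. Proof. exact: basis_free (A1_basis hA1). Qed.

Let e_mem (j : 'I_p.+1) : e`_j \in L0.
Proof. by have [eb _ _] := hA0; apply: (basis_mem eb); rewrite mem_nth// size_tuple. Qed.

Let eps_mem (k : 'I_q) : eps`_k \in L1.
Proof. by apply: (basis_mem (A1_basis hA1)); rewrite mem_nth// size_tuple. Qed.

Lemma basis_coord_dir d d' : basis_coord d (basis_dir d') = (d == d')%:R.
Proof.
case: d d' => -[i j] [] [i' j'] /=.
- rewrite /ycoord /= ffunE (_ : (inl _ == inl _) = (i == i') && (j == j'))//.
  case: (eqVneq i i') => [_|_]; last by rewrite !linear0.
  by rewrite (vsprojK (e_mem j')) coord_free// eq_sym.
- by rewrite /ycoord /= ffunE !linear0.
- by rewrite /tcoord /= ffunE !linear0.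
- rewrite /tcoord /= ffunE (_ : (inr _ == inr _) = (i == i') && (j == j'))//.
  case: (eqVneq i i') => [_|_]; last by rewrite !linear0.
  by rewrite (vsprojK (eps_mem j')) coord_free// eq_sym.
Qed.

Lemma basis_coord_inj (x y : X) : (forall d, basis_coord d x = basis_coord d y) -> x = y.
Proof.
case: x y => [y1 t1] [y2 t2] xy; have [eb _ _] := hA0.
congr (_, _); apply/ffunP => i; apply: val_inj => /=.
  rewrite (coord_basis eb (subvsP (y1 i))) (coord_basis eb (subvsP (y2 i))).
  by apply: eq_bigr => j _; congr (_ *: _); exact: (xy (inl (i, j))).
rewrite (coord_basis (A1_basis hA1) (subvsP (t1 i))) (coord_basis (A1_basis hA1) (subvsP (t2 i))).
by apply: eq_bigr => j _; congr (_ *: _); exact: (xy (inr (i, j))).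
Qed.

HB.instance Definition _ d := GRing.isLinear.Build R X R _ (basis_coord d) (basis_coord_is_linear d).

Lemma basis_sum (x : X) : x = \sum_d basis_coord d x *: basis_dir d.
Proof.
apply: basis_coord_inj => d; rewrite linear_sum (bigD1 d)//= big1 => [|d' dd'].
  have E0 : basis_coord d (basis_coord d x *: basis_dir d) = basis_coord d x * basis_coord d (basis_dir d).
    exact: linearZ.
  by rewrite E0 basis_coord_dir eqxx mulr1 addr0.
have E0 : basis_coord d (basis_coord d' x *: basis_dir d') = basis_coord d' x * basis_coord d (basis_dir d').
  exact: linearZ.
by rewrite E0 basis_coord_dir eq_sym (negbTE dd') mulr0.
Qed.

(** The sum may run over all coordinates, without the exclusions of d'': at a leader the coefficient
    is 1 and the term is 0. *)
Lemma dbarE (F : X -> fdnormed L) x h : differentiable F x ->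
  dbar e eps r s a F x h = \sum_d basis_coord d h *:
    ('d F x (basis_dir d) - basis_coef d * 'd F x (basis_dir (leader d)) : L).
Proof.
move=> dF; rewrite /dbar.
pose G (d : E) : L := basis_coord d h *:
  ('d F x (basis_dir d) - basis_coef d * 'd F x (basis_dir (leader d)) : L).
transitivity (\sum_i \sum_j G (inl (i, j)) + \sum_l \sum_k G (inr (l, k))); last first.
  by rewrite big_sumType; congr (_ + _); rewrite pair_bigA; apply: eq_bigr => -[].
have dyE i j : dy e F i j x = 'd F x (ydir L0 L1 m i e`_j) by rewrite /dy deriveE.
have dtE l k : dt eps F l k x = 'd F x (tdir L0 L1 n l eps`_k) by rewrite /dt deriveE.
have [_ e0 _] := hA0; congr (_ + _).
  apply: eq_bigr => i _; rewrite big_mkcond; apply: eq_bigr => j _.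
  rewrite /G /=; case: posnP => [j0|_]; last by rewrite !dyE.
  by rewrite j0 e0 mul1r subrr scaler0.
apply: eq_bigr => l _; under eq_bigr => b _ do rewrite big_mkcond.
rewrite exchange_big /=; apply: eq_bigr => k _.
have [b [br kb E1]] := ldtP k; rewrite (bigD1 (Ordinal br))//= big1 => [|b' bb'].
  rewrite addr0; rewrite /G /=; case: ifPn => [_|nk]; first by rewrite !dtE E1.
  (* In its own block, k fails the strict inequality only by being the first index. *)
  have kE : ldt k = k.
    apply/val_inj; rewrite /= E1; apply/eqP; move: nk; case/andP: kb => h1 ->.
    by rewrite andbT -leqNgt eqn_leq h1.
  have -> : a`_k = 1 by rewrite -kE E1; exact: (A1_unit hA1).
  by rewrite kE mul1r subrr scaler0.
case: ifPn => // /andP[h1 h2]; case/eqP: bb'; apply/val_inj => /=.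
by apply: (@block_unique b' b k) => //; rewrite ltnW.
Qed.

(** Evaluating the form d''F on the coordinate vectors separates the equations. *)
Lemma qS_cr_system (F : X -> fdnormed L) x :
  (differentiable F x /\ forall h, dbar e eps r s a F x h = 0) <->
  cr_system basis_dir basis_coef leader F x.
Proof.
split=> -[dF H]; (split; first exact: dF).
  move=> d; have := H (basis_dir d); rewrite dbarE// (bigD1 d)//= big1 => [|d' dd'].
    by rewrite basis_coord_dir eqxx scale1r addr0; exact: subr0_eq.
  by rewrite basis_coord_dir (negbTE dd') scale0r.
by move=> h; rewrite dbarE// big1// => d _; rewrite H subrr scaler0.
Qed.

Definition basis_coord_linear d : {linear X -> R} := basis_coord d.

End Leader.
End Translation.

Theorem mainTheorem5 (R : realType) (L : falgType R) (L0 L1 : {vspace L})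
    (p : nat) (e : p.+1.-tuple L)
    (q : nat) (eps : q.-tuple L) (r : nat) (s : nat -> nat) (a : q.-tuple L)
    (n m : nat)
    (hL : is_csa L0 L1) (hA0 : condA0 L0 e) (hA1 : condA1 L0 L1 eps r s a)
    (hdim : (n * p.+1 + m * q != 2)%N)
    (Omega : set (superspace L0 L1 n m))
    (Omega_open : open Omega) (Omega_connected : connected Omega)
    (Omega_bounded : bounded_set Omega)
    (bd_connected : connected (boundary Omega))
    (V : set (superspace L0 L1 n m)) (f : superspace L0 L1 n m -> fdnormed L)
    (V_open : open V) (bd_sub_V : boundary Omega `<=` V)
    (f_qS : qS_differentiable e eps r s a V f) :
  exists (F : superspace L0 L1 n m -> fdnormed L)
         (W : set (superspace L0 L1 n m)),
    [/\ open W, boundary Omega `<=` W, W `<=` V,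
        forall x, W x -> F x = f x
      & qS_differentiable e eps r s a (Omega `|` W) F].
Proof.
have [ldt ldtP] := block_leader hA1.
have E (F : superspace L0 L1 n m -> fdnormed L) x := qS_cr_system hA0 hA1 ldtP F x.
pose B : finType := ('I_n * 'I_p.+1 + 'I_m * 'I_q)%type.
have hdim' : #|B| != 2%N by rewrite card_basis.
have [F [W [oW bW WV FW FCR]]] := @hartogs_coordinates R L (superspace L0 L1 n m) _
  (@basis_dir R L L0 L1 p e q eps n m) (@basis_coord_linear R L L0 L1 p e q eps n m)
  (@basis_coef R L p e q a n m) (@leader p q n m ldt)
  (basis_sum hA0 hA1) (basis_coord_dir hA0 hA1) (basis_coef_central hL hA0 hA1)
  (leaderK hA1 ldtP) (leader_coef hA0 hA1 ldtP) (leader_sq hA0 hA1 ldtP) hdim'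
  Omega V f Omega_open Omega_bounded bd_connected V_open bd_sub_V
  (fun y Vy => (E f y).1 (f_qS y Vy)).
by exists F, W; split=> // y Wy; apply/E; exact: FCR.
Qed.
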